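(* Let $n\in\mathbb{N}$. Then $\mathcal{R}_{(n)}$ consists of all operators belonging to $\mathcal{B}(\mathcal{F}_{(n)})$ that are diagonal with respect to the orthonormal basis $(b_{p,n-1})_{p=0}^\infty$ of $\mathcal{F}_{(n)}$. Furthermore, $\mathcal{R}_{(n)}\cong\ell^\infty(\mathbb{N}_0)$, where $\cong$ means that the algebras are isometrically isomorphic.
   Context: $\mathbb{N}=\{1,2,\ldots\}$, $\mathbb{N}_0=\{0,1,2,\ldots\}$, $\mathbb{T}=\{z\in\mathbb{C}: |z|=1\}$. $\mu$ is the Lebesgue measure on $\mathbb{C}$ and $\gamma$ is the Gaussian measure $d\gamma(z)=\frac1\pi e^{-|z|^2}d\mu(z)$. $\mathcal{F}_n$ is the (closed) subspace of $L^2(\mathbb{C},\gamma)$ consisting of all $n$-analytic functions (smooth $f$ with $\partial^n f/\partial\overline{z}^n=0$) belonging to $L^2(\mathbb{C},\gamma)$, and $\mathcal{F}_0=\{0\}$. The true-$n$-polyanalytic Fock space is $\mathcal{F}_{(n)}=\{f\in\mathcal{F}_n: f\perp\mathcal{F}_{n-1}\}$. Normalized complex Hermite polynomials: with $A^\dagger f=\left(\overline{z}-\frac{\partial}{\partial z}\right)f$ and $\overline{A}^\dagger f=\left(z-\frac{\partial}{\partial\overline{z}}\right)f$, put $b_{p,q}=\frac{1}{\sqrt{p!\,q!}}(A^\dagger)^q(\overline{A}^\dagger)^p\,1$ for $p,q\in\mathbb{N}_0$, where $1$ is the constant function. The sequence $(b_{p,n-1})_{p\in\mathbb{N}_0}$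 is an orthonormal basis of $\mathcal{F}_{(n)}$. For $\tau\in\mathbb{T}$, $R_{(n),\tau}$ is the rotation operator on $\mathcal{F}_{(n)}$, $(R_{(n),\tau}f)(z)=f(\tau^{-1}z)$; $\mathcal{R}_{(n)}$ (the algebra of radial operators in $\mathcal{F}_{(n)}$) is the von Neumann algebra of all $S\in\mathcal{B}(\mathcal{F}_{(n)})$ that commute with $R_{(n),\tau}$ for every $\tau\in\mathbb{T}$. *)

(* Defs.v *)
From HB Require Import structures.
From mathcomp Require Import all_boot all_order all_algebra.
From mathcomp Require Import complex.
From mathcomp Require Import all_classical all_reals all_analysis measurable_realfun.
From mathcomp Require Import ring lra.

Set Implicit Arguments.
Unset Strict Implicit.
Unset Printing Implicit Defensive.

Import Order.TTheory GRing.Theory Num.Theory.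
Import numFieldNormedType.Exports.
Import Normc.

Local Open Scope classical_set_scope.
Local Open Scope complex_scope.
Local Open Scope ring_scope.

(* The complex plane is R[i]; measure theory and real differentiation take
   place on R * R, and [cplx] / [uncplx] identify the two.  [Re] and [Im] are
   qualified because the ones of numClosedFieldType take values in R[i], and
   [normc : R[i] -> R] is used for the modulus to get values in R. *)

Section calculus.
Variable R : realType.
Implicit Types (f g : R[i] -> R[i]) (p v : R * R).

Definition cplx (p : R * R) : R[i] := p.1 +i* p.2.

Definition uncplx (z : R[i]) : R * R := (complex.Re z, complex.Im z).

(* f read as a map from R^2 to R^2. *)
Definition plane f : R * R -> R * R := uncplx \o f \o cplx.

Definition pderiv (v : R * R) f : R[i] -> R[i] :=
  fun z => cplx ('D_v (plane f) (uncplx z)).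

Definition dx := pderiv (1, 0).
Definition dy := pderiv (0, 1).

Definition dz f : R[i] -> R[i] := fun z => (dx f z - 'i%C * dy f z) / 2.
Definition dzbar f : R[i] -> R[i] := fun z => (dx f z + 'i%C * dy f z) / 2.

(* f is k times (Frechet) differentiable as a map from R^2 to R^2: it is
   differentiable and both its partial derivatives are k-1 times so. *)
Fixpoint diff_upto (k : nat) f : Prop :=
  if k is k'.+1 then
    [/\ forall p, differentiable (plane f) p,
        diff_upto k' (dx f) & diff_upto k' (dy f)]
  else True.

Definition smooth f : Prop := forall k, diff_upto k f.

Lemma cplxK : cancel cplx uncplx. Proof. by case. Qed.

Lemma uncplxK : cancel uncplx cplx. Proof. by case. Qed.

Definition planeM (c : R[i]) (p : R * R) : R * R := uncplx (c * cplx p).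

Lemma planeM_linear c : linear (planeM c).
Proof.
case: c => c1 c2 a [u1 u2] [v1 v2]; rewrite /planeM /uncplx /=.
by congr pair => /=; rewrite /GRing.scale /=; ring.
Qed.

HB.instance Definition _ c :=
  GRing.isLinear.Build R (R * R)%type (R * R)%type _ (planeM c)
    (planeM_linear c).

Lemma planeM_continuous c : continuous (planeM c).
Proof.
have h (a b : R) : continuous (fun p : R * R => a * p.1 + b * p.2).
  move=> q; apply: cvgD; apply: cvgM; try exact: cvg_cst.
    exact: cvg_fst.
  exact: cvg_snd.
case: c => c1 c2 p.
have -> : planeM (c1 +i* c2) =
    (fun p => (c1 * p.1 + - c2 * p.2, c2 * p.1 + c1 * p.2)).
  by apply/funext => -[x y]; rewrite /planeM /uncplx /=; congr pair; ring.
exact: cvg_pair (h c1 (- c2) p) (h c2 c1 p).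
Qed.

Lemma differentiable_planeM c p : differentiable (planeM c) p.
Proof. by apply: linear_differentiable; exact: planeM_continuous. Qed.

Lemma diff_planeM c p : 'd (planeM c) p = planeM c :> (R * R -> R * R).
Proof. exact: (@diff_lin _ _ _ (planeM c)) (@planeM_continuous c). Qed.

Lemma derive_planeM_comp c (F : R * R -> R * R) v p : differentiable F p ->
  'D_v (planeM c \o F) p = planeM c ('D_v F p).
Proof.
move=> dF; have dM q := differentiable_planeM c q.
rewrite [LHS]deriveE; last exact: differentiable_comp.
rewrite [X in X v]diff_comp// [in RHS]deriveE//.
by rewrite compE; exact: (congr1 (@^~ ('d F p v)) (diff_planeM c (F p))).
Qed.

Lemma derive_comp_planeM c (F : R * R -> R * R) v p :
  differentiable F (planeM c p) ->
  'D_v (F \o planeM c) p = 'D_(planeM c v) F (planeM c p).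
Proof.
move=> dF; have dM q := differentiable_planeM c q.
rewrite [LHS]deriveE; last exact: differentiable_comp.
rewrite [X in X v]diff_comp// [in RHS]deriveE//.
by rewrite compE; exact: (congr1 (fun h => 'd F (planeM c p) (h v)) (diff_planeM c p)).
Qed.

Lemma cplxM c p : cplx (planeM c p) = c * cplx p.
Proof. by rewrite /planeM uncplxK. Qed.

Lemma cplxD p v : cplx (p + v) = cplx p + cplx v. Proof. by []. Qed.

Lemma plane_lin (a : R[i]) f g :
  plane (a *: f + g) = (planeM a \o plane f) + plane g.
Proof.
apply/funext => p; rewrite /plane /= /planeM !fctE/= uncplxK /GRing.scale/=.
by case: (a * f _) (g _) => ? ? [].
Qed.

Lemma plane_rot (c : R[i]) f :
  plane (fun z => f (c * z)) = plane f \o planeM c.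
Proof. by apply/funext => p; rewrite /plane /= cplxM. Qed.

Lemma pderiv_lin v (a : R[i]) f g :
  (forall p, differentiable (plane f) p) ->
  (forall p, differentiable (plane g) p) ->
  pderiv v (a *: f + g) = a *: pderiv v f + pderiv v g.
Proof.
move=> df dg; apply/funext => z; rewrite /pderiv plane_lin.
have dMf p : differentiable (planeM a \o plane f) p.
  by apply: differentiable_comp => //; exact: differentiable_planeM.
rewrite deriveD; [|exact: diff_derivable..].
rewrite cplxD !fctE; congr (_ + _).
by rewrite derive_planeM_comp// cplxM.
Qed.

Lemma differentiable_lin (a : R[i]) f g :
  (forall p, differentiable (plane f) p) ->
  (forall p, differentiable (plane g) p) ->
  forall p, differentiable (plane (a *: f + g)) p.
Proof.
move=> df dg p; rewrite plane_lin; apply: differentiableD => //.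
by apply: differentiable_comp => //; exact: differentiable_planeM.
Qed.

Lemma pderivE f v z : (forall p, differentiable (plane f) p) ->
  pderiv v f z = v.1%:C * dx f z + v.2%:C * dy f z.
Proof.
move=> df; rewrite /dx /dy /pderiv !deriveE//.
have vE : v = v.1 *: (1, 0) + v.2 *: (0, 1).
  case: v => a b; congr pair.
    by rewrite -[RHS]/(a * 1 + b * 0) mulr1 mulr0 addr0.
  by rewrite -[RHS]/(a * 0 + b * 1) mulr1 mulr0 add0r.
rewrite [in LHS]vE linearD !linearZ.
move: ('d _ _ ((1, 0) : R * R)) ('d _ _ ((0, 1) : R * R)) => A B.
case: v {vE} A B => [a b] [A1 A2] [B1 B2].
rewrite /cplx /= /GRing.scale /=.
by apply/eqP; rewrite eq_complex /=; apply/andP; split; apply/eqP; ring.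
Qed.

Lemma pderiv_rot (c : R[i]) v f :
  (forall p, differentiable (plane f) p) ->
  pderiv v (fun z => f (c * z)) = fun z => pderiv (planeM c v) f (c * z).
Proof.
move=> df; apply/funext => z; rewrite /pderiv plane_rot.
rewrite (@derive_comp_planeM c (plane f) v (uncplx z) (df _)).
have E : planeM c (uncplx z) = uncplx (c * z) by rewrite /planeM uncplxK.
by rewrite E.
Qed.

Lemma differentiable_rot (c : R[i]) f :
  (forall p, differentiable (plane f) p) ->
  forall p, differentiable (plane (fun z => f (c * z))) p.
Proof.
move=> df p; rewrite plane_rot.
by apply: differentiable_comp => //; exact: differentiable_planeM.
Qed.

Lemma diff_uptoS k f : diff_upto k.+1 f =
  [/\ forall p, differentiable (plane f) p,
      diff_upto k (dx f) & diff_upto k (dy f)].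
Proof. by []. Qed.

Lemma dx_lin (a : R[i]) f g :
  (forall p, differentiable (plane f) p) ->
  (forall p, differentiable (plane g) p) ->
  dx (a *: f + g) = a *: dx f + dx g.
Proof. exact: pderiv_lin. Qed.

Lemma dy_lin (a : R[i]) f g :
  (forall p, differentiable (plane f) p) ->
  (forall p, differentiable (plane g) p) ->
  dy (a *: f + g) = a *: dy f + dy g.
Proof. exact: pderiv_lin. Qed.

Lemma diff_upto_lin k (a : R[i]) f g :
  diff_upto k f -> diff_upto k g -> diff_upto k (a *: f + g).
Proof.
elim: k f g => [|k IH] f g; first by [].
rewrite !diff_uptoS => -[df fx fy] [dg gx gy]; split.
- exact: differentiable_lin.
- rewrite (dx_lin a df dg); exact: (IH _ _ fx gx).
- rewrite (dy_lin a df dg); exact: (IH _ _ fy gy).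
Qed.

Lemma pderiv_cst v (a : R[i]) : pderiv v (cst a) = cst 0.
Proof.
apply/funext => z; rewrite /pderiv.
have -> : plane (cst a) = cst (uncplx a) by [].
by rewrite derive_cst.
Qed.

Lemma diff_upto_cst k (a : R[i]) : diff_upto k (cst a).
Proof.
elim: k a => [|k IH] a; first by [].
rewrite diff_uptoS; split.
- move=> p; exact: (@differentiable_cst _ _ _ (uncplx a) p).
- by rewrite [dx _](pderiv_cst (1, 0) a); exact: IH.
- by rewrite [dy _](pderiv_cst (0, 1) a); exact: IH.
Qed.

Lemma diff_upto_rot k (c : R[i]) f :
  diff_upto k f -> diff_upto k (fun z => f (c * z)).
Proof.
elim: k f => [|k IH] f; first by [].
rewrite !diff_uptoS => -[df fx fy].
have comb v : diff_upto k (fun z => pderiv v f (c * z)).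
  have -> : (fun z => pderiv v f (c * z)) =
      v.1%:C *: (fun z => dx f (c * z)) +
      (v.2%:C *: (fun z => dy f (c * z)) + cst 0).
    apply/funext => z; rewrite (pderivE v _ df).
    rewrite -[RHS]/(v.1%:C * dx f (c * z) + (v.2%:C * dy f (c * z) + 0)).
    by move: (dx f _) (dy f _) => A B; rewrite addr0.
  apply: diff_upto_lin; first exact: (IH _ fx).
  apply: diff_upto_lin; first exact: (IH _ fy).
  exact: diff_upto_cst.
split; first exact: (differentiable_rot c df).
- rewrite [dx _](pderiv_rot c (1, 0) df); exact: comb.
- rewrite [dy _](pderiv_rot c (0, 1) df); exact: comb.
Qed.

Lemma smooth_differentiable f : smooth f ->
  forall p, differentiable (plane f) p.
Proof. by move=> /(_ 1%N); rewrite diff_uptoS => -[]. Qed.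

Lemma smooth_cst (a : R[i]) : smooth (cst a).
Proof. move=> k; exact: diff_upto_cst. Qed.

Lemma smooth_lin (a : R[i]) f g : smooth f -> smooth g -> smooth (a *: f + g).
Proof. move=> sf sg k; exact: (diff_upto_lin a (sf k) (sg k)). Qed.

Lemma smooth_rot (c : R[i]) f : smooth f -> smooth (fun z => f (c * z)).
Proof. move=> sf k; exact: (diff_upto_rot c (sf k)). Qed.

Lemma smooth_dx f : smooth f -> smooth (dx f).
Proof. by move=> sf k; have := sf k.+1; rewrite diff_uptoS => -[_ fx _]. Qed.

Lemma smooth_dy f : smooth f -> smooth (dy f).
Proof. by move=> sf k; have := sf k.+1; rewrite diff_uptoS => -[_ _ fy]. Qed.

Lemma dzbarE f : dzbar f = (2^-1 : R[i]) *: dx f + ((2^-1 * 'i%C) *: dy f + cst 0).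
Proof.
apply/funext => z.
rewrite -[RHS]/(2^-1 * dx f z + (2^-1 * 'i%C * dy f z + 0)) /dzbar.
move: (dx f z) (dy f z) => A B; ring.
Qed.

Lemma smooth_dzbar f : smooth f -> smooth (dzbar f).
Proof.
move=> sf; rewrite dzbarE; apply: smooth_lin; first exact: (smooth_dx sf).
apply: smooth_lin; [exact: (smooth_dy sf)|exact: smooth_cst].
Qed.

Lemma smooth_iter_dzbar n f : smooth f -> smooth (iter n dzbar f).
Proof.
by move=> sf; elim: n => [|n IH]; [exact: sf|rewrite iterS; exact: smooth_dzbar].
Qed.

Lemma dzbar_lin (a : R[i]) f g : smooth f -> smooth g ->
  dzbar (a *: f + g) = a *: dzbar f + dzbar g.
Proof.
move=> /smooth_differentiable df /smooth_differentiable dg.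
apply/funext => z; rewrite /dzbar (dx_lin a df dg) (dy_lin a df dg).
rewrite -[LHS]/((a * dx f z + dx g z + 'i%C * (a * dy f z + dy g z)) / 2).
rewrite -[RHS]/(a * ((dx f z + 'i%C * dy f z) / 2) + (dx g z + 'i%C * dy g z) / 2).
move: (dx f z) (dx g z) (dy f z) (dy g z) => A B C D; ring.
Qed.

Lemma iter_dzbar_lin n (a : R[i]) f g : smooth f -> smooth g ->
  iter n dzbar (a *: f + g) = a *: iter n dzbar f + iter n dzbar g.
Proof.
move=> sf sg; elim: n => [|n IH]; first by [].
rewrite !iterS IH dzbar_lin//; exact: smooth_iter_dzbar.
Qed.

Lemma dzbar_rot (c : R[i]) f : smooth f ->
  dzbar (fun z => f (c * z)) = c^* *: (fun z => dzbar f (c * z)) .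
Proof.
move=> /smooth_differentiable df; apply/funext => z.
rewrite /dzbar [dx (fun _ => _)](pderiv_rot c (1, 0) df).
rewrite [dy (fun _ => _)](pderiv_rot c (0, 1) df).
rewrite !(pderivE _ _ df).
rewrite -[RHS]/(c^* * ((dx f (c * z) + 'i%C * dy f (c * z)) / 2)).
move: (dx f _) (dy f _) => A B.
case: c => c1 c2.
have -> : planeM (c1 +i* c2) (1, 0) = (c1, c2).
  by rewrite /planeM /uncplx /=; congr pair; ring.
have -> : planeM (c1 +i* c2) (0, 1) = (- c2, c1).
  by rewrite /planeM /uncplx /=; congr pair; ring.
have -> : (c1 +i* c2)^* = c1%:C - 'i%C * c2%:C.
  by apply/eqP; rewrite eq_complex /=; apply/andP; split; apply/eqP; ring.
rewrite -[(c1, c2).1]/c1 -[(c1, c2).2]/c2 -[(- c2, c1).1]/(- c2).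
rewrite -[(- c2, c1).2]/c1.
have -> : (- c2)%:C = - c2%:C :> R[i] by exact: rmorphN.
move: (c1%:C) (c2%:C) (sqr_i R) => a b; move: 'i%C => i ii.
ring: ii.
Qed.

Lemma iter_dzbar_rot n (c : R[i]) f : smooth f ->
  iter n dzbar (fun z => f (c * z)) =
  (c^* ^+ n) *: (fun z => iter n dzbar f (c * z)).
Proof.
move=> sf; elim: n => [|n IH]; first by rewrite expr0 scale1r.
rewrite iterS IH.
have s1 := smooth_iter_dzbar n sf.
have -> : c^* ^+ n *: (fun z => iter n dzbar f (c * z)) =
    c^* ^+ n *: (fun z => iter n dzbar f (c * z)) + cst 0.
  by rewrite -[cst 0]/(0 : R[i] -> R[i]) addr0.
rewrite dzbar_lin; [|exact: (smooth_rot c s1)|exact: smooth_cst].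
rewrite (dzbar_rot c s1) scalerA -exprSr iterS.
suff -> : dzbar (cst 0 : R[i] -> R[i]) = 0 by rewrite addr0.
apply/funext => z; rewrite /dzbar [dx _](pderiv_cst (1, 0) 0).
by rewrite [dy _](pderiv_cst (0, 1) 0) /= mulr0 addr0 mul0r.
Qed.

End calculus.

Arguments dx {R} f z.
Arguments dy {R} f z.
Arguments dz {R} f z.
Arguments dzbar {R} f z.

(* [measurableTypeR R] is R with its Borel sigma-algebra, the type on which
   [lebesgue_measure] is defined. *)
Notation mplane R := (measurableTypeR R * measurableTypeR R)%type.

Section gaussian.
Variable R : realType.

Local Notation mplane := (mplane R).
Local Notation leb2 := (@lebesgue_measure R \x @lebesgue_measure R)%E.

Definition gauss_density (p : R * R) : R :=
  pi^-1 * expR (- normc (cplx p) ^+ 2).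

Definition gauss_measure (A : set mplane) : \bar R :=
  (\int[leb2]_(p in A) (gauss_density p)%:E)%E.

Lemma gauss_density_ge0 p : 0 <= gauss_density p.
Proof. by rewrite mulr_ge0 ?expR_ge0// invr_ge0 pi_ge0. Qed.

Lemma gauss_densityE p :
  gauss_density p = pi^-1 * expR (- (p.1 ^+ 2 + p.2 ^+ 2)).
Proof.
by rewrite /gauss_density /normc/= sqr_sqrtr// addr_ge0// sqr_ge0.
Qed.

Lemma measurable_gauss_density :
  measurable_fun [set: mplane] (gauss_density : mplane -> R).
Proof.
rewrite (_ : (gauss_density : mplane -> R) =
  fun p : mplane => pi^-1 * expR (- (p.1 ^+ 2 + p.2 ^+ 2))); last first.
  by apply/funext => p; exact: gauss_densityE.
apply: measurable_funM => //; apply: measurableT_comp => //.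
apply: measurableT_comp => //.
by apply: measurable_funD; apply: measurable_funX;
  [exact: measurable_fst|exact: measurable_snd].
Qed.

Let gauss0 : gauss_measure set0 = 0%E.
Proof. by rewrite /gauss_measure integral_set0. Qed.

Let gauss_ge0 A : (0 <= gauss_measure A)%E.
Proof. by apply: integral_ge0 => x _; rewrite lee_fin gauss_density_ge0. Qed.

Let gauss_sigma_additive : semi_sigma_additive gauss_measure.
Proof.
move=> /= A mA tA mUA; rewrite /gauss_measure/= ge0_integral_bigcup//=.
- apply: is_cvg_ereal_nneg_natsum_cond => n _ _.
  by apply: integral_ge0 => /= x ?; rewrite lee_fin gauss_density_ge0.
- apply/measurable_EFinP; apply: measurable_funTS.
  exact: measurable_gauss_density.
- by move=> x _; rewrite lee_fin gauss_density_ge0.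
Qed.

HB.instance Definition _ := isMeasure.Build _ _ _
  gauss_measure gauss0 gauss_ge0 gauss_sigma_additive.

End gaussian.


Section rotation_invariance.
Variable R : realType.

Local Notation mplane := (mplane R).
Local Notation leb := (@lebesgue_measure R).
Local Notation leb2 := (@lebesgue_measure R \x @lebesgue_measure R)%E.

Lemma measurable_translate (b : R) :
  measurable_fun [set: measurableTypeR R]
    ((fun y => y + b) : measurableTypeR R -> measurableTypeR R).
Proof. by apply: measurable_funD. Qed.

Lemma lebesgue_translate (b : R) (A : set (measurableTypeR R)) :
  measurable A -> leb ((fun y => y + b) @^-1` A) = leb A.
Proof.
pose phi : {mfun measurableTypeR R >-> measurableTypeR R} :=
  HB.pack ((fun y => y + b) : measurableTypeR R -> measurableTypeR R)
    (isMeasurableFun.Build _ _ _ _ _ (measurable_translate b)).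
move=> mA.
apply/esym.
apply: (lebesgue_measure_unique (mu := pushforward leb phi)) => //.
move=> _ [[u v] _ <-] /=; rewrite /pushforward /=.
have -> : ((fun y => y + b) @^-1` `]u, v]) = `]u - b, v - b]%classic.
  by apply/seteqP; split => x /=; rewrite !in_itv/= ltrBlDr lerBrDr.
rewrite [LHS]lebesgue_measure_itv [RHS]lebesgue_measure_itv/= !lte_fin.
rewrite ltrD2r; case: ifP => // _.
by rewrite -!EFinB; congr EFin; ring.
Qed.

Definition leb2_invariant (phi : mplane -> mplane) :=
  measurable_fun [set: mplane] phi /\
  forall A, measurable A -> leb2 (phi @^-1` A) = leb2 A.

Lemma leb2_invariant_comp phi psi : leb2_invariant phi -> leb2_invariant psi ->
  leb2_invariant (psi \o phi).
Proof.
move=> [mphi iphi] [mpsi ipsi]; split; first exact: measurableT_comp.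
move=> A mA; rewrite comp_preimage iphi ?ipsi// -[X in measurable X]setTI.
exact: mpsi.
Qed.

Lemma leb2_invariant_swap : leb2_invariant (fun p => (p.2, p.1)).
Proof.
pose phi : mplane -> mplane := fun p => (p.2, p.1).
have mphi : measurable_fun [set: mplane] phi.
  by apply: measurable_fun_pair; [exact: measurable_snd|exact: measurable_fst].
split=> // A mA.
pose phi' : {mfun mplane >-> mplane} :=
  HB.pack phi (isMeasurableFun.Build _ _ _ _ _ mphi).
apply/esym.
apply: (product_measure_unique (m' := pushforward leb2 phi')) => // B C mB mC.
have E : phi @^-1` (B `*` C) = C `*` B.
  by apply/seteqP; split => -[x y] /= [].
rewrite -[LHS]/(leb2 (phi @^-1` (B `*` C))) E.
by rewrite product_measure1E// muleC.
Qed.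

Lemma leb2_invariant_sheary (a : R) :
  leb2_invariant (fun p => (p.1, p.2 + a * p.1)).
Proof.
have mphi : measurable_fun [set: mplane]
    ((fun p => (p.1, p.2 + a * p.1)) : mplane -> mplane).
  apply: measurable_fun_pair; first exact: measurable_fst.
  apply: measurable_funD; first exact: measurable_snd.
  by apply: measurable_funM => //; exact: measurable_fst.
split=> // A mA; rewrite /product_measure1.
apply: eq_integral => x _ /=.
rewrite -(lebesgue_translate (a * x) (measurable_xsection x mA)).
congr (leb _); apply/seteqP; split => y /=;
  by rewrite /xsection/= !inE.
Qed.

Lemma leb2_invariant_shearx (a : R) :
  leb2_invariant (fun p => (p.1 + a * p.2, p.2)).
Proof.
have -> : (fun p : mplane => (p.1 + a * p.2, p.2) : mplane) =
    (fun p : mplane => (p.2, p.1) : mplane) \o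
      (fun p : mplane => (p.1, p.2 + a * p.1) : mplane) \o
      (fun p : mplane => (p.2, p.1) : mplane).
  by apply/funext => -[].
apply: leb2_invariant_comp; last first.
  exact: leb2_invariant_comp (leb2_invariant_sheary a) leb2_invariant_swap.
exact: leb2_invariant_swap.
Qed.

Lemma leb2_invariant_planeM_generic (c : R[i]) : normc c = 1 ->
  complex.Re c != -1 -> leb2_invariant (planeM c).
Proof.
case: c => c1 c2 /(congr1 (fun x => x ^+ 2)).
rewrite /normc/= expr1n sqr_sqrtr ?addr_ge0 ?sqr_ge0// => c12 c1N.
have c10 : 1 + c1 != 0 by rewrite addrC addr_eq0.
pose t := c2 / (1 + c1).
have tc : t * (1 + c1) = c2 by rewrite divfK.
have tc2 : t * c2 = 1 - c1.
  apply: (mulIf c10); rewrite mulrAC tc.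
  by rewrite -expr2; lra.
have -> : (planeM (c1 +i* c2) : mplane -> mplane) =
    (fun p : mplane => (p.1 + (- t) * p.2, p.2) : mplane) \o
      (fun p : mplane => (p.1, p.2 + c2 * p.1) : mplane) \o
      (fun p : mplane => (p.1 + (- t) * p.2, p.2) : mplane).
  apply/funext => -[x y] /=; rewrite /planeM /uncplx/=; congr pair.
    have -> : x + - t * y + - t * (y + c2 * (x + - t * y)) =
      x - t * c2 * x - t * y - t * y + t * c2 * (t * y) by ring.
    rewrite tc2 -tc; ring.
  have -> : y + c2 * (x + - t * y) = y + c2 * x - t * c2 * y by ring.
  rewrite tc2; ring.
apply: leb2_invariant_comp (leb2_invariant_shearx _).
exact: leb2_invariant_comp (leb2_invariant_shearx _) (leb2_invariant_sheary _).
Qed.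

Lemma planeM_comp (c d : R[i]) : planeM (c * d) = planeM c \o planeM d.
Proof. by apply/funext => p; rewrite /planeM/= uncplxK mulrA. Qed.

Lemma leb2_invariant_planeM (c : R[i]) : normc c = 1 ->
  leb2_invariant (planeM c).
Proof.
move=> c1; have [cN|cN] := eqVneq (complex.Re c) (-1); last first.
  exact: leb2_invariant_planeM_generic.
have [d [dd d1 dN]] : exists d : R[i],
    [/\ d * d = c, normc d = 1 & complex.Re d != -1].
  exists 'i%C; split.
  - case: c cN c1 => a b /= -> /(congr1 (fun x => x ^+ 2)).
    rewrite sqr_sqrtr ?addr_ge0 ?sqr_ge0// expr1n sqrrN expr1n.
    rewrite -[X in _ = X -> _]addr0 => /addrI/eqP; rewrite sqrf_eq0 => /eqP ->.
    by rewrite -[LHS]/(_ ^+ 2) sqr_i; apply/eqP; rewrite eq_complex/= oppr0 !eqxx.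
  - by rewrite /= expr0n add0r expr1n sqrtr1.
  - by rewrite /= eq_sym oppr_eq0 oner_eq0.
rewrite -dd planeM_comp.
by apply: leb2_invariant_comp; exact: leb2_invariant_planeM_generic.
Qed.

Lemma gauss_density_planeM (c : R[i]) p : normc c = 1 ->
  gauss_density (planeM c p) = gauss_density p.
Proof. by move=> c1; rewrite /gauss_density cplxM normcM c1 mul1r. Qed.

Lemma measurable_planeM (c : R[i]) : normc c = 1 ->
  measurable_fun [set: mplane] (planeM c : mplane -> mplane).
Proof. by move=> /leb2_invariant_planeM[]. Qed.

Lemma leb2_integral_planeM (c : R[i]) (F : mplane -> \bar R) : normc c = 1 ->
  measurable_fun [set: mplane] F -> (forall p, 0 <= F p)%E ->
  (\int[leb2]_p F (planeM c p) = \int[leb2]_p F p)%E.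
Proof.
move=> c1 mF F0; have [mphi iphi] := leb2_invariant_planeM c1.
have F0' : {in [set: mplane], forall p, (0 <= F p)%E} by move=> p _; exact: F0.
have E := @ge0_integral_pushforward _ _ _ _ R _ mphi leb2 setT F measurableT mF F0'.
rewrite preimage_setT in E.
apply: (etrans (esym E)).
apply: eq_measure_integral => A mA _; exact: (iphi A mA).
Qed.

Lemma gauss_measure_planeM (c : R[i]) A : normc c = 1 -> measurable A ->
  gauss_measure ((planeM c : mplane -> mplane) @^-1` A) = gauss_measure A.
Proof.
move=> c1 mA; have [mphi iphi] := leb2_invariant_planeM c1.
rewrite /gauss_measure integral_mkcond [RHS]integral_mkcond.
rewrite -[RHS](leb2_integral_planeM c1); first last.
- by move=> p; rewrite erestrict_ge0// => x _; rewrite lee_fin gauss_density_ge0.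
- apply/(measurable_restrictT _ mA)/measurable_EFinP/measurable_funTS.
  exact: measurable_gauss_density.
by apply: eq_integral => p _; rewrite !patchE gauss_density_planeM//.
Qed.

Lemma ge0_gauss_integral_planeM (c : R[i]) (F : mplane -> \bar R) :
  normc c = 1 -> measurable_fun [set: mplane] F -> (forall p, 0 <= F p)%E ->
  (\int[@gauss_measure R]_p F (planeM c p) = \int[@gauss_measure R]_p F p)%E.
Proof.
move=> c1 mF F0; have mphi := measurable_planeM c1.
have F0' : {in [set: mplane], forall p, (0 <= F p)%E} by move=> p _; exact: F0.
have E := @ge0_integral_pushforward _ _ _ _ R _ mphi (@gauss_measure R)
  setT F measurableT mF F0'.
rewrite preimage_setT in E.
apply: (etrans (esym E)).
apply: eq_measure_integral => A mA _; exact: (gauss_measure_planeM c1 mA).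
Qed.

Lemma gauss_integral_planeM (c : R[i]) (F : mplane -> \bar R) :
  normc c = 1 -> measurable_fun [set: mplane] F ->
  (\int[@gauss_measure R]_p F (planeM c p) = \int[@gauss_measure R]_p F p)%E.
Proof.
move=> c1 mF; rewrite integralE [RHS]integralE.
congr (_ - _)%E.
- rewrite -(ge0_gauss_integral_planeM c1 (measurable_funepos mF)); last first.
    by move=> p; exact: funepos_ge0.
  by apply: eq_integral => p _; rewrite !funeposE.
- rewrite -(ge0_gauss_integral_planeM c1 (measurable_funeneg mF)); last first.
    by move=> p; exact: funeneg_ge0.
  by apply: eq_integral => p _; rewrite !funenegE.
Qed.

End rotation_invariance.

Section L2.
Variable R : realType.
Implicit Types f g h : R[i] -> R[i].

Local Notation mplane := (mplane R).
Local Notation gauss := (@gauss_measure R).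

Definition L2 f : Prop :=
  measurable_fun [set: mplane] (plane f : mplane -> mplane) /\
  (\int[gauss]_p (normc (f (cplx p)) ^+ 2)%:E < +oo)%E.

Definition gauss_integral (F : R[i] -> R[i]) : R[i] :=
  (\int[gauss]_p complex.Re (F (cplx p))) +i*
  (\int[gauss]_p complex.Im (F (cplx p))).

Definition inner f g : R[i] := gauss_integral (fun z => f z * (g z)^*).

Lemma normc_ge0 (z : R[i]) : 0 <= normc z.
Proof. by case: z => a b; exact: sqrtr_ge0. Qed.

Lemma normcE2 (z : R[i]) : normc z ^+ 2 = complex.Re z ^+ 2 + complex.Im z ^+ 2.
Proof. by case: z => a b /=; rewrite sqr_sqrtr// addr_ge0 ?sqr_ge0. Qed.

Lemma measurable_Re f : measurable_fun [set: mplane] (plane f : mplane -> mplane) ->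
  measurable_fun [set: mplane] ((fun p => complex.Re (f (cplx p))) : mplane -> R).
Proof. by move=> mf; exact: (measurableT_comp measurable_fst mf). Qed.

Lemma measurable_Im f : measurable_fun [set: mplane] (plane f : mplane -> mplane) ->
  measurable_fun [set: mplane] ((fun p => complex.Im (f (cplx p))) : mplane -> R).
Proof. by move=> mf; exact: (measurableT_comp measurable_snd mf). Qed.

Lemma measurable_planeP f :
  measurable_fun [set: mplane] ((fun p => complex.Re (f (cplx p))) : mplane -> R) ->
  measurable_fun [set: mplane] ((fun p => complex.Im (f (cplx p))) : mplane -> R) ->
  measurable_fun [set: mplane] (plane f : mplane -> mplane).
Proof. by move=> mr mi; exact: measurable_fun_pair. Qed.

Lemma measurable_normc2 f :
  measurable_fun [set: mplane] (plane f : mplane -> mplane) ->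
  measurable_fun [set: mplane] ((fun p => normc (f (cplx p)) ^+ 2) : mplane -> R).
Proof.
move=> mf.
have -> : ((fun p => normc (f (cplx p)) ^+ 2) : mplane -> R) = fun p =>
    complex.Re (f (cplx p)) ^+ 2 + complex.Im (f (cplx p)) ^+ 2.
  by apply/funext => p; exact: normcE2.
apply: measurable_funD; apply: measurable_funX.
- exact: measurable_Re.
- exact: measurable_Im.
Qed.

Lemma Re_mulc (z w : R[i]) : complex.Re (z * w) =
  complex.Re z * complex.Re w - complex.Im z * complex.Im w.
Proof. by case: z w => a b []. Qed.

Lemma Im_mulc (z w : R[i]) : complex.Im (z * w) =
  complex.Re z * complex.Im w + complex.Im z * complex.Re w.
Proof. by case: z w => a b []. Qed.

Lemma Re_addc (z w : R[i]) : complex.Re (z + w) = complex.Re z + complex.Re w.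
Proof. by case: z w => a b []. Qed.

Lemma Im_addc (z w : R[i]) : complex.Im (z + w) = complex.Im z + complex.Im w.
Proof. by case: z w => a b []. Qed.

Lemma Re_conjc (z : R[i]) : complex.Re z^* = complex.Re z.
Proof. by case: z. Qed.

Lemma Im_conjc (z : R[i]) : complex.Im z^* = - complex.Im z.
Proof. by case: z. Qed.

Lemma measurable_plane_lin (a : R[i]) f g :
  measurable_fun [set: mplane] (plane f : mplane -> mplane) ->
  measurable_fun [set: mplane] (plane g : mplane -> mplane) ->
  measurable_fun [set: mplane] (plane (a *: f + g) : mplane -> mplane).
Proof.
move=> mf mg; have fr := measurable_Re mf; have fi := measurable_Im mf.
have gr := measurable_Re mg; have gi := measurable_Im mg.
apply: measurable_planeP.
- have -> : ((fun p => complex.Re ((a *: f + g) (cplx p))) : mplane -> R) =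
    fun p => (complex.Re a * complex.Re (f (cplx p)) -
              complex.Im a * complex.Im (f (cplx p))) + complex.Re (g (cplx p)).
    by apply/funext => p; rewrite -Re_mulc -Re_addc.
  apply: measurable_funD => //.
  by apply: measurable_funB; apply: measurable_funM.
- have -> : ((fun p => complex.Im ((a *: f + g) (cplx p))) : mplane -> R) =
    fun p => (complex.Re a * complex.Im (f (cplx p)) +
              complex.Im a * complex.Re (f (cplx p))) + complex.Im (g (cplx p)).
    by apply/funext => p; rewrite -Im_mulc -Im_addc.
  apply: measurable_funD => //.
  by apply: measurable_funD; apply: measurable_funM.
Qed.

Lemma L2_integrable f : L2 f ->
  gauss.-integrable [set: mplane] (fun p => (normc (f (cplx p)) ^+ 2)%:E).
Proof.
move=> [mf foo]; apply/integrableP; split.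
  by apply/measurable_EFinP; exact: measurable_normc2.
apply: le_lt_trans foo; rewrite le_eqVlt; apply/orP; left; apply/eqP.
by apply: eq_integral => p _; rewrite abse_EFin ger0_norm// sqr_ge0.
Qed.

Lemma integrable_dom (F G : mplane -> R) :
  measurable_fun [set: mplane] F ->
  gauss.-integrable [set: mplane] (EFin \o G) ->
  (forall p, `|F p| <= G p) -> gauss.-integrable [set: mplane] (EFin \o F).
Proof.
move=> mF iG FG; apply: (le_integrable measurableT _ _ iG) => //.
  exact/measurable_EFinP.
move=> p _ /=; rewrite lee_fin (le_trans (FG p))// ler_norm//.
Qed.

Lemma L2_lin (a : R[i]) f g : L2 f -> L2 g -> L2 (a *: f + g).
Proof.
move=> Lf Lg; have [[mf _] [mg _]] := (Lf, Lg).
have ml := measurable_plane_lin a mf mg; split => //.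
have i1 : gauss.-integrable [set: mplane]
    (EFin \o (fun p => 2 * normc a ^+ 2 * normc (f (cplx p)) ^+ 2 +
                       2 * normc (g (cplx p)) ^+ 2)).
  have -> : EFin \o (fun p => 2 * normc a ^+ 2 * normc (f (cplx p)) ^+ 2 +
                       2 * normc (g (cplx p)) ^+ 2) =
    (fun p : mplane => (2 * normc a ^+ 2)%:E * (normc (f (cplx p)) ^+ 2)%:E +
              2%:E * (normc (g (cplx p)) ^+ 2)%:E)%E by [].
  by apply: integrableD => //; apply: integrableZl => //; exact: L2_integrable.
have : gauss.-integrable [set: mplane]
    (EFin \o (fun p => normc ((a *: f + g) (cplx p)) ^+ 2)).
  apply: (integrable_dom _ i1); first exact: measurable_normc2.
  move=> p; rewrite ger0_norm ?sqr_ge0//.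
  rewrite -[(a *: f + g) (cplx p)]/(a * f (cplx p) + g (cplx p)).
  move: (f _) (g _) => u v.
  have := le_normcD (a * u) v; rewrite normcM => /(lerXn2r 2).
  rewrite !nnegrE => /(_ (normc_ge0 _)) H.
  apply: le_trans (H _) _; first by rewrite addr_ge0 ?mulr_ge0 ?normc_ge0.
  rewrite -subr_ge0.
  have -> : 2 * normc a ^+ 2 * normc u ^+ 2 + 2 * normc v ^+ 2 -
    (normc a * normc u + normc v) ^+ 2 = (normc a * normc u - normc v) ^+ 2.
    by ring.
  exact: sqr_ge0.
move=> /integrableP[_]; apply: le_lt_trans.
rewrite le_eqVlt; apply/orP; left; apply/eqP.
by apply: eq_integral => p _; rewrite abse_EFin ger0_norm// sqr_ge0.
Qed.

End L2.

Section fock.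
Variable R : realType.
Implicit Types f g h : R[i] -> R[i].

Local Notation mplane := (mplane R).
Local Notation gauss := (@gauss_measure R).

Definition cintegrable (F : R[i] -> R[i]) : Prop :=
  gauss.-integrable [set: mplane] (EFin \o (fun p => complex.Re (F (cplx p)))) /\
  gauss.-integrable [set: mplane] (EFin \o (fun p => complex.Im (F (cplx p)))).

Lemma RintegralDZ (a b : R) (F G : mplane -> R) :
  gauss.-integrable [set: mplane] (EFin \o F) ->
  gauss.-integrable [set: mplane] (EFin \o G) ->
  (\int[gauss]_p (a * F p + b * G p) =
   a * (\int[gauss]_p F p) + b * (\int[gauss]_p G p)) /\
  gauss.-integrable [set: mplane] (EFin \o (fun p => a * F p + b * G p)).
Proof.
move=> iF iG.
have iaF : gauss.-integrable [set: mplane] (EFin \o (fun p => a * F p)).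
  exact: (integrableZl measurableT a iF).
have ibG : gauss.-integrable [set: mplane] (EFin \o (fun p => b * G p)).
  exact: (integrableZl measurableT b iG).
split; first by rewrite RintegralD// !RintegralZl.
exact: (integrableD measurableT iaF ibG).
Qed.

Lemma gauss_integral_lin (a : R[i]) (F G : R[i] -> R[i]) :
  cintegrable F -> cintegrable G ->
  gauss_integral (fun z => a * F z + G z) =
  a * gauss_integral F + gauss_integral G.
Proof.
case: a => a b [Fr Fi] [Gr Gi].
pose F1 (p : mplane) := complex.Re (F (cplx p)).
pose F2 (p : mplane) := complex.Im (F (cplx p)).
pose G1 (p : mplane) := complex.Re (G (cplx p)).
pose G2 (p : mplane) := complex.Im (G (cplx p)).
have [e1 i1] := RintegralDZ a (- b) Fr Fi.
have [e2 i2] := RintegralDZ a b Fi Fr.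
have [e3 _] := RintegralDZ 1 1 i1 Gr.
have [e4 _] := RintegralDZ 1 1 i2 Gi.
apply/eqP; rewrite eq_complex; apply/andP; split; apply/eqP.
- rewrite Re_addc Re_mulc /=.
  transitivity (1 * (a * (\int[gauss]_p F1 p) + - b * (\int[gauss]_p F2 p)) +
     1 * (\int[gauss]_p G1 p)); last by rewrite !mul1r mulNr.
  rewrite -e1 -e3; apply: eq_Rintegral => p _.
  by rewrite Re_addc Re_mulc !mul1r mulNr.
- rewrite Im_addc Im_mulc /=.
  transitivity (1 * (a * (\int[gauss]_p F2 p) + b * (\int[gauss]_p F1 p)) +
     1 * (\int[gauss]_p G2 p)); last by rewrite !mul1r.
  rewrite -e2 -e4; apply: eq_Rintegral => p _.
  by rewrite Im_addc Im_mulc !mul1r.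
Qed.

Lemma L2_cintegrable f g : L2 f -> L2 g -> cintegrable (fun z => f z * (g z)^*).
Proof.
move=> Lf Lg; have [[mf _] [mg _]] := (Lf, Lg).
have iG : gauss.-integrable [set: mplane]
    (EFin \o (fun p => 1 * normc (f (cplx p)) ^+ 2 + 1 * normc (g (cplx p)) ^+ 2)).
  by have [] := RintegralDZ 1 1 (L2_integrable Lf) (L2_integrable Lg).
have fr := measurable_Re mf; have fi := measurable_Im mf.
have gr := measurable_Re mg; have gi := measurable_Im mg.
have key (x y u v : R) : `|x * u + y * v| <= (x ^+ 2 + y ^+ 2) + (u ^+ 2 + v ^+ 2).
  have h1 := sqr_ge0 (x - u); have h2 := sqr_ge0 (y - v).
  have h3 := sqr_ge0 (x + u); have h4 := sqr_ge0 (y + v).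
  rewrite ler_norml; apply/andP; split; nra.
split.
- apply: (integrable_dom _ iG).
    have -> : (fun p : mplane => complex.Re (f (cplx p) * (g (cplx p))^*)) =
      fun p => complex.Re (f (cplx p)) * complex.Re (g (cplx p)) +
               complex.Im (f (cplx p)) * complex.Im (g (cplx p)).
      by apply/funext => p; rewrite Re_mulc Re_conjc Im_conjc mulrN opprK.
    by apply: measurable_funD; apply: measurable_funM.
  move=> p; rewrite !mul1r !normcE2 Re_mulc Re_conjc Im_conjc mulrN opprK.
  exact: key.
- apply: (integrable_dom _ iG).
    have -> : (fun p : mplane => complex.Im (f (cplx p) * (g (cplx p))^*)) =
      fun p => complex.Im (f (cplx p)) * complex.Re (g (cplx p)) -
               complex.Re (f (cplx p)) * complex.Im (g (cplx p)).
      by apply/funext => p; rewrite Im_mulc Re_conjc Im_conjc mulrN addrC.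
    by apply: measurable_funB; apply: measurable_funM.
  move=> p; rewrite !mul1r !normcE2 Im_mulc Re_conjc Im_conjc.
  rewrite [X in `|X|]addrC; apply: le_trans (key _ _ _ _) _.
  by rewrite sqrrN (addrC (complex.Im _ ^+ 2)).
Qed.

Lemma inner_linl (a : R[i]) f g h : L2 f -> L2 g -> L2 h ->
  inner (a *: f + g) h = a * inner f h + inner g h.
Proof.
move=> Lf Lg Lh; rewrite /inner -gauss_integral_lin; try exact: L2_cintegrable.
congr gauss_integral; apply/funext => z.
by rewrite -[(a *: f + g) z]/(a * f z + g z) mulrDl mulrA.
Qed.

Lemma L2_rot (c : R[i]) f : normc c = 1 -> L2 f -> L2 (fun z => f (c * z)).
Proof.
move=> c1 [mf foo]; split.
  by rewrite plane_rot; exact: (measurableT_comp mf (measurable_planeM c1)).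
apply: le_lt_trans foo; rewrite le_eqVlt; apply/orP; left; apply/eqP.
pose F (p : mplane) := (normc (f (cplx p)) ^+ 2)%:E.
have mF : measurable_fun [set: mplane] F.
  by apply/measurable_EFinP; exact: measurable_normc2.
rewrite -[RHS](gauss_integral_planeM c1 mF).
by apply: eq_integral => p _; rewrite /F cplxM.
Qed.

Lemma gauss_integral_rot (c : R[i]) f :
  normc c = 1 -> measurable_fun [set: mplane] (plane f : mplane -> mplane) ->
  gauss_integral (fun z => f (c * z)) = gauss_integral f.
Proof.
move=> c1 mf.
have E (F : mplane -> R) : measurable_fun [set: mplane] F ->
    \int[gauss]_p F (planeM c p) = \int[gauss]_p F p.
  move=> /measurable_EFinP mF.
  by rewrite /Rintegral -[in RHS](gauss_integral_planeM c1 mF).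
congr (_ +i* _).
  rewrite -(E _ (measurable_Re mf)); apply: eq_Rintegral => p _.
  by rewrite cplxM.
rewrite -(E _ (measurable_Im mf)); apply: eq_Rintegral => p _.
by rewrite cplxM.
Qed.

Lemma measurable_plane_inner f g : L2 f -> L2 g ->
  measurable_fun [set: mplane]
    (plane (fun z => f z * (g z)^*) : mplane -> mplane).
Proof.
move=> Lf Lg; have [i1 i2] := L2_cintegrable Lf Lg.
apply: measurable_planeP; apply/measurable_EFinP.
  exact: measurable_int i1.
exact: measurable_int i2.
Qed.

Lemma normc_conj (c : R[i]) : normc c^* = normc c.
Proof. by case: c => a b; rewrite /= sqrrN. Qed.

Lemma unit_conjK (c : R[i]) : normc c = 1 -> c^* * c = 1.
Proof.
case: c => a b /(congr1 (fun x => x ^+ 2)).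
rewrite /= sqr_sqrtr ?addr_ge0 ?sqr_ge0// expr1n => ab.
apply/eqP; rewrite eq_complex /=; apply/andP; split; apply/eqP; last by ring.
by rewrite -ab; ring.
Qed.

Lemma inner_rot (c : R[i]) f g : normc c = 1 -> L2 f -> L2 g ->
  inner (fun z => f (c * z)) g = inner f (fun z => g (c^* * z)).
Proof.
move=> c1 Lf Lg; rewrite /inner.
have Lg' : L2 (fun z => g (c^* * z)) by apply: L2_rot; rewrite ?normc_conj.
rewrite -[RHS](gauss_integral_rot c1 (measurable_plane_inner Lf Lg')).
by congr gauss_integral; apply/funext => z; rewrite mulrA unit_conjK// mul1r.
Qed.

(* Elements of L^2(C, gamma) that are n-analytic are represented by their unique
   smooth representative, so F_n is a set of functions rather than of classes
   modulo equality almost everywhere.  For n = 0 the second condition says that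
   f vanishes, hence F_0 = {0}. *)
Definition polyfock (n : nat) f : Prop :=
  [/\ smooth f, forall z, iter n dzbar f z = 0 & L2 f].

Definition true_polyfock (n : nat) f : Prop :=
  polyfock n f /\ forall g, polyfock n.-1 g -> inner f g = 0.

Lemma L2_0 : L2 (0 : R[i] -> R[i]).
Proof.
split; first by apply: measurable_planeP; exact: (@measurable_cst _ _ _ _ _ (0 : R)).
rewrite integral0_eq ?ltry// => p _.
by rewrite /normc/= expr0n addr0 sqrtr0 expr0n.
Qed.

Lemma iter_dzbar0 n : iter n dzbar (0 : R[i] -> R[i]) = 0.
Proof.
elim: n => [|n IH]; first by [].
rewrite iterS IH; apply/funext => z.
by rewrite /dzbar [dx _](pderiv_cst (1, 0) 0) [dy _](pderiv_cst (0, 1) 0) /=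
  mulr0 addr0 mul0r.
Qed.

Lemma polyfock0 n : polyfock n 0.
Proof.
split; [exact: smooth_cst|by move=> z; rewrite iter_dzbar0|exact: L2_0].
Qed.

Lemma polyfock_lin n (a : R[i]) f g :
  polyfock n f -> polyfock n g -> polyfock n (a *: f + g).
Proof.
move=> [sf nf Lf] [sg ng Lg]; split.
- exact: smooth_lin.
- move=> z; rewrite iter_dzbar_lin//.
  rewrite -[LHS]/(a * iter n dzbar f z + iter n dzbar g z) nf ng.
  by rewrite mulr0 addr0.
- exact: L2_lin.
Qed.

Lemma polyfock_rot n (c : R[i]) f : normc c = 1 ->
  polyfock n f -> polyfock n (fun z => f (c * z)).
Proof.
move=> c1 [sf nf Lf]; split.
- exact: smooth_rot.
- move=> z; rewrite iter_dzbar_rot//.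
  rewrite -[LHS]/(c^* ^+ n * iter n dzbar f (c * z)) nf.
  by rewrite mulr0.
- exact: L2_rot.
Qed.

Lemma true_polyfock0 n : true_polyfock n 0.
Proof.
split; first exact: polyfock0.
move=> g [_ _ Lg]; have L0 := L2_0.
have := inner_linl 0 L0 L0 Lg.
by rewrite scale0r add0r mul0r add0r => E; have := inner_linl 1 L0 L0 Lg;
  rewrite scale1r add0r mul1r -[LHS]addr0 => /addrI/esym.
Qed.

Lemma true_polyfock_lin n (a : R[i]) f g :
  true_polyfock n f -> true_polyfock n g -> true_polyfock n (a *: f + g).
Proof.
move=> [pf of_] [pg og]; split; first exact: polyfock_lin.
move=> h ph; have [[_ _ Lf] [_ _ Lg] [_ _ Lh]] := And3 pf pg ph.
by rewrite inner_linl// of_// og// mulr0 addr0.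
Qed.

Lemma true_polyfock_rot n (c : R[i]) f : normc c = 1 ->
  true_polyfock n f -> true_polyfock n (fun z => f (c * z)).
Proof.
move=> c1 [pf of_]; split; first exact: polyfock_rot.
move=> g pg; have [[_ _ Lf] [_ _ Lg]] := (pf, pg).
by rewrite inner_rot// of_//; apply: polyfock_rot => //; rewrite normc_conj.
Qed.

(* Boolean version, over which [true_fock] below is a subtype and a subspace. *)
Definition true_polyfock_pred n : {pred R[i] -> R[i]} :=
  fun f => `[< true_polyfock n f >].

Lemma true_polyfock_submod n : submod_closed (true_polyfock_pred n).
Proof.
split; first by apply/asboolP; exact: true_polyfock0.
move=> a f g /asboolP Ff /asboolP Fg; apply/asboolP.
exact: true_polyfock_lin.
Qed.

HB.instance Definition _ n := GRing.isSubmodClosed.Build R[i] (R[i] -> R[i])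
  (true_polyfock_pred n) (true_polyfock_submod n).

End fock.

Definition circle (R : realType) : Type := {tau : R[i] | normc tau == 1}.

Definition true_fock (R : realType) (n : nat) : Type :=
  {f : R[i] -> R[i] | f \in true_polyfock_pred n}.

HB.instance Definition _ (R : realType) n := SubType.on (true_fock R n).
HB.instance Definition _ (R : realType) n := Choice.on (true_fock R n).
HB.instance Definition _ (R : realType) n :=
  [SubChoice_isSubLmodule of true_fock R n by <:].

Section hermite.
Variable R : realType.
Implicit Types f : R[i] -> R[i].

Definition creation f : R[i] -> R[i] := fun z => z^* * f z - dz f z.
Definition creation_bar f : R[i] -> R[i] := fun z => z * f z - dzbar f z.

Definition hermite (p q : nat) : R[i] -> R[i] :=
  ((Num.sqrt (p`! * q`!)%:R)^-1)%:C *: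
    iter q creation (iter p creation_bar (cst 1)).

End hermite.

Section operators.
Variables (R : realType) (n : nat).
Implicit Types (f g : true_fock R n) (S T : true_fock R n -> true_fock R n).

Definition fock_norm f : R := Num.sqrt (complex.Re (inner (\val f) (\val f))).

Definition bounded_operators : set (true_fock R n -> true_fock R n) :=
  [set S | linear S /\ exists M, forall f, fock_norm (S f) <= M * fock_norm f].

Definition opnorm S : R :=
  sup [set fock_norm (S f) | f in [set f | fock_norm f <= 1]].

Lemma rotation_subproof (tau : circle R) f :
  (fun z => \val f ((\val tau)^-1 * z)) \in true_polyfock_pred n.
Proof.
have c1 : normc (\val tau)^-1 = 1.
  by rewrite normcV (eqP (valP tau)) invr1.
apply/asboolP; apply: (true_polyfock_rot c1).
exact: (asboolP _ (valP f)).
Qed.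

Definition rotation (tau : circle R) f : true_fock R n :=
  exist _ (fun z => \val f ((\val tau)^-1 * z)) (rotation_subproof tau f).

Definition radial : set (true_fock R n -> true_fock R n) :=
  [set S | bounded_operators S /\
           forall tau, S \o rotation tau = rotation tau \o S].

(* S (e p) = lambda p *: e p for all p; e is given as a sequence of functions, and
   the existence of f says that each e p belongs to F_(n). *)
Definition diagonal_wrt (e : nat -> R[i] -> R[i]) S : Prop :=
  exists lambda : nat -> R[i], forall p,
    exists2 f : true_fock R n, \val f = e p & S f = lambda p *: f.

End operators.

Section isometric_isomorphism.
Variable R : realType.

Definition linf : set (nat -> R[i]) :=
  [set x | exists M, forall k, normc (x k) <= M].

Definition linf_norm (x : nat -> R[i]) : R := sup (range (fun k => normc (x k))).

(* Isometric isomorphism between the algebras A and B, given as sets of vectors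
   with a product and a norm. *)
Definition isometrically_isomorphic (U V : lmodType R[i])
    (A : set U) (mulU : U -> U -> U) (normU : U -> R)
    (B : set V) (mulV : V -> V -> V) (normV : V -> R) : Prop :=
  exists Phi : U -> V,
    [/\ set_bij A B Phi,
        forall (a : R[i]) x y, A x -> A y ->
          Phi (a *: x + y) = a *: Phi x + Phi y,
        forall x y, A x -> A y -> Phi (mulU x y) = mulV (Phi x) (Phi y) &
        forall x, A x -> normV (Phi x) = normU x].

End isometric_isomorphism.

(* Main.v *)
Require Import Defs.
From mathcomp Require Import all_boot all_order all_algebra.
From mathcomp Require Import complex.
From mathcomp Require Import all_classical all_reals all_analysis.
From mathcomp Require Import measurable_realfun ring lra.

Import Order.TTheory GRing.Theory Num.Theory.
Import numFieldNormedType.Exports.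
Import Normc.

(** Put q = n - 1 and b_p = b_(p,q). The rotation by tau multiplies b_p by
    tau^(q-p). These characters of the circle are pairwise distinct, so an
    operator S that commutes with all rotations sends b_p to a function whose
    Hermite coefficients of index r <> p vanish; as the b_p are complete in
    F_(n), b_p is an eigenvector of S ([radial_basis]). Conversely, if S is
    bounded and S b_p = lambda_p b_p, then S multiplies the p-th Hermite
    coefficient of every f by lambda_p ([coef_diagonal]); rotations act on
    these coefficients in the same way, so S commutes with them. The
    isomorphism with l^infty maps S to (lambda_p)_p: it is isometric by Bessel
    and Parseval, and onto because, by Riesz-Fischer, (x_p <f, b_p>)_p is again
    the coefficient sequence of an element of F_(n) when x is bounded.

    The substance is thus that (b_p)_p is an orthonormal basis of F_(n). It
    rests on two facts.

    - An n-analytic function is a sum of zbar^k h_k(z), k < n, where the h_k are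
      everywhere convergent power series ([polyanalytic_expansion]). For this, a
      smooth function h with dh/dzbar = 0 has to be expanded in a power series,
      and contour integrals can be avoided: the auxiliary function of Bernstein
        2 rho^2 |h|^2 + (rho^2 - |z - z0|^2)^2 |dh/dz|^2
      is subharmonic, so the maximum principle bounds dh/dz at z0 by
      2 sup|h| / rho ([cauchy_estimate]). Iterating this over shrinking discs
      bounds the k-th derivative by C^k k! sup|h|, which is what Taylor's
      formula needs ([hol_pser]).

    - If f = sum_k zbar^k sum_j a_k(j) z^j is in L^2, then
        <f, (A^dagger)^q z^p> = sum_(k >= q) k!/(k-q)! (k+p-q)! a_k(k+p-q)
      ([pairing_coef]). On a disc all series may be integrated termwise, and
      rotation invariance leaves one Taylor coefficient of each h_k; then the
      radius tends to infinity. The constants are the moments of the Gaussian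
      measure and the adjointness of A^dagger and d/dzbar on monomials.

    The formula shows at once that b_(p,q) is orthogonal to F_q, and that a
    function of F_n orthogonal to all b_(p,q) with q < n vanishes, because
    q = n-1, n-2, ... successively yields a_q = 0 ([polyfock_eq0]). Finally, for
    square summable c, the series sum_p c_p b_p converges pointwise to an
    n-analytic function, since the factor 1 / sqrt(p!) of b_p makes the
    resulting power series entire, and Fatou's lemma turns this into convergence
    in L^2 ([riesz_fischer]). *)

Set Implicit Arguments.
Unset Strict Implicit.
Unset Printing Implicit Defensive.

Local Open Scope classical_set_scope.
Local Open Scope complex_scope.
Local Open Scope ring_scope.

(** * Calculus of the Wirtinger derivatives *)

Section calculus.
Variable R : realType.
Implicit Types (f g h : R[i] -> R[i]) (p v : R * R).

Definition re_part f p : R := complex.Re (f (cplx p)).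
Definition im_part f p : R := complex.Im (f (cplx p)).

Lemma differentiable_planeP f p : differentiable (plane f) p <->
  differentiable (re_part f) p /\ differentiable (im_part f) p.
Proof.
split=> [df|[dr di]].
  split.
    have -> : re_part f = fst \o plane f by [].
    apply: differentiable_comp => //.
    apply: linear_differentiable => q; exact: cvg_fst.
  have -> : im_part f = snd \o plane f by [].
  apply: differentiable_comp => //.
  apply: linear_differentiable => q; exact: cvg_snd.
have -> : plane f = fun p => (re_part f p, im_part f p) by [].
exact: differentiable_pair.
Qed.

Lemma pderiv_parts v f z : differentiable (plane f) (uncplx z) ->
  pderiv v f z = 'D_v (re_part f) (uncplx z) +i* 'D_v (im_part f) (uncplx z).
Proof.
move=> df; have [dr di] := (differentiable_planeP _ _).1 df.
rewrite /pderiv !deriveE//.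
have -> : plane f = fun p => (re_part f p, im_part f p) by [].
by rewrite diff_pair.
Qed.

Definition cdiff f := forall p, differentiable (plane f) p.

Lemma re_partM f g : re_part (f * g) = re_part f * re_part g - im_part f * im_part g.
Proof. by apply/funext => p; rewrite /re_part !fctE Re_mulc. Qed.

Lemma im_partM f g : im_part (f * g) = re_part f * im_part g + im_part f * re_part g.
Proof. by apply/funext => p; rewrite /im_part !fctE Im_mulc. Qed.

Lemma cdiff_parts f p : cdiff f ->
  differentiable (re_part f) p /\ differentiable (im_part f) p.
Proof. by move=> df; apply/differentiable_planeP. Qed.

Lemma cdiffM f g : cdiff f -> cdiff g -> cdiff (f * g).
Proof.
move=> df dg p; have [fr fi] := cdiff_parts p df; have [gr gi] := cdiff_parts p dg.
apply/differentiable_planeP; rewrite re_partM im_partM; split.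
  by apply: differentiableB; apply: differentiableM.
by apply: differentiableD; apply: differentiableM.
Qed.

Lemma pderivM v f g : cdiff f -> cdiff g ->
  pderiv v (f * g) = pderiv v f * g + f * pderiv v g.
Proof.
move=> df dg; apply/funext => z; rewrite !fctE.
have [fr fi] := cdiff_parts (uncplx z) df.
have [gr gi] := cdiff_parts (uncplx z) dg.
rewrite (pderiv_parts _ (cdiffM df dg _)) (pderiv_parts _ (df _)) (pderiv_parts _ (dg _)).
rewrite re_partM im_partM.
rewrite deriveB ?deriveD; [|by apply: derivableM; apply: diff_derivable..].
rewrite !deriveM; [|by apply: diff_derivable..].
rewrite /GRing.scale/=.
have -> : re_part f (uncplx z) = complex.Re (f z) by rewrite /re_part uncplxK.
have -> : im_part f (uncplx z) = complex.Im (f z) by rewrite /im_part uncplxK.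
have -> : re_part g (uncplx z) = complex.Re (g z) by rewrite /re_part uncplxK.
have -> : im_part g (uncplx z) = complex.Im (g z) by rewrite /im_part uncplxK.
move: ('D_v (re_part f) _) ('D_v (im_part f) _) => A B.
move: ('D_v (re_part g) _) ('D_v (im_part g) _) => C D.
case: (f z) (g z) => [a b] [c d].
by apply/eqP; rewrite eq_complex/=; apply/andP; split; apply/eqP; ring.
Qed.

Definition conjf f : R[i] -> R[i] := fun z => (f z)^*.

Lemma cdiff_conj f : cdiff f -> cdiff (conjf f).
Proof.
move=> df p; have [fr fi] := cdiff_parts p df.
apply/differentiable_planeP; split.
  have -> // : re_part (conjf f) = re_part f.
  by apply/funext => q; rewrite /re_part /conjf Re_conjc.
have -> : im_part (conjf f) = - im_part f.
  by apply/funext => q; rewrite !fctE /im_part /conjf Im_conjc.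
exact: differentiableN.
Qed.

Lemma pderiv_conj v f : cdiff f -> pderiv v (conjf f) = conjf (pderiv v f).
Proof.
move=> df; apply/funext => z.
have [fr fi] := cdiff_parts (uncplx z) df.
rewrite (pderiv_parts _ (cdiff_conj df _)) -[RHS]/((pderiv v f z)^*) (pderiv_parts _ (df _)).
have -> : re_part (conjf f) = re_part f.
  by apply/funext => q; rewrite /re_part /conjf Re_conjc.
have -> : im_part (conjf f) = - im_part f.
  by apply/funext => q; rewrite !fctE /im_part /conjf Im_conjc.
by rewrite deriveN; last exact: diff_derivable.
Qed.

Lemma diff_uptoW k f : diff_upto k.+1 f -> diff_upto k f.
Proof.
elim: k f => [|k IH] f; first by [].
rewrite (diff_uptoS k.+1) => -[df fx fy].
by rewrite diff_uptoS; split; [exact: df|exact: IH|exact: IH].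
Qed.

Lemma diff_uptoD k f g : diff_upto k f -> diff_upto k g -> diff_upto k (f + g).
Proof. by move=> df dg; have := diff_upto_lin 1 df dg; rewrite scale1r. Qed.

Lemma diff_uptoM k f g : diff_upto k f -> diff_upto k g -> diff_upto k (f * g).
Proof.
elim: k f g => [|k IH] f g; first by [].
move=> df dg.
have [f0 g0] := (diff_uptoW df, diff_uptoW dg).
move: df dg; rewrite !diff_uptoS => -[df fx fy] [dg gx gy]; split.
- exact: cdiffM.
- have -> : dx (f * g) = dx f * g + f * dx g by exact: pderivM.
  exact: diff_uptoD (IH _ _ fx g0) (IH _ _ f0 gx).
- have -> : dy (f * g) = dy f * g + f * dy g by exact: pderivM.
  exact: diff_uptoD (IH _ _ fy g0) (IH _ _ f0 gy).
Qed.

Lemma diff_upto_conj k f : diff_upto k f -> diff_upto k (conjf f).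
Proof.
elim: k f => [|k IH] f; first by [].
rewrite !diff_uptoS => -[df fx fy]; split.
- exact: cdiff_conj.
- have -> : dx (conjf f) = conjf (dx f) by exact: pderiv_conj.
  exact: (IH _ fx).
- have -> : dy (conjf f) = conjf (dy f) by exact: pderiv_conj.
  exact: (IH _ fy).
Qed.

Lemma smoothD f g : smooth f -> smooth g -> smooth (f + g).
Proof. by move=> sf sg k; apply: diff_uptoD. Qed.

Lemma smoothM f g : smooth f -> smooth g -> smooth (f * g).
Proof. by move=> sf sg k; apply: diff_uptoM. Qed.

Lemma smooth_conj f : smooth f -> smooth (conjf f).
Proof. by move=> sf k; apply: diff_upto_conj. Qed.

Lemma smooth0 : smooth (0 : R[i] -> R[i]).
Proof. exact: smooth_cst. Qed.

Lemma smoothZ a f : smooth f -> smooth (a *: f).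
Proof. by move=> sf; rewrite -[_ *: _]addr0; apply: smooth_lin => //; exact: smooth0. Qed.

Lemma smoothN f : smooth f -> smooth (- f).
Proof. by move=> sf; rewrite -scaleN1r; apply: smoothZ. Qed.

Lemma pderiv_id v : pderiv v (@id R[i]) = cst (cplx v).
Proof.
apply/funext => z; rewrite /pderiv.
have -> : plane (@id R[i]) = id by apply/funext => p; rewrite /plane/= cplxK.
by rewrite derive_id.
Qed.

Lemma smooth_id : smooth (@id R[i]).
Proof.
case=> [|k]; first by [].
rewrite diff_uptoS; split.
- have -> : plane (@id R[i]) = id by apply/funext => p; rewrite /plane/= cplxK.
  by move=> p; exact: ex_diff.
- by rewrite /dx pderiv_id; exact: diff_upto_cst.
- by rewrite /dy pderiv_id; exact: diff_upto_cst.
Qed.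

Definition zb : R[i] -> R[i] := conjf id.

Lemma smooth_zb : smooth zb. Proof. exact/smooth_conj/smooth_id. Qed.

Lemma smoothX f n : smooth f -> smooth (f ^+ n).
Proof.
move=> sf; elim: n => [|n IH]; first by rewrite expr0; exact: smooth_cst.
by rewrite exprS; apply: smoothM.
Qed.

Lemma smooth_sum I (r : seq I) (P : pred I) (F : I -> R[i] -> R[i]) :
  (forall i, P i -> smooth (F i)) -> smooth (\sum_(i <- r | P i) F i).
Proof.
move=> sF; elim/big_ind : _ => //; first exact: smooth0.
exact: smoothD.
Qed.

Lemma dxM f g : smooth f -> smooth g -> dx (f * g) = dx f * g + f * dx g.
Proof.
by move=> /smooth_differentiable df /smooth_differentiable dg; exact: pderivM.
Qed.

Lemma dyM f g : smooth f -> smooth g -> dy (f * g) = dy f * g + f * dy g.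
Proof.
by move=> /smooth_differentiable df /smooth_differentiable dg; exact: pderivM.
Qed.

Lemma cconjD (a b : R[i]) : (a + b)^* = a^* + b^*.
Proof. exact: rmorphD. Qed.

Lemma cconjB (a b : R[i]) : (a - b)^* = a^* - b^*.
Proof. exact: rmorphB. Qed.

Lemma cconjM (a b : R[i]) : (a * b)^* = a^* * b^*.
Proof. exact: rmorphM. Qed.

Lemma cconjX (a : R[i]) n : (a ^+ n)^* = a^* ^+ n.
Proof. exact: rmorphXn. Qed.

Lemma expfE f n z : (f ^+ n) z = f z ^+ n.
Proof. by elim: n => // n IH; rewrite !exprS -IH. Qed.

Lemma sumfE I (r : seq I) (P : pred I) (F : I -> R[i] -> R[i]) z :
  (\sum_(i <- r | P i) F i) z = \sum_(i <- r | P i) F i z.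
Proof. by elim/big_rec2 : _ => // i y u _ <-. Qed.

Lemma conj_ii : ('i%C : R[i])^* = - 'i%C.
Proof. by apply/eqP; rewrite eq_complex/=; apply/andP; split; apply/eqP; rewrite ?oppr0. Qed.

Lemma conj_half : ((2^-1 : R[i])^*) = 2^-1.
Proof. by rewrite fmorphV rmorph_nat. Qed.

Lemma dx_conj f : smooth f -> dx (conjf f) = conjf (dx f).
Proof. by move=> /smooth_differentiable df; exact: pderiv_conj. Qed.

Lemma dy_conj f : smooth f -> dy (conjf f) = conjf (dy f).
Proof. by move=> /smooth_differentiable df; exact: pderiv_conj. Qed.

Lemma conjfE f z : conjf f z = (f z)^*. Proof. by []. Qed.

Lemma dx_id : dx (@id R[i]) = cst (1 +i* 0).
Proof. exact: pderiv_id. Qed.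

Lemma dy_id : dy (@id R[i]) = cst (0 +i* 1).
Proof. exact: pderiv_id. Qed.

Lemma dx_cst (a : R[i]) : dx (cst a) = cst 0. Proof. exact: pderiv_cst. Qed.

Lemma dy_cst (a : R[i]) : dy (cst a) = cst 0. Proof. exact: pderiv_cst. Qed.

Local Notation op := ((R[i] -> R[i]) -> R[i] -> R[i]).

(** The four differential operators are used through sealed copies: unifying two
    of their values must never unfold them to limits of difference quotients. *)
Fact Dx_seal : {D : op | D = @dx R}. Proof. by exists (@dx R). Qed.
Definition Dx : op := sval Dx_seal.
Lemma DxE : @dx R = Dx. Proof. exact/esym/(svalP Dx_seal). Qed.

Fact Dy_seal : {D : op | D = @dy R}. Proof. by exists (@dy R). Qed.
Definition Dy : op := sval Dy_seal.
Lemma DyE : @dy R = Dy. Proof. exact/esym/(svalP Dy_seal). Qed.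

Fact Dz_seal : {D : op | D = @dz R}. Proof. by exists (@dz R). Qed.
Definition Dz : op := sval Dz_seal.
Lemma DzE : @dz R = Dz. Proof. exact/esym/(svalP Dz_seal). Qed.

Fact Dzb_seal : {D : op | D = @dzbar R}. Proof. by exists (@dzbar R). Qed.
Definition Dzb : op := sval Dzb_seal.
Lemma DzbE : @dzbar R = Dzb. Proof. exact/esym/(svalP Dzb_seal). Qed.

Lemma Dz_def f z : Dz f z = (Dx f z - 'i%C * Dy f z) / 2.
Proof. by rewrite -DzE -DxE -DyE. Qed.

Lemma Dzb_def f z : Dzb f z = (Dx f z + 'i%C * Dy f z) / 2.
Proof. by rewrite -DzbE -DxE -DyE. Qed.

Lemma smooth_Dx f : smooth f -> smooth (Dx f).
Proof. by rewrite -DxE; exact: smooth_dx. Qed.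

Lemma smooth_Dy f : smooth f -> smooth (Dy f).
Proof. by rewrite -DyE; exact: smooth_dy. Qed.

Lemma smooth_Dzb f : smooth f -> smooth (Dzb f).
Proof. by rewrite -DzbE; exact: smooth_dzbar. Qed.

Lemma smooth_Dz f : smooth f -> smooth (Dz f).
Proof.
move=> sf; have -> : Dz f = (2^-1 : R[i]) *: (Dx f + (- 'i%C) *: Dy f).
  apply/funext => z; rewrite -[RHS]/(2^-1 * (Dx f z + - 'i%C * Dy f z)) Dz_def.
  by rewrite mulNr mulrC.
by apply/smoothZ/smoothD; [exact: smooth_Dx|apply/smoothZ/smooth_Dy].
Qed.

Lemma DxM f g : smooth f -> smooth g -> Dx (f * g) = Dx f * g + f * Dx g.
Proof. by rewrite -DxE; exact: dxM. Qed.

Lemma DyM f g : smooth f -> smooth g -> Dy (f * g) = Dy f * g + f * Dy g.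
Proof. by rewrite -DyE; exact: dyM. Qed.

Lemma Dx_conj f : smooth f -> Dx (conjf f) = conjf (Dx f).
Proof. by rewrite -DxE; exact: dx_conj. Qed.

Lemma Dy_conj f : smooth f -> Dy (conjf f) = conjf (Dy f).
Proof. by rewrite -DyE; exact: dy_conj. Qed.

Lemma Dx_id : Dx (@id R[i]) = cst (1 +i* 0).
Proof. by rewrite -DxE; exact: dx_id. Qed.

Lemma Dy_id : Dy (@id R[i]) = cst (0 +i* 1).
Proof. by rewrite -DyE; exact: dy_id. Qed.

Lemma Dx_cst (a : R[i]) : Dx (cst a) = cst 0.
Proof. by rewrite -DxE; exact: dx_cst. Qed.

Lemma Dy_cst (a : R[i]) : Dy (cst a) = cst 0.
Proof. by rewrite -DyE; exact: dy_cst. Qed.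

Lemma Dx_lin (a : R[i]) f g : smooth f -> smooth g ->
  Dx (a *: f + g) = a *: Dx f + Dx g.
Proof.
rewrite -DxE => /smooth_differentiable df /smooth_differentiable dg.
exact: dx_lin.
Qed.

Lemma Dy_lin (a : R[i]) f g : smooth f -> smooth g ->
  Dy (a *: f + g) = a *: Dy f + Dy g.
Proof.
rewrite -DyE => /smooth_differentiable df /smooth_differentiable dg.
exact: dy_lin.
Qed.

Lemma Dzb_lin (a : R[i]) f g : smooth f -> smooth g ->
  Dzb (a *: f + g) = a *: Dzb f + Dzb g.
Proof. by rewrite -DzbE; exact: dzbar_lin. Qed.

Lemma DzM f g : smooth f -> smooth g -> Dz (f * g) = Dz f * g + f * Dz g.
Proof.
move=> sf sg; apply/funext => z.
have ex : Dx (f * g) z = Dx f z * g z + f z * Dx g z.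
  exact: (congr1 (@^~ z) (DxM sf sg)).
have ey : Dy (f * g) z = Dy f z * g z + f z * Dy g z.
  exact: (congr1 (@^~ z) (DyM sf sg)).
rewrite -[RHS]/(Dz f z * g z + f z * Dz g z) !Dz_def ex ey.
move: (Dx f z) (Dy f z) (Dx g z) (Dy g z) (f z) (g z) => a b c d u v; ring.
Qed.

Lemma DzbM f g : smooth f -> smooth g -> Dzb (f * g) = Dzb f * g + f * Dzb g.
Proof.
move=> sf sg; apply/funext => z.
have ex : Dx (f * g) z = Dx f z * g z + f z * Dx g z.
  exact: (congr1 (@^~ z) (DxM sf sg)).
have ey : Dy (f * g) z = Dy f z * g z + f z * Dy g z.
  exact: (congr1 (@^~ z) (DyM sf sg)).
rewrite -[RHS]/(Dzb f z * g z + f z * Dzb g z) !Dzb_def ex ey.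
move: (Dx f z) (Dy f z) (Dx g z) (Dy g z) (f z) (g z) => a b c d u v; ring.
Qed.

Lemma Dz_conj f : smooth f -> Dz (conjf f) = conjf (Dzb f).
Proof.
move=> sf; apply/funext => z.
have ex : Dx (conjf f) z = (Dx f z)^* by exact: (congr1 (@^~ z) (Dx_conj sf)).
have ey : Dy (conjf f) z = (Dy f z)^* by exact: (congr1 (@^~ z) (Dy_conj sf)).
rewrite -[RHS]/((Dzb f z)^* ) Dz_def Dzb_def ex ey.
move: (Dx f z) (Dy f z) => a b.
by rewrite cconjM cconjD [('i%C * b)^*]cconjM conj_half conj_ii mulNr.
Qed.

Lemma Dzb_conj f : smooth f -> Dzb (conjf f) = conjf (Dz f).
Proof.
move=> sf; apply/funext => z.
have ex : Dx (conjf f) z = (Dx f z)^* by exact: (congr1 (@^~ z) (Dx_conj sf)).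
have ey : Dy (conjf f) z = (Dy f z)^* by exact: (congr1 (@^~ z) (Dy_conj sf)).
rewrite -[RHS]/((Dz f z)^* ) Dz_def Dzb_def ex ey.
move: (Dx f z) (Dy f z) => a b.
by rewrite cconjM cconjB [('i%C * b)^*]cconjM conj_half conj_ii mulNr opprK.
Qed.

Lemma Dz_id : Dz (@id R[i]) = 1.
Proof.
apply/funext => z; rewrite Dz_def Dx_id Dy_id.
rewrite -[RHS]/(1 : R[i]) /cst/=.
have -> : (1 +i* 0 : R[i]) - 'i%C * (0 +i* 1) = 2.
  by apply/eqP; rewrite eq_complex/=; apply/andP; split; apply/eqP; ring.
by rewrite divff// pnatr_eq0.
Qed.

Lemma Dzb_id : Dzb (@id R[i]) = 0.
Proof.
apply/funext => z; rewrite Dzb_def Dx_id Dy_id.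
rewrite -[RHS]/(0 : R[i]) /cst/=.
have -> : (1 +i* 0 : R[i]) + 'i%C * (0 +i* 1) = 0.
  by apply/eqP; rewrite eq_complex/=; apply/andP; split; apply/eqP; ring.
by rewrite mul0r.
Qed.

Lemma Dz_zb : Dz zb = 0.
Proof. by rewrite Dz_conj ?Dzb_id; [apply/funext => z; exact: rmorph0|exact: smooth_id]. Qed.

Lemma Dzb_zb : Dzb zb = 1.
Proof. by rewrite Dzb_conj ?Dz_id; [apply/funext => z; exact: rmorph1|exact: smooth_id]. Qed.

Lemma Dz_cst a : Dz (cst a : R[i] -> R[i]) = 0.
Proof. by apply/funext => z; rewrite Dz_def Dx_cst Dy_cst/= mulr0 subr0 mul0r. Qed.

Lemma Dzb_cst a : Dzb (cst a : R[i] -> R[i]) = 0.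
Proof. by apply/funext => z; rewrite Dzb_def Dx_cst Dy_cst/= mulr0 addr0 mul0r. Qed.

Lemma Dz_lin (a : R[i]) f g : smooth f -> smooth g ->
  Dz (a *: f + g) = a *: Dz f + Dz g.
Proof.
move=> sf sg; apply/funext => z.
rewrite -[RHS]/(a * Dz f z + Dz g z) !Dz_def (Dx_lin a sf sg) (Dy_lin a sf sg).
rewrite -[LHS]/((a * Dx f z + Dx g z - 'i%C * (a * Dy f z + Dy g z)) / 2).
move: (Dx f z) (Dy f z) (Dx g z) (Dy g z) => b c d e; ring.
Qed.

Lemma DzD f g : smooth f -> smooth g -> Dz (f + g) = Dz f + Dz g.
Proof. by move=> sf sg; rewrite -[f]scale1r Dz_lin// !scale1r. Qed.

Lemma DzbD f g : smooth f -> smooth g -> Dzb (f + g) = Dzb f + Dzb g.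
Proof. by move=> sf sg; rewrite -[f]scale1r Dzb_lin// !scale1r. Qed.

Lemma DzZ a f : smooth f -> Dz (a *: f) = a *: Dz f.
Proof.
by move=> sf; rewrite -[_ *: f]addr0 Dz_lin//; [rewrite Dz_cst addr0|exact: smooth0].
Qed.

Lemma DzbZ a f : smooth f -> Dzb (a *: f) = a *: Dzb f.
Proof.
by move=> sf; rewrite -[_ *: f]addr0 Dzb_lin//; [rewrite Dzb_cst addr0|exact: smooth0].
Qed.

Lemma DzN f : smooth f -> Dz (- f) = - Dz f.
Proof. by move=> sf; rewrite -scaleN1r DzZ// scaleN1r. Qed.

Lemma DzbN f : smooth f -> Dzb (- f) = - Dzb f.
Proof. by move=> sf; rewrite -scaleN1r DzbZ// scaleN1r. Qed.

Lemma Dzb_sum I (r : seq I) (P : pred I) (F : I -> R[i] -> R[i]) :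
  (forall i, P i -> smooth (F i)) ->
  Dzb (\sum_(i <- r | P i) F i) = \sum_(i <- r | P i) Dzb (F i).
Proof.
move=> sF; suff [] : smooth (\sum_(i <- r | P i) F i) /\
  Dzb (\sum_(i <- r | P i) F i) = \sum_(i <- r | P i) Dzb (F i) by [].
elim/big_rec2 : _ => [|i g f Pi [sg <-]].
  by split; [exact: smooth0|exact: Dzb_cst].
by split; [apply: smoothD => //; exact: sF|rewrite DzbD//; exact: sF].
Qed.

Lemma DzX f n : smooth f ->
  Dz (f ^+ n) = fun z => n%:R * f z ^+ n.-1 * Dz f z.
Proof.
move=> sf; elim: n => [|n IH].
  by rewrite expr0 [LHS]Dz_cst; apply/funext => z; rewrite !mul0r.
rewrite exprS (DzM sf (smoothX n sf)) IH; apply/funext => z.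
rewrite -[LHS]/(Dz f z * (f ^+ n) z + f z * (n%:R * f z ^+ n.-1 * Dz f z)) expfE.
move: (Dz f z) (f z) => a b; case: n {IH} => [|n] /=; first by ring.
by rewrite [b ^+ n.+1]exprS -[n.+2]addn1 [(n.+1 + 1)%:R]natrD; ring.
Qed.

Lemma DzbX f n : smooth f ->
  Dzb (f ^+ n) = fun z => n%:R * f z ^+ n.-1 * Dzb f z.
Proof.
move=> sf; elim: n => [|n IH].
  by rewrite expr0 [LHS]Dzb_cst; apply/funext => z; rewrite !mul0r.
rewrite exprS (DzbM sf (smoothX n sf)) IH; apply/funext => z.
rewrite -[LHS]/(Dzb f z * (f ^+ n) z + f z * (n%:R * f z ^+ n.-1 * Dzb f z)) expfE.
move: (Dzb f z) (f z) => a b; case: n {IH} => [|n] /=; first by ring.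
by rewrite [b ^+ n.+1]exprS -[n.+2]addn1 [(n.+1 + 1)%:R]natrD; ring.
Qed.

End calculus.

(** * Symmetry of the second derivatives *)

Section second_derivatives.
Variable R : realType.
Implicit Types (f g h : R[i] -> R[i]) (p v w : R * R).

Lemma line_derive (F : R * R -> R) p v t : differentiable F (p + t *: v) ->
  is_derive t 1 (fun s : R => F (p + s *: v)) ('D_v F (p + t *: v)).
Proof.
move=> dF.
pose g := fun s : R => p + s *: v.
have dg : is_derive t 1 g v.
  rewrite /g -[X in is_derive _ _ _ X]add0r.
  apply: is_deriveD.
  rewrite -[X in is_derive _ _ _ X]scale1r.
  have -> : ( *:%R^~ v : R -> R * R) = fun s => id s *: v by [].
  apply: DeriveDef; first exact/derivable1_diffP.
  by rewrite deriveE// diff_val.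
have dg' : differentiable g t by apply/derivable1_diffP.
have dFg : differentiable (F \o g) t by apply: differentiable_comp.
apply: DeriveDef; first exact/derivable1_diffP.
have E1 : 'd g t 1 = v by rewrite -deriveE// derive_val.
by rewrite -[LHS]/('D_1 (F \o g) t) deriveE// diff_comp//= E1 [RHS]deriveE.
Qed.

(** Two applications of the mean value theorem, first in the direction v and
    then in the direction w. *)
Lemma mixed_difference (F Fv : R * R -> R) (v w p : R * R) (s : R) : 0 < s ->
  (forall q, differentiable F q) -> (forall q, 'D_v F q = Fv q) ->
  (forall q, differentiable Fv q) ->
  exists a b, [/\ 0 < a < s, 0 < b < s &
   F (p + s *: v + s *: w) - F (p + s *: v) - F (p + s *: w) + F p =
   s * s * 'D_w Fv (p + a *: v + b *: w)].
Proof.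
move=> s0 dF FvE dFv.
pose G (t : R) := F (p + s *: w + t *: v) - F (p + t *: v).
have dG (t : R) : is_derive t (1 : R) G (Fv (p + s *: w + t *: v) - Fv (p + t *: v)).
  by rewrite -!FvE; apply: is_deriveB; apply: line_derive.
have [|a aI Ga] := @MVT R G _ 0 s s0 (fun t _ => dG t).
  by apply: derivable_within_continuous => t _; exact: ex_derive.
pose H (t : R) := Fv (p + a *: v + t *: w).
have dH (t : R) : is_derive t (1 : R) H ('D_w Fv (p + a *: v + t *: w)).
  exact: line_derive.
have [|b bI Hb] := @MVT R H _ 0 s s0 (fun t _ => dH t).
  by apply: derivable_within_continuous => t _; exact: ex_derive.
exists a, b; split; [by rewrite in_itv in aI|by rewrite in_itv in bI|].
move: Ga; rewrite /G !scale0r !addr0 subr0.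
have -> : p + s *: w + a *: v = p + a *: v + s *: w by rewrite addrAC.
have -> : p + s *: w + s *: v = p + s *: v + s *: w by rewrite addrAC.
move: Hb; rewrite /H !scale0r addr0 subr0 => -> E.
have {}E : F (p + s *: v + s *: w) - F (p + s *: v) =
  'D_w Fv (p + a *: v + b *: w) * s * s + (F (p + s *: w) - F p).
  by rewrite -E subrK.
rewrite E; ring.
Qed.

(** The mixed difference is symmetric in v and w, so both mixed derivatives take
    a common value arbitrarily near p; continuity at p does the rest. *)
Lemma schwarz_real (F Fv Fw : R * R -> R) (v w p : R * R) :
  (forall q, differentiable F q) -> (forall q, 'D_v F q = Fv q) ->
  (forall q, 'D_w F q = Fw q) ->
  (forall q, differentiable Fv q) -> (forall q, differentiable Fw q) ->
  {for p, continuous (fun q => 'D_w Fv q)} ->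
  {for p, continuous (fun q => 'D_v Fw q)} ->
  'D_w Fv p = 'D_v Fw p.
Proof.
move=> dF FvE FwE dFv dFw c1 c2.
apply/eqP; rewrite -subr_eq0 -normr_le0; apply/ler_addgt0Pl => e e0.
rewrite addr0.
have e2 : 0 < e / 2 by rewrite divr_gt0.
have /nbhs_ballP[d1 /= d10 B1] : nbhs p (fun q => `|'D_w Fv p - 'D_w Fv q| < e / 2).
  by have /cvgrPdist_lt/(_ _ e2) := c1.
have /nbhs_ballP[d2 /= d20 B2] : nbhs p (fun q => `|'D_v Fw p - 'D_v Fw q| < e / 2).
  by have /cvgrPdist_lt/(_ _ e2) := c2.
pose K := `|v| + `|w| + 1.
have K0 : 0 < K by rewrite ltr_wpDl// addr_ge0.
have [m [m0 m1 m2]] : exists m : R, [/\ 0 < m, m <= d1 & m <= d2].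
  by exists (Num.min d1 d2); rewrite lt_min !ge_min !lexx orbT d10 d20.
(* Points p + a v + b w with a, b < s are then within m of p. *)
pose s : R := m / (K + K).
have s0 : 0 < s by apply: divr_gt0 => //; exact: addr_gt0.
have near_p (d a b : R) : m <= d -> 0 < a < s -> 0 < b < s ->
    ball p d (p + a *: v + b *: w).
  move=> dd /andP[a0 as_] /andP[b0 bs].
  rewrite -ball_normE /ball_/= -addrA opprD addNKr normrN.
  apply: le_lt_trans (ler_normD _ _) _; rewrite !normrZ !gtr0_norm//.
  apply: lt_le_trans dd.
  apply: (@le_lt_trans _ _ (s * K)).
    have h1 : a * `|v| <= s * `|v| by rewrite ler_wpM2r// ltW.
    have h2 : b * `|w| <= s * `|w| by rewrite ler_wpM2r// ltW.
    rewrite /K !mulrDr mulr1; lra.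
  have : s * (K + K) = m by rewrite divfK// gt_eqF// addr_gt0.
  by rewrite mulrDr; lra.
have [a [b [aI bI E1]]] := mixed_difference w p s0 dF FvE dFv.
have [a' [b' [aI' bI' E2]]] := mixed_difference v p s0 dF FwE dFw.
have ss : s * s != 0 by rewrite mulf_neq0// gt_eqF.
have E : 'D_w Fv (p + a *: v + b *: w) = 'D_v Fw (p + a' *: w + b' *: v).
  apply: (mulfI ss); rewrite -E1 -E2.
  have -> : p + s *: w + s *: v = p + s *: v + s *: w by rewrite addrAC.
  by ring.
have {}B1 := B1 _ (near_p d1 a b m1 aI bI).
have E3 : p + a' *: w + b' *: v = p + b' *: v + a' *: w by rewrite addrAC.
rewrite E3 in E.
have {}B2 := B2 _ (near_p d2 b' a' m2 bI' aI').
rewrite E in B1.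
apply: ltW; rewrite [e]splitr.
apply: le_lt_trans (ltrD B1 B2).
rewrite [X in _ <= _ + X]distrC.
apply: le_trans (ler_normD _ _).
by rewrite addrA subrK.
Qed.

Lemma D_re_part v f : cdiff f -> 'D_v (re_part f) = re_part (pderiv v f).
Proof.
move=> df; apply/funext => p.
by rewrite /re_part (pderiv_parts v (df _)) cplxK.
Qed.

Lemma D_im_part v f : cdiff f -> 'D_v (im_part f) = im_part (pderiv v f).
Proof.
move=> df; apply/funext => p.
by rewrite /im_part (pderiv_parts v (df _)) cplxK.
Qed.

Lemma dx_dy f : smooth f -> dx (dy f) = dy (dx f).
Proof.
move=> sf; apply/funext => z.
have df : cdiff f := smooth_differentiable sf.
have dfx : cdiff (dx f) := smooth_differentiable (smooth_dx sf).
have dfy : cdiff (dy f) := smooth_differentiable (smooth_dy sf).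
have dfxy : cdiff (dy (dx f)) := smooth_differentiable (smooth_dy (smooth_dx sf)).
have dfyx : cdiff (dx (dy f)) := smooth_differentiable (smooth_dx (smooth_dy sf)).
pose p := uncplx z.
have Er : re_part (dx (dy f)) p = re_part (dy (dx f)) p.
  rewrite -[LHS](congr1 (@^~ p) (D_re_part (1, 0) dfy)).
  rewrite -[RHS](congr1 (@^~ p) (D_re_part (0, 1) dfx)).
  apply/esym; apply: (@schwarz_real (re_part f)).
  - by move=> q; have [] := cdiff_parts q df.
  - by move=> q; exact: (congr1 (@^~ q) (D_re_part (1, 0) df)).
  - by move=> q; exact: (congr1 (@^~ q) (D_re_part (0, 1) df)).
  - by move=> q; have [] := cdiff_parts q dfx.
  - by move=> q; have [] := cdiff_parts q dfy.
  - have -> : 'D_(0, 1) (re_part (dx f)) = re_part (dy (dx f)) := D_re_part _ dfx.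
    apply: differentiable_continuous.
    by have [] := cdiff_parts p dfxy.
  - have -> : 'D_(1, 0) (re_part (dy f)) = re_part (dx (dy f)) := D_re_part _ dfy.
    apply: differentiable_continuous.
    by have [] := cdiff_parts p dfyx.
have Ei : im_part (dx (dy f)) p = im_part (dy (dx f)) p.
  rewrite -[LHS](congr1 (@^~ p) (D_im_part (1, 0) dfy)).
  rewrite -[RHS](congr1 (@^~ p) (D_im_part (0, 1) dfx)).
  apply/esym; apply: (@schwarz_real (im_part f)).
  - by move=> q; have [] := cdiff_parts q df.
  - by move=> q; exact: (congr1 (@^~ q) (D_im_part (1, 0) df)).
  - by move=> q; exact: (congr1 (@^~ q) (D_im_part (0, 1) df)).
  - by move=> q; have [] := cdiff_parts q dfx.
  - by move=> q; have [] := cdiff_parts q dfy.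
  - have -> : 'D_(0, 1) (im_part (dx f)) = im_part (dy (dx f)) := D_im_part _ dfx.
    apply: differentiable_continuous.
    by have [] := cdiff_parts p dfxy.
  - have -> : 'D_(1, 0) (im_part (dy f)) = im_part (dx (dy f)) := D_im_part _ dfy.
    apply: differentiable_continuous.
    by have [] := cdiff_parts p dfyx.
move: Er Ei; rewrite /re_part /im_part /p uncplxK.
by case: (dx (dy f) z) (dy (dx f) z) => a b [c d] /= -> ->.
Qed.

(** If c were positive, the first derivative, which vanishes at the maximum,
    would be positive just to the right of it, and g would increase there. *)
Lemma second_derivative_at_max (g g' : R -> R) (t0 c d : R) :
  (forall t : R, is_derive t (1 : R) g (g' t)) -> is_derive t0 (1 : R) g' c ->
  0 < d -> (forall t : R, `|t - t0| < d -> g t <= g t0) -> c <= 0.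
Proof.
move=> dg dg' d0 gmax; rewrite leNgt; apply/negP => c0.
have inI (t : R) : t \in `]t0 - d, t0 + d[%R -> `|t - t0| < d.
  by rewrite in_itv/= => /andP[h1 h2]; rewrite ltr_norml; apply/andP; split; lra.
have g't0 : g' t0 = 0.
  have [|t _||t tI|] := @derive1_at_max R g (t0 - d) (t0 + d) t0.
  - lra.
  - exact: ex_derive.
  - by rewrite in_itv/=; apply/andP; split; lra.
  - by apply: gmax; exact: inI.
  - by move=> _; rewrite (@derive_val _ _ _ _ _ _ _ (dg t0)).
have cv : (fun h : R => h^-1 *: ((g' \o shift t0) (h *: (1 : R)) - g' t0)) @ 0^' --> c.
  have := @ex_derive _ _ _ _ _ _ _ dg'; rewrite /derivable.
  by move=> /cvg_ex[l hl]; rewrite -(@derive_val _ _ _ _ _ _ _ dg') /derive (cvg_lim _ hl).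
have : \forall h \near 0^', 0 < h^-1 *: ((g' \o shift t0) (h *: (1 : R)) - g' t0).
  exact: (cvgr_gt c cv).
move=> [e /= e0 He].
pose h := Num.min e d / 2.
have [h0 he hd] : [/\ 0 < h, h < e & h < d].
  by rewrite /h; case: (leP e d) => ed; split; lra.
have t0h : t0 < t0 + h by rewrite ltrDl.
have [|xi] := @MVT R g g' t0 (t0 + h) t0h (fun t _ => dg t).
  by apply: derivable_within_continuous => t _; exact: ex_derive.
rewrite in_itv/= => /andP[x1 x2] E.
have := He (xi - t0); rewrite /= sub0r normrN gtr0_norm ?subr_gt0// => H.
have {}H : 0 < (xi - t0)^-1 *: ((g' \o shift t0) ((xi - t0) *: (1 : R)) - g' t0).
  by apply: H; [lra|rewrite gt_eqF// subr_gt0].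
move: H; rewrite /= g't0 subr0 /GRing.scale/= mulr1 subrK pmulr_rgt0 ?invr_gt0 ?subr_gt0// => H.
have : g (t0 + h) <= g t0 by apply: gmax; rewrite addrC addKr gtr0_norm.
have : 0 < g' xi * (t0 + h - t0) by rewrite mulr_gt0// addrC addKr.
by lra.
Qed.

Lemma Dx_Dy f : smooth f -> Dx (Dy f) = Dy (Dx f).
Proof. by rewrite -DxE -DyE; exact: dx_dy. Qed.

End second_derivatives.

(** * The maximum principle and Cauchy's estimate *)

Section maximum_principle.
Variable R : realType.
Implicit Types (f g h : R[i] -> R[i]) (p v w : R * R) (z : R[i]) (rho M : R).

Lemma continuous_dist z0 : continuous (fun p : R * R => normc (cplx p - z0)).
Proof.
case: z0 => a b p.
have -> : (fun p : R * R => normc (cplx p - (a +i* b))) =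
  Num.sqrt \o (fun p => (p.1 - a) ^+ 2 + (p.2 - b) ^+ 2) by apply/funext => -[].
apply: continuous_comp; last exact: sqrt_continuous.
by apply: continuousD; apply: (continuous_comp _ (@exprn_continuous R 2 _));
   apply: continuousB; (try exact: cst_continuous); [exact: cvg_fst|exact: cvg_snd].
Qed.

Lemma compact_disc z0 rho : compact [set p : R * R | normc (cplx p - z0) <= rho].
Proof.
case: z0 => a b.
apply: (@subclosed_compact _ _ (`[a - rho, a + rho] `*` `[b - rho, b + rho])).
- have := @preimage_closed _ _ (fun p : R * R => normc (cplx p - (a +i* b)))
    [set x | x <= rho].
  by apply; [move=> p _; exact: continuous_dist|exact: closed_le].
- by apply: compact_setX; exact: segment_compact.
- move=> [x y] /= H.
  have [h1 h2] : `|x - a| <= rho /\ `|y - b| <= rho.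
    split; apply: le_trans H; rewrite -sqrtr_sqr; apply: ler_wsqrtr.
      by rewrite lerDl sqr_ge0.
    by rewrite lerDr sqr_ge0.
  move: h1 h2; rewrite !ler_norml !in_itv/= => /andP[? ?] /andP[? ?].
  by split; apply/andP; split; lra.
Qed.

Lemma normc_ge_parts (z : R[i]) : `|complex.Re z| <= normc z /\ `|complex.Im z| <= normc z.
Proof.
case: z => a b /=; split; rewrite -sqrtr_sqr; apply: ler_wsqrtr.
  by rewrite lerDl sqr_ge0.
by rewrite lerDr sqr_ge0.
Qed.

Lemma cdiff_smooth f : smooth f -> cdiff f.
Proof. exact: smooth_differentiable. Qed.

Lemma second_pderiv_at_max f f' f'' v p d : cdiff f -> cdiff f' ->
  pderiv v f = f' -> pderiv v f' = f'' -> 0 < d ->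
  (forall t : R, `|t| < d -> re_part f (p + t *: v) <= re_part f p) ->
  re_part f'' p <= 0.
Proof.
move=> df df' fE f'E d0 fmax.
have L g g' (t : R) : cdiff g -> pderiv v g = g' ->
    is_derive t (1 : R) (fun s => re_part g (p + s *: v)) (re_part g' (p + t *: v)).
  move=> dg <-; rewrite -(congr1 (@^~ (p + t *: v)) (D_re_part v dg)).
  by apply: line_derive; have [] := cdiff_parts (p + t *: v) dg.
apply: (@second_derivative_at_max R (fun s => re_part f (p + s *: v))
   (fun s => re_part f' (p + s *: v)) 0 _ d) => //.
- by move=> t; exact: L.
- by have := L f' f'' 0 df' f'E; rewrite scale0r addr0.
- by move=> t; rewrite subr0 scale0r addr0; exact: fmax.
Qed.

Lemma normc_scale (t : R) v : normc (cplx (t *: v)) = `|t| * normc (cplx v).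
Proof.
case: v => a b; rewrite /cplx /=.
rewrite -[t *: a]/(t * a) -[t *: b]/(t * b) !exprMn -mulrDr sqrtrM ?sqr_ge0//.
by rewrite sqrtr_sqr.
Qed.

(** A maximum over the disc attained in the interior would be a maximum along
    the two coordinate directions, where both second derivatives are at most 0. *)
Lemma strict_max_principle f z0 rho M : smooth f -> 0 <= rho ->
  (forall z, normc (z - z0) < rho -> 0 < complex.Re (Dx (Dx f) z + Dy (Dy f) z)) ->
  (forall z, normc (z - z0) = rho -> complex.Re (f z) <= M) ->
  complex.Re (f z0) <= M.
Proof.
move=> sf rho0 lap bd.
pose A := [set p : R * R | normc (cplx p - z0) <= rho].
have Az : A (uncplx z0) by rewrite /A /= uncplxK subrr normc0.
have A0 : A !=set0 by exists (uncplx z0).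
have df : cdiff f := cdiff_smooth sf.
have cf : continuous (re_part f).
  by move=> p; apply: differentiable_continuous; have [] := cdiff_parts p df.
have [c] := compact_EVT_max A0 (compact_disc (z0:=z0) (rho:=rho)) (continuous_subspaceT cf).
rewrite inE => Ac cmax.
have zc : complex.Re (f z0) <= re_part f c.
  have := cmax (uncplx z0); rewrite inE => /(_ Az).
  by rewrite /re_part uncplxK.
have [cr|cr] := eqVneq (normc (cplx c - z0)) rho.
  by apply: le_trans zc _; exact: bd.
have {}cr : normc (cplx c - z0) < rho by rewrite lt_neqAle cr.
pose d := rho - normc (cplx c - z0).
have d0 : 0 < d by rewrite subr_gt0.
have inA v (t : R) : normc (cplx v) = 1 -> `|t| < d -> re_part f (c + t *: v) <= re_part f c.
  move=> v1 td; apply: cmax; rewrite inE /A /=.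
  have -> : cplx (c + t *: v) - z0 = (cplx c - z0) + cplx (t *: v).
    by rewrite cplxD addrAC.
  apply: le_trans (le_normcD _ _) _; rewrite normc_scale v1 mulr1.
  by move: td; rewrite /d; lra.
have n1 : normc (cplx ((1, 0) : R * R)) = 1 by rewrite /cplx /= expr1n expr0n addr0 sqrtr1.
have n2 : normc (cplx ((0, 1) : R * R)) = 1 by rewrite /cplx /= expr1n expr0n add0r sqrtr1.
have h1 : re_part (Dx (Dx f)) c <= 0.
  apply: (@second_pderiv_at_max f (Dx f) _ (1, 0) c d) => //.
  - exact: cdiff_smooth (smooth_Dx sf).
  - by rewrite -DxE.
  - by rewrite -DxE.
  - by move=> t; exact: inA.
have h2 : re_part (Dy (Dy f)) c <= 0.
  apply: (@second_pderiv_at_max f (Dy f) _ (0, 1) c d) => //.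
  - exact: cdiff_smooth (smooth_Dy sf).
  - by rewrite -DyE.
  - by rewrite -DyE.
  - by move=> t; exact: inA.
have := lap _ cr; rewrite Re_addc ltNge => /negP[].
by apply: le_trans (lerD h1 h2) _; rewrite addr0.
Qed.

(** The Laplacian is four times the product of the Wirtinger derivatives, in
    either order. *)
Lemma Dz_DzbE f z : smooth f ->
  Dz (Dzb f) z = (Dx (Dx f) z + Dy (Dy f) z) / 4 /\ Dzb (Dz f) z = Dz (Dzb f) z.
Proof.
move=> sf; have sx := smooth_Dx sf; have sy := smooth_Dy sf.
have Eb : Dzb f = (2^-1 : R[i]) *: Dx f + ((2^-1 * 'i%C) *: Dy f + 0).
  by rewrite -DzbE -DxE -DyE; exact: dzbarE.
have Ez : Dz f = (2^-1 : R[i]) *: Dx f + ((2^-1 * (- 'i%C)) *: Dy f + 0).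
  apply/funext => u; rewrite -[RHS]/(2^-1 * Dx f u + (2^-1 * (- 'i%C) * Dy f u + 0)) Dz_def.
  by move: (Dx f u) (Dy f u) => a b; ring.
have s0 := @smooth0 R.
have sb (b : R[i]) : smooth (b *: Dy f + 0) by apply: smooth_lin.
have d0x : Dx (0 : R[i] -> R[i]) = cst 0 := Dx_cst 0.
have d0y : Dy (0 : R[i] -> R[i]) = cst 0 := Dy_cst 0.
have X (a b : R[i]) : Dx (a *: Dx f + (b *: Dy f + 0)) z = a * Dx (Dx f) z + b * Dx (Dy f) z.
  rewrite (Dx_lin a sx (sb b)) (Dx_lin b sy s0).
  rewrite d0x; exact: (congr1 (+%R (a * Dx (Dx f) z)) (addr0 _)).
have Y (a b : R[i]) : Dy (a *: Dx f + (b *: Dy f + 0)) z = a * Dy (Dx f) z + b * Dy (Dy f) z.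
  rewrite (Dy_lin a sx (sb b)) (Dy_lin b sy s0).
  rewrite d0y; exact: (congr1 (+%R (a * Dy (Dx f) z)) (addr0 _)).
have S : Dx (Dy f) z = Dy (Dx f) z := congr1 (@^~ z) (Dx_Dy sf).
have i2 := sqr_i R.
have E1 : Dx (Dzb f) z = 2^-1 * Dx (Dx f) z + 2^-1 * 'i%C * Dx (Dy f) z.
  by rewrite Eb; exact: X.
have E2 : Dy (Dzb f) z = 2^-1 * Dy (Dx f) z + 2^-1 * 'i%C * Dy (Dy f) z.
  by rewrite Eb; exact: Y.
have E3 : Dx (Dz f) z = 2^-1 * Dx (Dx f) z + 2^-1 * (- 'i%C) * Dx (Dy f) z.
  by rewrite Ez; exact: X.
have E4 : Dy (Dz f) z = 2^-1 * Dy (Dx f) z + 2^-1 * (- 'i%C) * Dy (Dy f) z.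
  by rewrite Ez; exact: Y.
have E5 : Dz (Dzb f) z = (Dx (Dx f) z + Dy (Dy f) z) / 4.
  rewrite Dz_def E1 E2 S.
  move: (Dx (Dx f) z) (Dy (Dx f) z) (Dy (Dy f) z) i2 => a b c; move: 'i%C => i i2.
  by clear -i2; field: i2.
split; first exact: E5.
rewrite E5 Dzb_def E3 E4 S.
move: (Dx (Dx f) z) (Dy (Dx f) z) (Dy (Dy f) z) i2 => a b c; move: 'i%C => i i2.
by clear -i2; field: i2.
Qed.

Lemma Dzb_Dz f : smooth f -> Dzb (Dz f) = Dz (Dzb f).
Proof. by move=> sf; apply/funext => z; have [] := Dz_DzbE z sf. Qed.

(** Holomorphy in the real-variable form that the definition of n-analytic
    functions uses. *)
Definition hol f : Prop := smooth f /\ Dzb f = 0.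

Lemma hol_Dz f : hol f -> hol (Dz f).
Proof.
move=> [sf hf]; split; first exact: smooth_Dz.
by rewrite (Dzb_Dz sf) hf; exact: (Dz_cst 0).
Qed.

Lemma hol_iter_Dz f n : hol f -> hol (iter n (@Dz R) f).
Proof. by move=> hf; elim: n => // n IH; rewrite iterS; exact: hol_Dz. Qed.

Lemma Re_mul_conj (a : R[i]) : complex.Re (a * a^*) = normc a ^+ 2.
Proof. by rewrite normcE2; case: a => a b /=; ring. Qed.

Lemma conj_real (a : R) : (a%:C)^* = a%:C.
Proof. by apply/eqP; rewrite eq_complex/= oppr0 !eqxx. Qed.

Lemma mul_conj (a : R[i]) : a * a^* = (normc a ^+ 2)%:C.
Proof.
rewrite normcE2; case: a => a b; apply/eqP; rewrite eq_complex/=.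
by apply/andP; split; apply/eqP; ring.
Qed.

Lemma shift_facts z0 : let f0 : R[i] -> R[i] := id - cst z0 in
  [/\ smooth f0, Dz f0 = 1, Dzb f0 = 0, Dz (conjf f0) = 0 & Dzb (conjf f0) = 1].
Proof.
move=> f0.
have sid := @smooth_id R; have sc : smooth (- cst z0) by apply/smoothN/smooth_cst.
have s0 : smooth f0 by apply: smoothD.
have d1 : Dz f0 = 1.
  rewrite (DzD sid sc) Dz_id (DzN (smooth_cst z0)) Dz_cst; exact: subr0.
have d2 : Dzb f0 = 0.
  rewrite (DzbD sid sc) Dzb_id (DzbN (smooth_cst z0)) Dzb_cst; exact: subr0.
split => //.
  by rewrite (Dz_conj s0) d2; apply/funext => z; rewrite conjfE; exact: rmorph0.
by rewrite (Dzb_conj s0) d1; apply/funext => z; rewrite conjfE; exact: rmorph1.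
Qed.

(** Adding c |z - z0|^2 with small c > 0 makes the Laplacian positive and changes
    the boundary values by at most c rho^2. *)
Lemma max_principle f z0 rho M : smooth f -> 0 <= rho ->
  (forall z, normc (z - z0) < rho -> 0 <= complex.Re (Dz (Dzb f) z)) ->
  (forall z, normc (z - z0) = rho -> complex.Re (f z) <= M) ->
  complex.Re (f z0) <= M.
Proof.
move=> sf rho0 lap bd; apply/ler_addgt0Pl => e e0.
have [s0 d1 d2 d3 d4] := shift_facts z0.
set f0 := (id - cst z0 : R[i] -> R[i]) in s0 d1 d2 d3 d4.
have sb := smooth_conj s0.
(* This value keeps c rho^2 below e, also for rho = 0. *)
pose c := e / (rho ^+ 2 + 1).
have r1 : 0 < rho ^+ 2 + 1 by rewrite ltr_wpDl// sqr_ge0.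
have c0 : 0 < c by rewrite divr_gt0.
pose N := f0 * conjf f0.
have sN : smooth N by exact: smoothM.
have NE z : N z = (normc (z - z0) ^+ 2)%:C by rewrite -mul_conj.
have dN z : Dz (Dzb N) z = 1.
  by rewrite (DzbM s0 sb) d2 d4 mul0r mulr1 add0r d1.
pose psi := c%:C *: N + f.
have spsi : smooth psi by exact: smooth_lin.
have psiE z : complex.Re (psi z) = c * normc (z - z0) ^+ 2 + complex.Re (f z).
  rewrite -[psi z]/(c%:C * N z + f z) Re_addc NE; congr (_ + _).
  by rewrite Re_mulc /= mul0r subr0.
suff : complex.Re (psi z0) <= M + c * rho ^+ 2.
  rewrite psiE subrr normc0 expr0n mulr0 add0r => /le_trans; apply.
  rewrite addrC lerD2r /c mulrAC ler_pdivrMr// ler_wpM2l ?ltW//; lra.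
apply: (@strict_max_principle psi z0 rho) => //.
  move=> z zr.
  have [E _] := Dz_DzbE z spsi.
  have {}E : Dx (Dx psi) z + Dy (Dy psi) z = 4 * Dz (Dzb psi) z.
    by rewrite E mulrC divfK// pnatr_eq0.
  rewrite E.
  have -> : Dz (Dzb psi) z = c%:C + Dz (Dzb f) z.
    rewrite (Dzb_lin c%:C sN sf) (Dz_lin c%:C (smooth_Dzb sN) (smooth_Dzb sf)).
    by rewrite -[LHS]/(c%:C * Dz (Dzb N) z + Dz (Dzb f) z) dN mulr1.
  have := lap z zr; move: (Dz (Dzb f) z) => [a b] /= a0.
  by move: c0 a0; clear; nra.
by move=> z zr; rewrite psiE zr addrC lerD2r; exact: bd.
Qed.

Lemma conj_bilin (x y u v : R[i]) :
  (2 * x * y - u * v)^* = 2 * x^* * y^* - u^* * v^*.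
Proof.
case: x y u v => [x1 x2] [y1 y2] [u1 u2] [v1 v2].
by apply/eqP; rewrite eq_complex/=; apply/andP; split; apply/eqP; ring.
Qed.

Lemma bernstein_bound (rho M x y : R) : 0 < rho -> 0 <= M -> 0 <= x -> 0 <= y ->
  2 * rho ^+ 2 * x + (rho ^+ 2) ^+ 2 * y ^+ 2 <= 2 * rho ^+ 2 * M ^+ 2 ->
  y <= 2 * M / rho.
Proof.
move=> rho0 M0 x0 y0 H.
have r2 : 0 < rho ^+ 2 by rewrite exprn_gt0.
rewrite ler_pdivlMr// -(@ler_pXn2r _ 2) ?nnegrE ?mulr_ge0 ?(ltW rho0)//.
rewrite -(ler_pM2l r2).
have h1 : 0 <= rho ^+ 2 * x by rewrite mulr_ge0// ltW.
have h2 : 0 <= rho ^+ 2 * M ^+ 2 by rewrite mulr_ge0 ?sqr_ge0.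
have -> : rho ^+ 2 * (y * rho) ^+ 2 = (rho ^+ 2) ^+ 2 * y ^+ 2 by ring.
have -> : rho ^+ 2 * (2 * M) ^+ 2 = 4 * (rho ^+ 2 * M ^+ 2) by ring.
lra.
Qed.

(** The maximum principle is applied to the auxiliary function of Bernstein
      phi = 2 rho^2 |h|^2 + w^2 |k|^2,  w = rho^2 - |z - z0|^2,  k = dh/dz,
    whose mixed Wirtinger derivative is the square
      |2 conj(z - z0) k - w dk/dz|^2.
    The weight w vanishes on the circle, where only |h| is known to be bounded. *)
Lemma cauchy_estimate h z0 rho M : hol h -> 0 < rho ->
  (forall z, normc (z - z0) <= rho -> normc (h z) <= M) ->
  normc (Dz h z0) <= 2 * M / rho.
Proof.
move=> hh rho0 hM.
have M0 : 0 <= M.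
  by apply: le_trans (normc_ge0 (h z0)) (hM _ _); rewrite subrr normc0 ltW.
have [[sh h0] [sk k0] [sl l0]] := And3 hh (hol_Dz hh) (hol_Dz (hol_Dz hh)).
pose k := Dz h; pose l := Dz k.
have [s0 d1 d2 d3 d4] := shift_facts z0.
set f0 := (id - cst z0 : R[i] -> R[i]) in s0 d1 d2 d3 d4.
have sb := smooth_conj s0.
have [shb skb slb] := And3 (smooth_conj sh) (smooth_conj sk) (smooth_conj sl).
have cj0 : conjf (0 : R[i] -> R[i]) = 0 by apply/funext => z; exact: rmorph0.
have hb1 : Dz (conjf h) = 0 by rewrite (Dz_conj sh) h0.
have hb2 : Dzb (conjf h) = conjf k by rewrite (Dzb_conj sh).
have kb1 : Dz (conjf k) = 0 by rewrite (Dz_conj sk) k0.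
have kb2 : Dzb (conjf k) = conjf l by rewrite (Dzb_conj sk).
have lb1 : Dz (conjf l) = 0 by rewrite (Dz_conj sl) l0.
pose w := cst (rho ^+ 2)%:C - f0 * conjf f0.
have sff : smooth (f0 * conjf f0) by exact: smoothM.
have sw : smooth w by apply: smoothD; [exact: smooth_cst|exact: smoothN].
have dw : Dz w = - conjf f0.
  rewrite (DzD (smooth_cst _) (smoothN sff)) (DzN sff) (DzM s0 sb) d1 d3 mulr0 mul1r addr0.
  by rewrite Dz_cst add0r.
have dbw : Dzb w = - f0.
  rewrite (DzbD (smooth_cst _) (smoothN sff)) (DzbN sff) (DzbM s0 sb) d2 d4 mul0r mulr1 add0r.
  by rewrite Dzb_cst add0r.
have sww := smoothM sw sw; have skk := smoothM sk skb; have shh := smoothM sh shb.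
have skl := smoothM sk slb; have shk := smoothM sh skb.
pose C : R[i] := (2 * rho ^+ 2)%:C.
pose phi := C *: (h * conjf h) + (w * w) * (k * conjf k).
have sphi : smooth phi by apply: smooth_lin => //; exact: smoothM.
pose A := - (f0 * w + w * f0).
have sA : smooth A by apply/smoothN/smoothD; exact: smoothM.
have dbphi : Dzb phi = C *: (h * conjf k) + (A * (k * conjf k) + (w * w) * (k * conjf l)).
  rewrite (Dzb_lin _ shh (smoothM sww skk)) (DzbM sh shb) h0 hb2 mul0r add0r.
  rewrite (DzbM sww skk) (DzbM sw sw) (DzbM sk skb) k0 kb2 mul0r add0r dbw.
  by rewrite mulNr mulrN -opprD.
have dA : Dz A = - (w - f0 * conjf f0 + (w - conjf f0 * f0)).
  rewrite (DzN (smoothD (smoothM s0 sw) (smoothM sw s0))) (DzD (smoothM s0 sw) (smoothM sw s0)).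
  rewrite (DzM s0 sw) (DzM sw s0) dw d1 mul1r mulr1 mulrN mulNr.
  by congr (- (_ + _)); rewrite addrC.
have ddphi z : Dz (Dzb phi) z =
    (2 * (f0 z)^* * k z - w z * l z) * (2 * (f0 z)^* * k z - w z * l z)^*.
  rewrite dbphi.
  rewrite (Dz_lin _ shk (smoothD (smoothM sA skk) (smoothM sww skl))).
  rewrite (DzD (smoothM sA skk) (smoothM sww skl)) (DzM sA skk) (DzM sww skl) (DzM sw sw).
  rewrite (DzM sh skb) (DzM sk skb) (DzM sk slb) kb1 lb1 dw dA !mulr0 !addr0.
  rewrite -[LHS]/(C * (k z * (k z)^*) +
    (- (w z - f0 z * (f0 z)^* + (w z - (f0 z)^* * f0 z)) * (k z * (k z)^*) +
     - (f0 z * w z + w z * f0 z) * (l z * (k z)^*) +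
     ((- (f0 z)^* * w z + w z * - (f0 z)^*) * (k z * (l z)^*) +
      w z * w z * (l z * (l z)^*)))).
  have wr : (w z)^* = w z.
    rewrite -[w z]/((rho ^+ 2)%:C - f0 z * (f0 z)^*) mul_conj.
    by rewrite cconjB !conj_real.
  have CE : C = 2 * (w z + f0 z * (f0 z)^*).
    by rewrite -[w z]/((rho ^+ 2)%:C - f0 z * (f0 z)^*) subrK /C rmorphM rmorph_nat.
  have -> : (2 * (f0 z)^* * k z - w z * l z)^* = 2 * f0 z * (k z)^* - w z * (l z)^*.
    by rewrite conj_bilin wr conjCK.
  rewrite CE.
  move: (w z) (f0 z) ((f0 z)^*) (k z) ((k z)^*) (l z) ((l z)^*) => a b b' c c' d d'.
  ring.
have phiE z : complex.Re (phi z) = 2 * rho ^+ 2 * normc (h z) ^+ 2 +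
    (rho ^+ 2 - normc (z - z0) ^+ 2) ^+ 2 * normc (k z) ^+ 2.
  rewrite -[phi z]/(C * (h z * (h z)^*) +
    (((rho ^+ 2)%:C - (z - z0) * (z - z0)^*) * ((rho ^+ 2)%:C - (z - z0) * (z - z0)^*)) *
     (k z * (k z)^*)).
  rewrite !mul_conj /C -!(rmorphB, rmorphM, rmorphD)/=.
  by ring.
have key : complex.Re (phi z0) <= 2 * rho ^+ 2 * M ^+ 2.
  apply: (@max_principle phi z0 rho) => //; first exact: ltW.
    by move=> z _; rewrite ddphi Re_mul_conj sqr_ge0.
  move=> z zr; rewrite phiE zr subrr expr0n mul0r addr0 ler_wpM2l//.
    by rewrite mulr_ge0// sqr_ge0.
  by rewrite ler_sqr ?nnegrE ?normc_ge0// hM// zr.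
move: key; rewrite phiE subrr normc0 expr0n subr0.
have := normc_ge0 (k z0); have := sqr_ge0 (normc (h z0)).
by rewrite -/k; move: (normc (h z0) ^+ 2) => x x0 y0; exact: bernstein_bound.
Qed.

End maximum_principle.

(** * Power series of functions annihilated by d/dzbar *)

Section taylor.
Variable R : realType.
Implicit Types (f g h : R[i] -> R[i]) (z : R[i]) (rho M r : R) (a : nat -> R[i]).

(** Convergence of complex sequences, measured with the real-valued modulus. *)
Definition clim (u : nat -> R[i]) (l : R[i]) : Prop :=
  forall e : R, 0 < e -> exists N, forall n, (N <= n)%N -> normc (u n - l) <= e.

Lemma normc_dist (x y z : R[i]) : normc (x - z) <= normc (x - y) + normc (y - z).
Proof. by rewrite -[x - z](subrKA y) le_normcD. Qed.

Lemma normcB (x y : R[i]) : normc (x - y) = normc (y - x).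
Proof. by rewrite -opprB normcN. Qed.

Lemma clim_le u l (c : R[i]) (b : R) N : clim u l ->
  (forall n, (N <= n)%N -> normc (u n - c) <= b) -> normc (l - c) <= b.
Proof.
move=> ul ub; apply/ler_addgt0Pl => e e0.
have [K HK] := ul e e0; have := HK (maxn K N) (leq_maxl _ _).
have := ub (maxn K N) (leq_maxr _ _).
move=> h1 h2; apply: le_trans (normc_dist _ (u (maxn K N)) _) _.
by rewrite lerD// normcB.
Qed.

Lemma clim_unique u l l' : clim u l -> clim u l' -> l = l'.
Proof.
move=> ul ul'; apply/subr0_eq/eq0_normc/eqP.
rewrite eq_le normc_ge0 andbT; apply/ler_addgt0Pl => e e0; rewrite addr0.
by have [N HN] := ul' e e0; exact: (clim_le ul HN).
Qed.

Lemma clim_cst (c : R[i]) : clim (fun=> c) c.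
Proof. by move=> e e0; exists 0 => n _; rewrite subrr normc0 ltW. Qed.

Lemma climD u v (l m : R[i]) : clim u l -> clim v m -> clim (fun n => u n + v n) (l + m).
Proof.
move=> ul vm e e0; have e2 : 0 < e / 2 by rewrite divr_gt0.
have [N1 H1] := ul _ e2; have [N2 H2] := vm _ e2.
exists (maxn N1 N2) => n; rewrite geq_max => /andP[n1 n2].
have -> : u n + v n - (l + m) = (u n - l) + (v n - m) by ring.
by apply: le_trans (le_normcD _ _) _; rewrite [e]splitr lerD ?H1 ?H2.
Qed.

Lemma climZ (c : R[i]) u (l : R[i]) : clim u l -> clim (fun n => c * u n) (c * l).
Proof.
move=> ul e e0; have c1 : 0 < normc c + 1 by rewrite ltr_wpDl// normc_ge0.
have [N H] := ul (e / (normc c + 1)) (divr_gt0 e0 c1).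
exists N => n /H {}H; rewrite -mulrBr normcM.
rewrite ler_pdivlMr// in H; apply: le_trans _ H; rewrite mulrDr mulr1 mulrC.
by rewrite lerDl normc_ge0.
Qed.

Lemma clim_shift u (l : R[i]) k : clim u l -> clim (fun n => u (n + k)%N) l.
Proof.
move=> ul e e0; have [N H] := ul e e0; exists N => n Nn.
by apply: H; rewrite (leq_trans Nn)// leq_addr.
Qed.

Lemma normc_sum I (s : seq I) (P : pred I) (F : I -> R[i]) :
  normc (\sum_(i <- s | P i) F i) <= \sum_(i <- s | P i) normc (F i).
Proof.
elim/big_ind2 : _ => [|x y u v h1 h2|//]; first by rewrite normc0.
by apply: le_trans (le_normcD _ _) _; exact: lerD.
Qed.

Lemma normc_exp z n : normc (z ^+ n) = normc z ^+ n.
Proof. by elim: n => [|n IH]; rewrite ?expr0 ?normc1// !exprS normcM IH. Qed.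

Lemma normc_nat n : normc (n%:R : R[i]) = n%:R.
Proof. by rewrite normcMn normc1. Qed.

Lemma normc_real (x : R) : normc (x%:C) = `|x|.
Proof. by rewrite /= expr0n addr0 sqrtr_sqr. Qed.

Lemma normc_le_parts z : normc z <= `|complex.Re z| + `|complex.Im z|.
Proof.
have -> : z = (complex.Re z)%:C + 'i%C * (complex.Im z)%:C.
  by case: z => a b; apply/eqP; rewrite eq_complex/=; apply/andP; split; apply/eqP; ring.
apply: le_trans (le_normcD _ _) _; rewrite normcM !normc_real.
have -> : normc ('i%C : R[i]) = 1 by rewrite /= expr0n expr1n add0r sqrtr1.
by rewrite !Re_addc !Im_addc !Re_mulc !Im_mulc /= !mul0r !mul1r subr0 !addr0 ?add0r.
Qed.

Lemma sum_half (C : R) n m : 0 <= C -> (n <= m)%N ->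
  \sum_(n <= j < m) C * 2^-1 ^+ j <= 2 * C * 2^-1 ^+ n.
Proof.
move=> C0 nm; suff : \sum_(n <= j < m) C * 2^-1 ^+ j =
    2 * C * 2^-1 ^+ n - 2 * C * 2^-1 ^+ m.
  move=> ->; rewrite lerBlDr lerDl !mulr_ge0// exprn_ge0// invr_ge0//.
elim: m nm => [|m IH].
  by rewrite leqn0 => /eqP ->; rewrite big_geq// subrr.
rewrite leq_eqVlt => /orP[/eqP <-|]; first by rewrite big_geq// subrr.
rewrite ltnS => nm; rewrite big_nat_recr//= IH// exprS; by field.
Qed.

(** Geometric domination gives the limit together with the rate of convergence,
    and the rate is what later makes convergence uniform on discs. *)
Lemma clim_ex (u : nat -> R[i]) (C : R) : 0 <= C ->
  (forall j, normc (u j) <= C * 2^-1 ^+ j) ->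
  exists s, (forall n, normc (\sum_(j < n) u j - s) <= 2 * C * 2^-1 ^+ n).
Proof.
move=> C0 uC.
have cvR (v : nat -> R) : (forall j, `|v j| <= C * 2^-1 ^+ j) -> cvgn (series v).
  move=> vC; apply: normed_cvg; apply: (@series_le_cvg _ _ (geometric C 2^-1)) => //.
  - by move=> n; exact: normr_ge0.
  - by move=> n; rewrite /= mulr_ge0// exprn_ge0// invr_ge0.
  - apply: is_cvg_geometric_series; rewrite ger0_norm ?invr_ge0// invf_lt1// ltr1n//.
have c1 : cvgn (series (fun j => complex.Re (u j))).
  by apply: cvR => j; apply: le_trans (uC j); have [] := normc_ge_parts (u j).
have c2 : cvgn (series (fun j => complex.Im (u j))).
  by apply: cvR => j; apply: le_trans (uC j); have [] := normc_ge_parts (u j).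
pose s : R[i] := limn (series (fun j => complex.Re (u j))) +i*
                 limn (series (fun j => complex.Im (u j))).
have us : clim (fun n => \sum_(j < n) u j) s.
  move=> e e0; have e2 : 0 < e / 2 by rewrite divr_gt0.
  have /cvgrPdist_le/(_ _ e2)[N1 _ H1] := c1.
  have /cvgrPdist_le/(_ _ e2)[N2 _ H2] := c2.
  exists (maxn N1 N2) => n; rewrite geq_max => /andP[n1 n2].
  rewrite normcB; apply: le_trans (normc_le_parts _) _; rewrite [e]splitr.
  have -> : \sum_(j < n) u j = series (fun j => complex.Re (u j)) n +i*
      series (fun j => complex.Im (u j)) n.
    rewrite /series /= !big_mkord; elim/big_rec3 : _ => // i x y w _ ->.
    by case: (u i).
  by apply: lerD; [exact: H1|exact: H2].
exists s => n; rewrite normcB; apply: (clim_le (N := n) us) => m nm.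
have -> : \sum_(j < m) u j - \sum_(j < n) u j = \sum_(n <= j < m) u j.
  by rewrite -!(big_mkord xpredT u) (@big_cat_nat _ _ _ n)//= addrAC subrr add0r.
apply: le_trans (normc_sum _ _ _) _; apply: le_trans (sum_half C0 nm).
by apply: ler_sum => j _; exact: uC.
Qed.

(** Cauchy-Hadamard without limits superior: these are the coefficient sequences
    of power series with infinite radius of convergence. *)
Definition entire a := forall r, 0 < r -> exists C, forall j, normc (a j) * r ^+ j <= C.

Definition psum a n z : R[i] := \sum_(j < n) a j * z ^+ j.

(** The sum of the power series; the value 0 is taken where it diverges. *)
Definition pser a z : R[i] := xget 0 [set s | clim (fun n => psum a n z) s].

Lemma psum_rate a r (C : R) z : (forall j, normc (a j) * (2 * r) ^+ j <= C) ->
  normc z <= r -> exists s, forall n, normc (psum a n z - s) <= 2 * C * 2^-1 ^+ n.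
Proof.
move=> aC zr; have C0 : 0 <= C.
  by apply: le_trans (aC 0); rewrite expr0 mulr1 normc_ge0.
apply: (@clim_ex (fun j => a j * z ^+ j) C C0) => j; rewrite normcM normc_exp.
have r0 : 0 <= r by apply: le_trans zr; exact: normc_ge0.
apply: (@le_trans _ _ (normc (a j) * r ^+ j)).
  by rewrite ler_wpM2l ?normc_ge0// lerXn2r ?nnegrE ?normc_ge0.
have -> : normc (a j) * r ^+ j = normc (a j) * (2 * r) ^+ j * 2^-1 ^+ j.
  by rewrite exprMn -!mulrA; congr (_ * _); rewrite mulrCA -exprMn divff ?expr1n ?mulr1.
by rewrite ler_wpM2r// exprn_ge0// invr_ge0.
Qed.

Lemma clim_rate u (s : R[i]) (C : R) : (forall n, normc (u n - s) <= C * 2^-1 ^+ n) -> clim u s.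
Proof.
move=> H e e0.
have /cvgrPdist_le/(_ _ e0)[N _ HN] : (fun n => C * 2^-1 ^+ n) @ \oo --> (0 : R).
  apply: cvg_geometric; rewrite ger0_norm ?invr_ge0// invf_lt1// ltr1n//.
exists N => n /HN /=; rewrite sub0r normrN => h.
by apply: le_trans (H n) _; apply: le_trans h; rewrite ler_norm.
Qed.

Lemma pserP a z : entire a -> clim (fun n => psum a n z) (pser a z).
Proof.
move=> ea; have z1 : 0 < 2 * (normc z + 1) by rewrite mulr_gt0// ltr_wpDl// normc_ge0.
have [C HC] := ea _ z1.
have [||s Hs] := @psum_rate a (normc z + 1) C z; [exact: HC|by rewrite lerDl|].
apply: (@xgetPex _ 0 [set s | clim (fun n => psum a n z) s]).
by exists s; exact: clim_rate Hs.
Qed.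

Lemma pser_rate a r (C : R) z n : (forall j, normc (a j) * (2 * r) ^+ j <= C) ->
  entire a -> normc z <= r -> normc (psum a n z - pser a z) <= 2 * C * 2^-1 ^+ n.
Proof.
move=> aC ea zr; have [s Hs] := psum_rate aC zr.
by rewrite (clim_unique (pserP z ea) (clim_rate Hs)).
Qed.

Lemma leq_exp_ffact n m : (n ^ m <= (n + m) ^_ m)%N.
Proof.
elim: m => [|m IH]; first by rewrite expn0 ffactn0.
by rewrite addnS ffactSS expnS leq_mul// -addnS leq_addr.
Qed.

Lemma leq_bin_exp2 n m : ('C(n, m) <= 2 ^ n)%N.
Proof.
elim: n m => [|n IH] [|m]; rewrite ?bin0 ?expn_gt0//.
by rewrite binS expnS mul2n -addnn leq_add.
Qed.

(** Absorbs into k! the factor k^k that k applications of Cauchy's estimate, each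
    on a disc of radius rho / k, produce. *)
Lemma leq_expnn k : (k ^ k <= 4 ^ k * k`!)%N.
Proof.
apply: leq_trans (leq_exp_ffact k k) _.
rewrite -bin_ffact leq_mul2r; apply/orP; right.
by apply: leq_trans (leq_bin_exp2 _ _) _; rewrite addnn -mul2n expnM.
Qed.

Lemma bounded_on_disc f r : smooth f -> exists M, forall z, normc z <= r -> normc (f z) <= M.
Proof.
move=> sf; have [r0|r0] := ltP r 0.
  by exists 0 => z zr; have := le_lt_trans (normc_ge0 z) (le_lt_trans zr r0); rewrite ltxx.
pose A := [set p : R * R | normc (cplx p - 0) <= r].
have A0 : A !=set0.
  exists (uncplx 0); rewrite -[A _]/(is_true (normc (cplx (uncplx 0) - 0) <= r)).
  by rewrite uncplxK subrr normc0.
pose F (p : R * R) : R := normc (cplx (plane f p) - 0).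
have cF : continuous F.
  have -> : F = (fun p => normc (cplx p - 0)) \o plane f by [].
  move=> p; apply: continuous_comp; last exact: continuous_dist.
  exact/differentiable_continuous/(cdiff_smooth sf).
have [c _ cmax] := compact_EVT_max A0 (compact_disc (z0:=0) (rho:=r)) (continuous_subspaceT cF).
exists (F c) => z zr.
have zA : uncplx z \in A.
  by rewrite inE -[A _]/(is_true (normc (cplx (uncplx z) - 0) <= r)) uncplxK subr0.
have FE : F (uncplx z) = normc (f z).
  by rewrite /F subr0 -[plane f _]/(uncplx (f (cplx (uncplx z)))) !uncplxK.
by rewrite -FE; exact: cmax.
Qed.

(** The Cauchy-Riemann equation says that the differential is multiplication by
    the complex derivative. *)
Lemma hol_pderiv f v z : hol f -> pderiv v f z = cplx v * Dz f z.
Proof.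
move=> [sf hf]; rewrite (pderivE v z (cdiff_smooth sf)) DxE DyE.
have E : (Dx f z + 'i%C * Dy f z) / 2 = 0 by rewrite -Dzb_def hf.
have {}E : Dx f z = - ('i%C * Dy f z).
  by apply/eqP; rewrite -addr_eq0; have /eqP := E; rewrite mulf_eq0 invr_eq0 pnatr_eq0 orbF.
have E2 : Dy f z = 'i%C * Dx f z by rewrite E mulrN mulrA -expr2 sqr_i mulN1r opprK.
have i2 : 'i%C * 'i%C = -1 :> R[i] by rewrite -expr2 sqr_i.
have E3 : 'i%C * ('i%C * Dx f z) = - Dx f z by rewrite mulrA i2 mulN1r.
rewrite Dz_def E2 E3; case: v => a b.
have -> : cplx (a, b) = a%:C + b%:C * 'i%C.
  by apply/eqP; rewrite eq_complex/=; apply/andP; split; apply/eqP; ring.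
by move: (Dx f z) => X; rewrite -[(a, b).1]/a -[(a, b).2]/b; field.
Qed.

(** The mean value theorem on the segment from 0 to z, for the real and the
    imaginary part separately; hence the factor 2. *)
Lemma hol_mean_value f r K z : hol f -> normc z <= r ->
  (forall u, normc u <= r -> normc (Dz f u) <= K) ->
  normc (f z - f 0) <= 2 * (normc z * K).
Proof.
move=> hf zr HK; have [sf _] := hf; have df := cdiff_smooth sf.
have K0 : 0 <= K.
  apply: le_trans (HK 0 _); first exact: normc_ge0.
  by rewrite normc0 (le_trans _ zr)// normc_ge0.
pose v := uncplx z.
have in_disc (t : R) : 0 < t -> t < 1 -> normc (cplx (0 + t *: v)) <= r.
  move=> t0 t1; rewrite add0r normc_scale uncplxK gtr0_norm//.
  by apply: le_trans zr; rewrite ler_piMl ?normc_ge0// ltW.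
have bd (P : (R[i] -> R[i]) -> R * R -> R) (Q : R[i] -> R) :
    (forall g p, P g p = Q (g (cplx p))) -> (forall u, `|Q u| <= normc u) ->
    (forall p, differentiable (P f) p) -> 'D_v (P f) = P (pderiv v f) ->
    `|Q (f z) - Q (f 0)| <= normc z * K.
  move=> PQ Qn dP DP.
  have dg (t : R) : is_derive t (1 : R) (fun s => P f (0 + s *: v)) (P (pderiv v f) (0 + t *: v)).
    by rewrite -DP; apply: line_derive.
  have [|t] := @MVT R _ _ 0 1 ltr01 (fun t _ => dg t).
    by apply: derivable_within_continuous => t _; exact: ex_derive.
  rewrite in_itv/= => /andP[t0 t1].
  rewrite !PQ scale0r scale1r !add0r subr0 mulr1.
  have -> : cplx v = z by rewrite uncplxK.
  have -> : cplx (0 : R * R) = 0 by [].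
  move=> ->; apply: le_trans (Qn _) _.
  rewrite hol_pderiv// normcM uncplxK ler_wpM2l ?normc_ge0// HK//.
  by have := in_disc t t0 t1; rewrite add0r.
have h1 := bd (@re_part R) (@complex.Re R) (fun _ _ => erefl) (fun u => (normc_ge_parts u).1)
  (fun p => (cdiff_parts p df).1) (D_re_part v df).
have h2 := bd (@im_part R) (@complex.Im R) (fun _ _ => erefl) (fun u => (normc_ge_parts u).2)
  (fun p => (cdiff_parts p df).2) (D_im_part v df).
apply: le_trans (normc_le_parts _) _.
have E : complex.Re (f z - f 0) = complex.Re (f z) - complex.Re (f 0) /\
         complex.Im (f z - f 0) = complex.Im (f z) - complex.Im (f 0).
  by case: (f z) (f 0) => ? ? [].
by rewrite E.1 E.2 mulr2n mulrDl mul1r; exact: lerD.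
Qed.

(** Each derivative costs a shrinking of the disc by rho / k. *)
Lemma cauchy_iter h r rho M k : hol h -> 0 < rho -> (0 < k)%N ->
  (forall z, normc z <= r + rho -> normc (h z) <= M) ->
  forall i z, normc z <= r + rho - i%:R * (rho / k%:R) ->
  normc (iter i (@Dz R) h z) <= (2 * k%:R / rho) ^+ i * M.
Proof.
move=> hh rho0 k0 hM; have kr : 0 < k%:R :> R by rewrite ltr0n.
have d0 : 0 < rho / k%:R by rewrite divr_gt0.
elim=> [|i IH] z; first by rewrite mul0r subr0 expr0 mul1r; exact: hM.
move=> zr; rewrite iterS.
have -> : (2 * k%:R / rho) ^+ i.+1 * M = 2 * ((2 * k%:R / rho) ^+ i * M) / (rho / k%:R).
  by rewrite exprS invf_div; ring.
apply: cauchy_estimate => //; first exact: hol_iter_Dz.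
move=> u uz; apply: IH; apply: le_trans (_ : normc u <= normc (u - z) + normc z) _.
  by rewrite -[u in normc u](subrK z) le_normcD.
have E : i.+1%:R * (rho / k%:R) = i%:R * (rho / k%:R) + rho / k%:R.
  by rewrite -addn1 natrD mulrDl mul1r.
move: uz zr; rewrite E; move: (rho / k%:R) => d; clear; lra.
Qed.

Lemma cauchy_fact h r rho M : hol h -> 0 < rho ->
  (forall z, normc z <= r + rho -> normc (h z) <= M) ->
  forall k z, normc z <= r -> normc (iter k (@Dz R) h z) <= (8 / rho) ^+ k * M * k`!%:R.
Proof.
move=> hh rho0 hM k z zr.
have M0 : 0 <= M.
  apply: le_trans (hM z _); first exact: normc_ge0.
  by apply: le_trans zr _; rewrite lerDl ltW.
case: k => [|k]; first by rewrite expr0 mul1r mulr1 hM// (le_trans zr)// lerDl ltW.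
have kr : 0 < k.+1%:R :> R by rewrite ltr0n.
apply: (@le_trans _ _ ((2 * k.+1%:R / rho) ^+ k.+1 * M)).
  apply: (@cauchy_iter h r rho M k.+1 hh rho0 _ hM) => //.
  by rewrite [k.+1%:R * _]mulrC divfK ?gt_eqF// addrK.
rewrite [leRHS]mulrAC ler_wpM2r//.
have -> : 8 / rho = (2 / rho) * 4 :> R by ring.
have -> : 2 * k.+1%:R / rho = (2 / rho) * k.+1%:R :> R by ring.
rewrite [(_ * k.+1%:R) ^+ _]exprMn [(_ * 4) ^+ _]exprMn -mulrA ler_wpM2l ?exprn_ge0 ?divr_ge0 ?(ltW rho0)//.
by rewrite -!natrX -natrM ler_nat leq_expnn.
Qed.

Definition taylor_coef h j : R[i] := iter j (@Dz R) h 0 / j`!%:R.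

Lemma entire_taylor h : hol h -> entire (taylor_coef h).
Proof.
move=> hh r r0; have [sh _] := hh.
have rho0 : 0 < 8 * r by rewrite mulr_gt0.
have [M HM] := bounded_on_disc (0 + 8 * r) sh.
exists M => j.
have := cauchy_fact hh rho0 HM j; move=> /(_ 0); rewrite normc0 lexx => /(_ isT) H.
have f0 : 0 < j`!%:R :> R by rewrite ltr0n fact_gt0.
rewrite /taylor_coef normcM normcV normc_nat mulrAC ler_pdivrMr//.
rewrite -ler_pdivlMr ?exprn_gt0//; apply: le_trans H _.
rewrite le_eqVlt; apply/orP; left; apply/eqP.
have -> : 8 / (8 * r) = r^-1 by rewrite invfM mulrA divff ?mul1r// pnatr_eq0.
by rewrite exprVn; ring.
Qed.

(** In Taylor's polynomial the expansion point is the variable and the target w is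
    fixed, so that the derivative telescopes. *)
Lemma taylor_hol h w N : hol h ->
  let F : R[i] -> R[i] :=
    \sum_(j < N.+1) (j`!%:R^-1 : R[i]) *: (iter j (@Dz R) h * (cst w - id) ^+ j) in
  hol F /\ Dz F = (N`!%:R^-1 : R[i]) *: (iter N.+1 (@Dz R) h * (cst w - id) ^+ N).
Proof.
move=> hh; have sid := @smooth_id R.
pose f0 : R[i] -> R[i] := cst w - id.
have s0 : smooth f0 by apply: smoothD; [exact: smooth_cst|exact: smoothN].
have d1 : Dz f0 = - 1.
  by rewrite (DzD (smooth_cst w) (smoothN sid)) (DzN sid) Dz_cst Dz_id add0r.
have d2 : Dzb f0 = 0.
  by rewrite (DzbD (smooth_cst w) (smoothN sid)) (DzbN sid) Dzb_cst Dzb_id add0r oppr0.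
have sX n := smoothX n s0.
have hX n : Dzb (f0 ^+ n) = 0.
  by rewrite (DzbX n s0) d2; apply/funext => z; exact: mulr0.
have sI n : smooth (iter n (@Dz R) h) by have [] := hol_iter_Dz n hh.
have hI n : Dzb (iter n (@Dz R) h) = 0 by have [] := hol_iter_Dz n hh.
have sT n (c : R[i]) : smooth (c *: (iter n (@Dz R) h * f0 ^+ n)).
  by apply/smoothZ/smoothM.
have dT n (c : R[i]) : Dzb (c *: (iter n (@Dz R) h * f0 ^+ n)) = 0.
  by rewrite (DzbZ _ (smoothM (sI n) (sX n))) (DzbM (sI n) (sX n)) hI hX mul0r mulr0 addr0 scaler0.
rewrite -/f0.
have sF N' : smooth (\sum_(j < N') (j`!%:R^-1 : R[i]) *: (iter j (@Dz R) h * f0 ^+ j)).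
  by apply: smooth_sum => j _; exact: sT.
split.
  split => //; rewrite Dzb_sum; last by move=> j _; exact: sT.
  by rewrite big1// => j _; exact: dT.
elim: N => [|N IH].
  rewrite big_ord1 /= fact0 invr1 !scale1r !expr0 !mulr1 //.
rewrite big_ord_recr/= (DzD (sF _) (sT _ _)) IH.
rewrite (DzZ _ (smoothM (sI N.+1) (sX N.+1))) (DzM (sI N.+1) (sX N.+1)) (DzX _ s0) d1.
apply/funext => z; rewrite -[LHS]/(N`!%:R^-1 * (iter N.+1 (@Dz R) h z * (f0 ^+ N) z) +
  N.+1`!%:R^-1 * (iter N.+2 (@Dz R) h z * (f0 ^+ N.+1) z +
    iter N.+1 (@Dz R) h z * (N.+1%:R * f0 z ^+ N * - 1))).
rewrite -[RHS]/(N.+1`!%:R^-1 * (iter N.+2 (@Dz R) h z * (f0 ^+ N.+1) z)) !expfE.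
move: (f0 z) (iter N.+1 (@Dz R) h z) (iter N.+2 (@Dz R) h z) => a b c.
rewrite factS natrM invfM.
have n1 : N.+1%:R != 0 :> R[i] by rewrite pnatr_eq0.
have -> : N`!%:R^-1 * (b * a ^+ N) = N.+1%:R^-1 * N`!%:R^-1 * (b * (N.+1%:R * a ^+ N)).
  have f1 : N`!%:R != 0 :> R[i] by rewrite pnatr_eq0 -lt0n fact_gt0.
  move: n1 f1; move: (N.+1%:R : R[i]) (N`!%:R : R[i]) => x y x0 y0.
  by field; rewrite x0 y0.
by ring.
Qed.

(** The function u |-> sum_(j <= N) h^(j)(u) (z - u)^j / j! is h(z) at u = z and the
    N-th Taylor polynomial at u = 0. Its derivative is
    h^(N+1)(u) (z - u)^N / N!, and Cauchy's estimate on discs of radius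
    64 (|z| + 1) makes it so small that the two values differ by at most a
    multiple of 2^-N. *)
Theorem hol_pser h z : hol h -> h z = pser (taylor_coef h) z.
Proof.
move=> hh; have [sh _] := hh.
apply: (clim_unique _ (pserP z (entire_taylor hh))).
(* With rho = 64 r the mean value bound below is (|z| / r) M (N+1) / 4^(N+1), which
   is at most M / 2^N. *)
pose r := normc z + 1.
have r0 : 0 < r by rewrite ltr_wpDl// normc_ge0.
have zr : normc z <= r by rewrite lerDl.
have [M HM] := bounded_on_disc (r + 64 * r) sh.
have rho0 : 0 < 64 * r by rewrite mulr_gt0.
have M0 : 0 <= M.
  apply: le_trans (HM 0 _); first exact: normc_ge0.
  by rewrite normc0 ltW// addr_gt0.
suff H N : normc (psum (taylor_coef h) N.+1 z - h z) <= M * 2^-1 ^+ N.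
  have : clim (fun n => psum (taylor_coef h) (n + 1)%N z) (h z).
    by apply: (@clim_rate _ _ M) => n; rewrite addn1.
  move=> cl e e0; have [N HN] := cl e e0; exists N.+1 => -[//|n]; rewrite ltnS => /HN.
  by rewrite addn1.
have [hF dF] := taylor_hol z N hh.
set F := (X in hol X) in hF dF.
have Fz : F z = h z.
  rewrite /F sumfE big_ord_recl big1 ?addr0 => [|j _].
    rewrite -[LHS]/(0`!%:R^-1 * (h z * ((cst z - id) ^+ 0 : R[i] -> R[i]) z)).
    by rewrite fact0 invr1 mul1r expr0; exact: mulr1.
  rewrite -[LHS]/(_ * (_ * ((cst z - id) ^+ lift ord0 j : R[i] -> R[i]) z)) expfE.
  by rewrite -[(cst z - id) z]/(z - z) subrr expr0n /= !mulr0.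
have F0 : F 0 = psum (taylor_coef h) N.+1 z.
  rewrite /F sumfE /psum; apply: eq_bigr => j _.
  rewrite -[LHS]/(j`!%:R^-1 * (iter j (@Dz R) h 0 * ((cst z - id) ^+ j : R[i] -> R[i]) 0)) expfE.
  by rewrite -[(cst z - id) 0]/(z - 0) subr0 /taylor_coef; ring.
rewrite -F0 -Fz normcB.
have f0 : 0 < N`!%:R :> R by rewrite ltr0n fact_gt0.
have HD u : normc u <= r -> normc (Dz F u) <= N.+1%:R * M * (8 / (64 * r)) ^+ N.+1 * (2 * r) ^+ N.
  move=> ur; rewrite dF.
  rewrite -[X in normc X]/(N`!%:R^-1 * (iter N.+1 (@Dz R) h u * ((cst z - id) ^+ N : R[i] -> R[i]) u)).
  rewrite expfE -[(cst z - id) u]/(z - u) !normcM normc_exp normcV normc_nat.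
  have h1 := cauchy_fact hh rho0 HM N.+1 ur.
  have h2 : normc (z - u) ^+ N <= (2 * r) ^+ N.
    rewrite lerXn2r ?nnegrE ?normc_ge0 ?mulr_ge0 ?(ltW r0)//.
    by apply: le_trans (le_normcD _ _) _; rewrite normcN mulr2n mulrDl mul1r lerD.
  rewrite mulrC ler_pdivrMr//.
  apply: le_trans (ler_pM (normc_ge0 _) (exprn_ge0 _ (normc_ge0 _)) h1 h2) _.
  rewrite factS natrM le_eqVlt; apply/orP; left; apply/eqP; ring.
apply: le_trans (hol_mean_value hF zr HD) _.
have -> : 8 / (64 * r) = (8 * r)^-1.
  have rn : r != 0 by rewrite gt_eqF.
  by field.
rewrite exprVn !exprMn.
have E : 2 * (normc z * (N.+1%:R * M * (8 ^+ N.+1 * r ^+ N.+1)^-1 * (2 ^+ N * r ^+ N))) =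
   (normc z / r) * M * (N.+1%:R * 2^-1 ^+ N.*2 * 2^-1 ^+ 2).
  have rn : r != 0 by rewrite gt_eqF.
  have e8 : (8 : R) ^+ N = (2 ^+ N) ^+ 3.
    by rewrite -exprM mulnC exprM; congr (_ ^+ N); rewrite -natrX.
  have p0 : (2 : R) ^+ N != 0 by rewrite expf_neq0.
  have q0 : r ^+ N != 0 by rewrite expf_neq0.
  rewrite [8 ^+ _]exprS e8 [r ^+ N.+1]exprS -addnn exprD !exprVn.
  move: p0 q0; move: (2 ^+ N) (r ^+ N) (N.+1%:R : R) (normc z) rn => x y n u rn x0 y0.
  by field; rewrite y0 x0 rn.
rewrite E.
have h1 : normc z / r <= 1 by rewrite ler_pdivrMr// mul1r.
have h2 : N.+1%:R * 2^-1 ^+ N.*2 * 2^-1 ^+ 2 <= 2^-1 ^+ N :> R.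
  have nx : N.+1%:R <= 2 ^+ N :> R by rewrite -natrX ler_nat ltn_expl.
  rewrite -addnn exprD mulrA; have y0 : 0 <= (2^-1 : R) ^+ N by rewrite exprn_ge0// invr_ge0.
  have xy : (2 : R) ^+ N * 2^-1 ^+ N = 1 by rewrite -exprMn divff ?expr1n.
  have ny : N.+1%:R * 2^-1 ^+ N <= 1 :> R by apply: le_trans (ler_wpM2r y0 nx) _; rewrite xy.
  have ny0 : 0 <= N.+1%:R * 2^-1 ^+ N :> R by rewrite mulr_ge0.
  have c1 : 2^-1 ^+ 2 <= 1 :> R by rewrite exprn_ile1// ?invr_ge0// invf_le1// ler1n.
  apply: (@le_trans _ _ (N.+1%:R * 2^-1 ^+ N * 2^-1 ^+ N)).
    by rewrite ler_piMr// mulr_ge0.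
  by rewrite ler_piMl.
have M1 : 0 <= (normc z / r) by rewrite divr_ge0 ?normc_ge0// ltW.
have p0 : 0 <= N.+1%:R * 2^-1 ^+ N.*2 * 2^-1 ^+ 2 :> R by rewrite !mulr_ge0// exprn_ge0// invr_ge0.
apply: ler_pM => //; first by rewrite mulr_ge0.
by rewrite ler_piMl.
Qed.

End taylor.

(** * Polyanalytic functions *)

Section entire_smooth.
Variable R : realType.
Implicit Types (f g h : R[i] -> R[i]) (z w : R[i]) (p v : R * R) (a : nat -> R[i]).

Lemma norm_le_normc p : `|p| <= normc (cplx p).
Proof.
case: p => x y; rewrite prod_normE /=.
have [h1 h2] := normc_ge_parts (cplx (x, y)).
by rewrite ge_max; apply/andP; split; [exact: h1|exact: h2].
Qed.

Lemma normc_le_norm p : normc (cplx p) <= 2 * `|p|.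
Proof.
case: p => x y; apply: le_trans (normc_le_parts _) _.
rewrite prod_normE /= mulr2n mulrDl mul1r; apply: lerD; rewrite le_max lexx ?orbT //.
Qed.

(** A quadratic bound for the remainder identifies the differential as
    multiplication by c. *)
Lemma quadratic_differentiable f p (c : R[i]) (C : R) :
  (forall w, normc w <= 1 ->
    normc (f (cplx p + w) - f (cplx p) - c * w) <= C * normc w ^+ 2) ->
  differentiable (plane f) p /\ forall v, 'D_v (plane f) p = planeM c v.
Proof.
move=> H.
have C0 : 0 <= C.
  have := H 1; rewrite normc1 lexx expr1n !mulr1 => /(_ isT) h.
  exact: le_trans (normc_ge0 _) h.
have D : plane f \o shift p = cst (plane f p) + planeM c +o_ (0 : R * R) id.
  apply/eqaddoP => e e0.
  have d0 : 0 < Num.min (2^-1) (e / (4 * C + 1)).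
    rewrite lt_min invr_gt0 ltr0n divr_gt0//.
    by rewrite ltr_wpDl// mulr_ge0.
  apply/nbhs_ballP; exists (Num.min (2^-1) (e / (4 * C + 1))) => //= q.
  rewrite -ball_normE /ball_/= sub0r normrN lt_min => /andP[q1 q2].
  have w1 : normc (cplx q) <= 1.
    by apply: le_trans (normc_le_norm q) _; move: q1; lra.
  have -> : (plane f \o shift p - (cst (plane f p) + planeM c)) q =
      uncplx (f (cplx p + cplx q) - f (cplx p) - c * cplx q).
    rewrite -[LHS]/(uncplx (f (cplx (q + p))) - (uncplx (f (cplx p)) + uncplx (c * cplx q))).
    rewrite cplxD [cplx q + _]addrC.
    by case: (f (cplx p + cplx q)) (f (cplx p)) (c * cplx q) => ? ? [? ?] [? ?]; congr pair => /=; ring.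
  apply: le_trans (norm_le_normc _) _; rewrite uncplxK.
  apply: le_trans (H _ w1) _.
  have h1 := normc_le_norm q; have h0 := normc_ge0 (cplx q).
  have q0 : 0 <= `|q| by [].
  move: q2; rewrite ltr_pdivlMr; last by rewrite ltr_wpDl// mulr_ge0.
  move: h1 h0 q0; move: (normc _) `|q| => x y xy x0 y0 q2.
  have x2 : x ^+ 2 <= 4 * (y * y).
    have -> : 4 * (y * y) = (2 * y) ^+ 2 by ring.
    by rewrite lerXn2r// nnegrE ?mulr_ge0.
  apply: (@le_trans _ _ (C * (4 * (y * y)))); first by rewrite ler_wpM2l.
  have -> : C * (4 * (y * y)) = (y * (4 * C)) * y by ring.
  by rewrite ler_wpM2r//; move: q2 y0; rewrite mulrDr mulr1; lra.
have dE := diff_unique (@planeM_continuous _ c) D.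
have df : differentiable (plane f) p.
  apply/diff_locallyP; split; first by rewrite dE; exact: planeM_continuous.
  by rewrite dE.
by split => // v; rewrite deriveE// dE.
Qed.

Definition deriv_coef a j : R[i] := j.+1%:R * a j.+1.

Lemma entire_deriv a : entire a -> entire (deriv_coef a).
Proof.
move=> ea r r0; have r2 : 0 < 2 * r by rewrite mulr_gt0.
have [C HC] := ea _ r2; exists (C / r) => j.
rewrite normcM normc_nat ler_pdivlMr// -!mulrA -exprSr.
apply: le_trans (HC j.+1); rewrite exprMn mulrCA ler_wpM2l ?normc_ge0//.
by rewrite ler_wpM2r ?exprn_ge0 ?(ltW r0)// -natrX ler_nat ltnW// ltn_expl.
Qed.

(** The crude constants 4^j suffice: entire coefficients absorb them. *)
Lemma pow_remainder (r : R) z w j : 1 <= r -> normc z <= r -> normc (z + w) <= r ->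
  normc ((z + w) ^+ j.+1 - z ^+ j.+1 - j.+1%:R * z ^+ j * w) <=
  4 ^+ j.+1 * r ^+ j.+1 * normc w ^+ 2.
Proof.
move=> r1 zr zwr; have r0 : 0 <= r by apply: le_trans r1.
elim: j => [|j IH].
  rewrite !expr1 expr0 (_ : _ - _ = 0) ?normc0; last by ring.
  by apply: mulr_ge0; [exact: mulr_ge0|exact: sqr_ge0].
have -> : (z + w) ^+ j.+2 - z ^+ j.+2 - j.+2%:R * z ^+ j.+1 * w =
  (z + w) * ((z + w) ^+ j.+1 - z ^+ j.+1 - j.+1%:R * z ^+ j * w) +
  (j.+1%:R * z ^+ j) * w ^+ 2.
  have -> : j.+2%:R = j.+1%:R + 1 :> R[i] by rewrite natr1.
  by rewrite !exprS; ring.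
apply: le_trans (le_normcD _ _) _.
rewrite normcM [normc (_ * w ^+ 2)]normcM normc_exp normcM normc_nat normc_exp.
have h1 := ler_pM (normc_ge0 _) (normc_ge0 _) zwr IH.
have h2 : j.+1%:R * normc z ^+ j <= 4 ^+ j.+1 * r ^+ j.+2.
  apply: ler_pM => //; first by rewrite exprn_ge0 ?normc_ge0.
    by rewrite -natrX ler_nat ltnW// ltn_expl.
  apply: (@le_trans _ _ (r ^+ j)); first by rewrite lerXn2r ?nnegrE ?normc_ge0.
  by apply: ler_weXn2l => //; rewrite -addn2 leq_addr.
have {}h2 := ler_wpM2r (sqr_ge0 (normc w)) h2.
apply: le_trans (lerD h1 h2) _.
have -> : r * (4 ^+ j.+1 * r ^+ j.+1 * normc w ^+ 2) = 4 ^+ j.+1 * r ^+ j.+2 * normc w ^+ 2.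
  by rewrite [r ^+ j.+2]exprS; ring.
rewrite [4 ^+ j.+2]exprS.
have : 0 <= 4 ^+ j.+1 * r ^+ j.+2 * normc w ^+ 2 by apply: mulr_ge0 (sqr_ge0 _); apply: mulr_ge0; exact: exprn_ge0.
have -> : 4 * 4 ^+ j.+1 * r ^+ j.+2 * normc w ^+ 2 = 4 * (4 ^+ j.+1 * r ^+ j.+2 * normc w ^+ 2) by ring.
by move: (_ * _) => x; clear; lra.
Qed.

Lemma pser_remainder a z : entire a -> exists C, forall w, normc w <= 1 ->
  normc (pser a (z + w) - pser a z - pser (deriv_coef a) z * w) <= C * normc w ^+ 2.
Proof.
move=> ea; pose r := normc z + 1.
have r1 : 1 <= r by rewrite lerDr normc_ge0.
have r0 : 0 < r by rewrite (lt_le_trans _ r1).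
have r8 : 0 < 8 * r by rewrite mulr_gt0.
have [C HC] := ea _ r8.
have C0 : 0 <= C by apply: le_trans (HC 0); rewrite expr0 mulr1 normc_ge0.
exists (2 * C) => w w1.
have zr : normc z <= r by rewrite lerDl.
have zwr : normc (z + w) <= r by apply: le_trans (le_normcD _ _) _; rewrite lerD2l.
have h1 := clim_shift 1 (pserP (z + w) ea).
have h2 := climZ (-1) (clim_shift 1 (pserP z ea)).
have h3 := climZ (- w) (pserP z (entire_deriv ea)).
have := climD (climD h1 h2) h3.
rewrite mulN1r [- w * _]mulrC mulrN => cl.
rewrite -[X in normc X]subr0; apply: (clim_le (N := 0%N) cl) => n _; rewrite subr0.
have -> : psum a (n + 1) (z + w) + -1 * psum a (n + 1) z + - w * psum (deriv_coef a) n z =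
  \sum_(j < n) a j.+1 * ((z + w) ^+ j.+1 - z ^+ j.+1 - j.+1%:R * z ^+ j * w).
  rewrite /psum !addn1 !big_ord_recl !expr0 mulN1r opprD addrACA subrr add0r mulr_sumr.
  rewrite -sumrN -!big_split/=; apply: eq_bigr => j _.
  by rewrite /deriv_coef /bump /= !add1n; ring.
apply: le_trans (normc_sum _ _ _) _.
apply: (@le_trans _ _ (\sum_(j < n) C * 2^-1 ^+ j.+1 * normc w ^+ 2)).
  apply: ler_sum => j _; rewrite normcM.
  apply: le_trans (ler_wpM2l (normc_ge0 _) (pow_remainder j r1 zr zwr)) _.
  rewrite mulrA ler_wpM2r ?sqr_ge0//.
  have -> : normc (a j.+1) * (4 ^+ j.+1 * r ^+ j.+1) = normc (a j.+1) * (8 * r) ^+ j.+1 * 2^-1 ^+ j.+1.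
    rewrite -mulrA; congr (_ * _); rewrite -!exprMn; congr (_ ^+ _); by field.
  by rewrite ler_wpM2r// exprn_ge0// invr_ge0.
rewrite -mulr_suml ler_wpM2r ?sqr_ge0//.
have -> : \sum_(j < n) C * 2^-1 ^+ j.+1 = \sum_(1 <= j < n.+1) C * 2^-1 ^+ j.
  by rewrite big_add1 big_mkord.
apply: le_trans (sum_half C0 (ltn0Sn n)) _.
by rewrite ler_piMr ?mulr_ge0// expr1 invf_le1// ler1n.
Qed.

Lemma pser_differentiable a : entire a ->
  cdiff (pser a) /\ forall v, pderiv v (pser a) = fun z => cplx v * pser (deriv_coef a) z.
Proof.
move=> ea; split=> [p|v].
  have [C HC] := pser_remainder (cplx p) ea.
  by have [] := quadratic_differentiable HC.
apply/funext => z; have [C HC] := pser_remainder (cplx (uncplx z)) ea.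
rewrite /pderiv; have [_ ->] := quadratic_differentiable HC.
by rewrite cplxM uncplxK mulrC.
Qed.

(** The partial derivatives of a power series with infinite radius are again such
    series, up to a constant factor. *)
Lemma smooth_pser a : entire a -> smooth (pser a).
Proof.
move=> ea k; elim: k a ea => [|k IH] a ea; first by [].
have [da dE] := pser_differentiable ea; rewrite diff_uptoS; split => //.
  have -> : dx (pser a) = 1 *: pser (deriv_coef a) + 0.
    by rewrite [LHS]dE; apply/funext => z; rewrite addr0.
  by apply: diff_upto_lin; [exact/IH/entire_deriv|exact: (diff_upto_cst k 0)].
have -> : dy (pser a) = 'i%C *: pser (deriv_coef a) + 0.
  by rewrite [LHS]dE; apply/funext => z; rewrite addr0.
by apply: diff_upto_lin; [exact/IH/entire_deriv|exact: (diff_upto_cst k 0)].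
Qed.

Lemma hol_pser_entire a : entire a -> hol (pser a).
Proof.
move=> ea; split; first exact: smooth_pser.
have [_ dE] := pser_differentiable ea.
apply/funext => z; rewrite Dzb_def -DxE -DyE.
rewrite [dx (pser a) z](congr1 (@^~ z) (dE (1, 0))).
rewrite [dy (pser a) z](congr1 (@^~ z) (dE (0, 1))).
rewrite -[cplx (1, 0)]/(1 : R[i]) -[cplx (0, 1)]/('i%C : R[i]) mulrA -expr2 sqr_i.
by rewrite mul1r mulN1r subrr mul0r.
Qed.

Lemma iter_Dzb_zbX n k g : hol g ->
  iter k (@Dzb R) (@zb R ^+ n * g) = (n ^_ k)%:R *: (@zb R ^+ (n - k) * g).
Proof.
move=> [sg hg]; have sb := @smooth_zb R.
elim: k => [|k IH]; first by rewrite /= ffactn0 subn0 scale1r.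
rewrite iterS IH (DzbZ _ (smoothM (smoothX _ sb) sg)) (DzbM (smoothX _ sb) sg) hg mulr0 addr0.
rewrite (DzbX _ sb) Dzb_zb; apply/funext => z.
rewrite -[LHS]/((n ^_ k)%:R * ((n - k)%:R * @zb R z ^+ (n - k).-1 * 1 * g z)).
rewrite -[RHS]/((n ^_ k.+1)%:R * ((@zb R ^+ (n - k.+1)) z * g z)) expfE.
by rewrite ffactnSr natrM subnS; ring.
Qed.

Lemma iter_Dzb_lin n (b : R[i]) f g : smooth f -> smooth g ->
  iter n (@Dzb R) (b *: f + g) = b *: iter n (@Dzb R) f + iter n (@Dzb R) g.
Proof. by rewrite -DzbE; exact: iter_dzbar_lin. Qed.

Lemma smooth_iter_Dzb n f : smooth f -> smooth (iter n (@Dzb R) f).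
Proof. by rewrite -DzbE; exact: smooth_iter_dzbar. Qed.

Lemma hol0 : hol (0 : R[i] -> R[i]).
Proof. by split; [exact: smooth0|exact: Dzb_cst]. Qed.

(** The n-th zbar-derivative g of an (n+1)-analytic f is holomorphic, and subtracting
    zbar^n g / n! leaves an n-analytic function. *)
Lemma polyanalytic_decomp n f : smooth f -> iter n (@Dzb R) f = 0 ->
  exists h : nat -> R[i] -> R[i], (forall k, hol (h k)) /\
    f = \sum_(k < n) @zb R ^+ k * h k.
Proof.
elim: n f => [|n IH] f sf hf.
  exists (fun=> 0); split; first by move=> _; exact: hol0.
  by rewrite big_ord0.
pose g := iter n (@Dzb R) f.
have hg : hol g by split; [exact: smooth_iter_Dzb|rewrite -hf].
pose c : R[i] := - n`!%:R^-1.
have szg : smooth (@zb R ^+ n * g) by apply: smoothM; [exact/smoothX/smooth_zb|case: hg].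
have sf' : smooth (c *: (@zb R ^+ n * g) + f) by exact: smooth_lin.
have hf' : iter n (@Dzb R) (c *: (@zb R ^+ n * g) + f) = 0.
  rewrite (iter_Dzb_lin _ _ szg sf) (iter_Dzb_zbX _ _ hg) subnn expr0 mul1r ffactnn -/g.
  have f1 : n`!%:R != 0 :> R[i] by rewrite pnatr_eq0 -lt0n fact_gt0.
  by rewrite scalerA mulNr mulVf// scaleN1r addNr.
have [h [hh fE]] := IH _ sf' hf'.
exists (fun k => if (k == n)%N then n`!%:R^-1 *: g else h k); split.
  move=> k; case: eqP => _ //; case: hg => sg hg; split; first exact: smoothZ.
  by rewrite (DzbZ _ sg) hg scaler0.
rewrite big_ord_recr/= eqxx.
have -> : \sum_(i < n) @zb R ^+ i * (if (i == n :> nat)%N then n`!%:R^-1 *: g else h i) =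
  \sum_(i < n) @zb R ^+ i * h i.
  by apply: eq_bigr => i _; rewrite ltn_eqF.
rewrite -fE /c; apply/funext => z.
rewrite -[RHS]/(- n`!%:R^-1 * ((@zb R ^+ n) z * g z) + f z + (@zb R ^+ n) z * (n`!%:R^-1 * g z)).
by ring.
Qed.

(** Each holomorphic component is replaced by its Taylor series. *)
Theorem polyanalytic_expansion n f : smooth f -> (forall z, iter n dzbar f z = 0) ->
  exists a : nat -> nat -> R[i], (forall k, entire (a k)) /\
    forall z, f z = \sum_(k < n) z^* ^+ k * pser (a k) z.
Proof.
move=> sf hf; have {}hf : iter n (@Dzb R) f = 0.
  by rewrite -DzbE; apply/funext => z; exact: hf.
have [h [hh fE]] := polyanalytic_decomp sf hf.
exists (fun k => taylor_coef (h k)); split; first by move=> k; exact: entire_taylor.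
move=> z; rewrite {1}fE sumfE; apply: eq_bigr => k _.
by rewrite -[LHS]/((@zb R ^+ k) z * h k z) expfE -hol_pser.
Qed.

Lemma smooth_zbX_pser k a : entire a -> smooth (@zb R ^+ k * pser a).
Proof. by move=> ea; apply: smoothM; [exact/smoothX/smooth_zb|exact: smooth_pser]. Qed.

Lemma polyanalytic_sum n (a : nat -> nat -> R[i]) : (forall k, entire (a k)) ->
  let f := \sum_(k < n) @zb R ^+ k * pser (a k) in
  smooth f /\ forall z, iter n dzbar f z = 0.
Proof.
move=> ea f; have sk k := smooth_zbX_pser k (ea k).
suff H m : (m <= n)%N -> let g := \sum_(k < m) @zb R ^+ k * pser (a k) in
    smooth g /\ iter n (@Dzb R) g = 0.
  by have [sf fE] := H n (leqnn n); split => // z; rewrite DzbE fE.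
elim: m => [_|m IH mn].
  rewrite big_ord0; split; first exact: smooth0.
  by rewrite -DzbE iter_dzbar0.
have [sg gE] := IH (ltnW mn); rewrite big_ord_recr/=; split; first exact: smoothD.
rewrite -[X in X + _]scale1r (iter_Dzb_lin _ _ sg (sk m)) gE scaler0 add0r.
by rewrite (iter_Dzb_zbX _ _ (hol_pser_entire (ea m))) ffact_small// scale0r.
Qed.

End entire_smooth.

(** * Moments of the Gaussian measure *)

Section moments.
Variable R : realType.
Local Notation mplane := (mplane R).
Local Notation gauss := (@gauss_measure R).
Local Notation leb := (@lebesgue_measure R).
Local Notation leb2 := (@lebesgue_measure R \x @lebesgue_measure R)%E.
Local Open Scope ereal_scope.
Import HBNNSimple.

Local Notation dens := (@gauss_density R : mplane -> R).

Lemma measurable_dens : measurable_fun [set: mplane] (fun p : mplane => (dens p)%:E).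
Proof. by apply/measurable_EFinP; exact: measurable_gauss_density. Qed.

Lemma dens_ge0 (p : mplane) : 0 <= (dens p)%:E.
Proof. by rewrite lee_fin gauss_density_ge0. Qed.

(** The Gaussian measure is defined by its values on sets; for simple functions the
    integral reduces to these. *)
Lemma gauss_integral_nnsfun (h : {nnsfun mplane >-> R}) :
  \int[gauss]_p (h p)%:E = \int[leb2]_p ((h p)%:E * (dens p)%:E).
Proof.
rewrite integralT_nnsfun sintegralE.
under [RHS]eq_integral.
  move=> x _; rewrite fimfunE -fsumEFin// ge0_mule_fsuml; last first.
    by move=> r; rewrite EFinM nnfun_muleindic_ge0.
  over.
have mT r : measurable_fun [set: mplane] (fun x : mplane => (r * \1_(h @^-1` [set r]) x)%:E).
  by apply/measurable_EFinP; exact: measurableT_comp.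
rewrite /= ge0_integral_fsum//; first last.
- by move=> r x _; rewrite EFinM mule_ge0// ?nnfun_muleindic_ge0// dens_ge0.
- by move=> r; apply: emeasurable_funM; [exact: mT|exact: measurable_dens].
apply: eq_fsbigr => r; rewrite inE => -[x _ <-].
have r0 : (0 <= h x)%R by [].
under [RHS]eq_integral do rewrite EFinM -muleA.
rewrite ge0_integralZl//; first last.
- by move=> p _; rewrite mule_ge0// dens_ge0.
- apply: emeasurable_funM; last exact: measurable_dens.
  by apply/measurable_EFinP; exact: measurable_indic.
congr (_ * _); rewrite -[LHS]/(\int[leb2]_(p in h @^-1` [set h x]) (dens p)%:E).
rewrite [LHS]integral_mkcond; apply: eq_integral => p _.
rewrite patchE indicE; case: ifPn => _; first by rewrite mul1e.
by rewrite mul0e.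
Qed.

Lemma ge0_gauss_integralE (f : mplane -> \bar R) :
  measurable_fun [set: mplane] f -> (forall p, 0 <= f p) ->
  \int[gauss]_p f p = \int[leb2]_p (f p * (dens p)%:E).
Proof.
move=> mf f0.
pose f_ := nnsfun_approx measurableT mf.
transitivity (limn (fun n => \int[gauss]_p (f_ n p)%:E)).
  rewrite -monotone_convergence//=.
  - by apply: eq_integral => ? _; apply/esym/cvg_lim => //=; exact: cvg_nnsfun_approx.
  - by move=> n; exact/measurable_EFinP/measurable_funTS.
  - by move=> n ? _; rewrite lee_fin.
  - by move=> ? _ ? ? mn; rewrite lee_fin; exact/lefP/nd_nnsfun_approx.
transitivity (limn (fun n => \int[leb2]_p ((f_ n p)%:E * (dens p)%:E))).
  by congr (limn _); apply/funext => n; exact: gauss_integral_nnsfun.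
rewrite -monotone_convergence//=.
- apply: eq_integral => p _; apply/cvg_lim => //=.
  by apply: cvgeZr => //; exact: cvg_nnsfun_approx.
- move=> n; apply: emeasurable_funM; last exact: measurable_dens.
  exact/measurable_EFinP.
- by move=> n p _; rewrite mule_ge0// ?lee_fin// gauss_density_ge0.
- move=> p _ m n mn; rewrite lee_wpmul2r// ?dens_ge0// lee_fin.
  exact/lefP/nd_nnsfun_approx.
Qed.

Lemma integral_gauss_scaled (t : R) : (0 < t)%R ->
  \int[leb]_x (expR (- (t * x ^+ 2)))%:E = (Num.sqrt (pi / t))%:E.
Proof.
move=> t0; pose s : R := Num.sqrt ((2 * t)^-1).
have s0 : (s != 0)%R by rewrite gt_eqF// sqrtr_gt0 invr_gt0 mulr_gt0.
have s2 : (s ^+ 2 = (2 * t)^-1)%R by rewrite sqr_sqrtr// invr_ge0 mulr_ge0// ltW.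
have tn : (t != 0)%R by rewrite gt_eqF.
have := integral_normal_pdf (0 : R) s.
rewrite normal_pdfE//.
under eq_integral do rewrite EFinM.
rewrite ge0_integralZl//=; first last.
- by rewrite lee_fin normal_peak_ge0.
- by move=> x _; rewrite lee_fin normal_fun_ge0.
- by apply/measurable_EFinP; exact: measurable_normal_fun.
have -> : (normal_peak s = (Num.sqrt (pi / t))^-1)%R.
  rewrite /normal_peak; congr ((Num.sqrt _)^-1)%R; rewrite s2 -mulr_natr.
  by field.
have -> : \int[leb]_x (normal_fun 0 s x)%:E = \int[leb]_x (expR (- (t * x ^+ 2)))%:E.
  apply: eq_integral => x _; rewrite /normal_fun subr0 s2; congr (expR _)%:E.
  by rewrite -mulr_natr; field.
have q0 : (0 < Num.sqrt (pi / t))%R by rewrite sqrtr_gt0 divr_gt0// pi_gt0.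
move=> /(congr1 (fun u => (Num.sqrt (pi / t))%:E * u)).
by rewrite muleA -EFinM divff ?gt_eqF// mul1e mule1.
Qed.

Lemma integral_gauss2 (t : R) : (0 < t)%R ->
  \int[leb2]_p (expR (- (t * (p.1 ^+ 2 + p.2 ^+ 2))))%:E = (pi / t)%:E.
Proof.
move=> t0.
have mf : measurable_fun [set: mplane] (fun p : mplane => (expR (- (t * (p.1 ^+ 2 + p.2 ^+ 2))))%:E).
  apply/measurable_EFinP; apply: measurableT_comp => //.
  apply: measurableT_comp => //; apply: measurable_funM => //.
  by apply: measurable_funD; apply: measurable_funX;
    [exact: measurable_fst|exact: measurable_snd].
have m1 : measurable_fun [set: measurableTypeR R] (fun x : R => (expR (- (t * x ^+ 2)))%:E).
  apply/measurable_EFinP; apply: measurableT_comp => //.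
  by apply: measurableT_comp => //; apply: measurable_funM => //; exact: measurable_funX.
rewrite fubini_tonelli1//.
rewrite /fubini_F /=.
under eq_integral.
  move=> x _; under eq_integral do rewrite mulrDr opprD expRD EFinM.
  rewrite ge0_integralZl//.
  rewrite integral_gauss_scaled//.
  over.
rewrite ge0_integralZr//.
rewrite integral_gauss_scaled// -EFinM -expr2 sqr_sqrtr//.
by rewrite divr_ge0 ?pi_ge0// ltW.
Qed.

Definition nrm2 (p : mplane) : R := (normc (cplx p) ^+ 2)%R.

Lemma nrm2E p : nrm2 p = (p.1 ^+ 2 + p.2 ^+ 2)%R.
Proof. by rewrite /nrm2 normcE2. Qed.

Lemma nrm2_ge0 p : (0 <= nrm2 p)%R. Proof. exact: sqr_ge0. Qed.

Lemma measurable_nrm2 : measurable_fun [set: mplane] nrm2.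
Proof.
have -> : nrm2 = fun p => (p.1 ^+ 2 + p.2 ^+ 2)%R by apply/funext => p; exact: nrm2E.
by apply: measurable_funD; apply: measurable_funX;
  [exact: measurable_fst|exact: measurable_snd].
Qed.

(** The product of the Gaussian density and exp(e |z|^2) is a Gaussian density
    again, with parameter 1 - e. *)
Lemma gauss_integral_exp (e : R) : (e < 1)%R ->
  \int[gauss]_p (expR (e * nrm2 p))%:E = (1 - e)^-1%:E.
Proof.
move=> e1; rewrite ge0_gauss_integralE; first last.
- by move=> p; rewrite lee_fin expR_ge0.
- apply/measurable_EFinP; apply: measurableT_comp => //.
  by apply: measurable_funM => //; exact: measurable_nrm2.
have t0 : (0 < 1 - e)%R by rewrite subr_gt0.
transitivity (\int[leb2]_p (pi^-1%:E * (expR (- ((1 - e) * (p.1 ^+ 2 + p.2 ^+ 2))))%:E)).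
  apply: eq_integral => p _; rewrite -!EFinM gauss_densityE mulrCA -expRD nrm2E.
  by congr (_ * expR _)%:E; ring.
rewrite ge0_integralZl//; first last.
- by rewrite lee_fin invr_ge0 pi_ge0.
- apply/measurable_EFinP; apply: measurableT_comp => //.
  apply: measurableT_comp => //; apply: measurable_funM => //.
  by apply: measurable_funD; apply: measurable_funX;
    [exact: measurable_fst|exact: measurable_snd].
by rewrite integral_gauss2// -EFinM mulrA mulVf ?mul1r// gt_eqF// pi_gt0.
Qed.

(** The first coefficient that might not vanish dominates the tail as e tends to
    0. *)
Lemma power_series_eq0 (c : nat -> R) (K : R) :
  (forall a, (`|c a| <= K * 2 ^+ a)%R) ->
  (forall e : R, (0 < e < 1)%R -> (series (fun a => c a * e ^+ a)%R) @ \oo --> (0%R : R)) ->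
  forall a, c a = 0%R.
Proof.
move=> cK c0 a; elim/ltn_ind: a => n IH.
have K0 : (0 <= K)%R by have := cK 0%N; rewrite expr0 mulr1; apply: le_trans.
apply/eqP; rewrite -normr_le0; apply/ler_addgt0Pl => d d0; rewrite addr0.
(* e <= 1/4 makes the tail geometric with ratio 2 e <= 1/2; the second bound makes
   it smaller than d e^n. *)
pose e : R := (Num.min 4^-1 (d / (4 * K * 2 ^+ n + 1)))%R.
have D0 : (0 < 4 * K * 2 ^+ n + 1)%R by rewrite ltr_wpDl// !mulr_ge0.
have e0 : (0 < e)%R by rewrite lt_min invr_gt0 ltr0n divr_gt0.
have e4 : (e <= 4^-1)%R by rewrite ge_min lexx.
have ed : (e * (4 * K * 2 ^+ n + 1) <= d)%R by rewrite -ler_pdivlMr// ge_min lexx orbT.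
have e1 : (0 < e < 1)%R by rewrite e0/= (le_lt_trans e4)// invf_lt1// ltr1n.
have bound : (`|c n * e ^+ n| <= 2 * K * (2 * e) ^+ n.+1)%R.
  have /cvgrPdist_le := c0 e e1 => cv; apply/ler_addgt0Pl => z z0.
  have [N _ HN] := cv z z0.
  have := HN (maxn N n.+1) (leq_maxl _ _); rewrite /= sub0r normrN.
  set m := maxn N n.+1; have nm : (n.+1 <= m)%N by exact: leq_maxr.
  have -> : series (fun a => c a * e ^+ a)%R m =
     (c n * e ^+ n + \sum_(n.+1 <= j < m) c j * e ^+ j)%R.
    rewrite /series /= (big_cat_nat (n := n.+1))//= big_nat_recr//=.
    rewrite big1_seq ?add0r// => j /andP[_]; rewrite mem_index_iota => /andP[_ jn].
    by rewrite IH// mul0r.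
  have tail : (`|\sum_(n.+1 <= j < m) c j * e ^+ j| <= 2 * K * (2 * e) ^+ n.+1)%R.
    apply: le_trans (ler_norm_sum _ _ _) _.
    apply: (@le_trans _ _ (\sum_(n.+1 <= j < m) K * (2 * e) ^+ n.+1 * 2^-1 ^+ (j - n.+1))%R).
      rewrite big_nat_cond [leRHS]big_nat_cond; apply: ler_sum => j /andP[/andP[nj _] _].
      rewrite normrM normrX (gtr0_norm e0).
      apply: le_trans (ler_wpM2r _ (cK j)) _; first by rewrite exprn_ge0// ltW.
      rewrite -!mulrA -exprMn -[in leLHS](subnKC nj) exprD.
      rewrite ler_wpM2l// ler_wpM2l// ?exprn_ge0 ?mulr_ge0 ?(ltW e0)//.
      rewrite lerXn2r ?nnegrE ?invr_ge0 ?mulr_ge0 ?(ltW e0)//.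
      by move: e4; lra.
    rewrite -mulr_sumr.
    have -> : (\sum_(n.+1 <= j < m) (2^-1 : R) ^+ (j - n.+1) = \sum_(0 <= j < m - n.+1) 1 * 2^-1 ^+ j)%R.
      by rewrite -{1}[n.+1]add0n big_addn; apply: eq_bigr => j _; rewrite addnK mul1r.
    have := @sum_half R 1 0 (m - n.+1) ler01 (leq0n _); rewrite expr0 !mulr1 => h.
    rewrite mulrC -mulrA ler_wpM2r// mulr_ge0// exprn_ge0// mulr_ge0// ltW//.
  move=> h; rewrite -[X in `|X|%R](addrK (\sum_(n.+1 <= j < m) c j * e ^+ j)%R).
  by apply: le_trans (ler_normB _ _) _; apply: lerD.
move: bound; rewrite normrM [`|e ^+ n|%R]ger0_norm ?exprn_ge0 ?(ltW e0)//.
have -> : (2 * K * (2 * e) ^+ n.+1 = (4 * K * 2 ^+ n * e) * e ^+ n)%R.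
  by rewrite exprMn !exprS; ring.
rewrite ler_pM2r ?exprn_gt0// => h; apply: le_trans h _; apply: le_trans ed.
by rewrite mulrC ler_wpM2l ?(ltW e0)// lerDl.
Qed.

(** Tonelli for the exponential series: the moments divided by a! are the
    coefficients of 1 / (1 - e). *)
Lemma gauss_moment_series (e : R) : (0 < e < 1)%R ->
  \sum_(a <oo) ((e ^+ a / a`!%:R)%:E * \int[gauss]_p (nrm2 p ^+ a)%:E) = (1 - e)^-1%:E.
Proof.
move=> /andP[e0 e1]; rewrite -gauss_integral_exp//.
have mX a : measurable_fun [set: mplane] (fun p => (nrm2 p ^+ a)%:E).
  by apply/measurable_EFinP; apply: measurable_funX; exact: measurable_nrm2.
have X0 a p : 0 <= (nrm2 p ^+ a)%:E by rewrite lee_fin exprn_ge0// nrm2_ge0.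
have c0 a : (0 <= e ^+ a / a`!%:R)%R by rewrite divr_ge0// exprn_ge0// ltW.
transitivity (\sum_(a <oo) \int[gauss]_p ((e ^+ a / a`!%:R)%:E * (nrm2 p ^+ a)%:E)).
  by apply: eq_eseriesr => a _; rewrite ge0_integralZl// ?lee_fin//; exact: mX.
rewrite -integral_nneseries//; first last.
- by move=> a p _; rewrite mule_ge0// lee_fin.
- by move=> a; apply: emeasurable_funM => //; exact: mX.
apply: eq_integral => p _.
apply/cvg_lim => //.
have -> : (fun n => \sum_(0 <= a < n) ((e ^+ a / a`!%:R)%:E * (nrm2 p ^+ a)%:E)) =
   EFin \o series (exp_coeff (e * nrm2 p)).
  apply/funext => n; rewrite /= -sumEFin; apply: eq_bigr => a _.
  rewrite -EFinM; congr EFin; move: (nrm2 p) => x.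
  by rewrite -[RHS]/((e * x) ^+ a / a`!%:R)%R exprMn mulrAC.
apply: cvg_EFin; first exact: nearW.
exact: is_cvg_series_exp_coeff.
Qed.

(** Comparison of the coefficients of the generating function
    sum_a M_a e^a / a! = 1 / (1 - e), which avoids polar coordinates. *)
Lemma gauss_moment a : \int[gauss]_p (nrm2 p ^+ a)%:E = (a`!%:R)%:E.
Proof.
pose M a := \int[gauss]_p (nrm2 p ^+ a)%:E.
have M0 b : 0 <= M b.
  by apply: integral_ge0 => p _; rewrite lee_fin exprn_ge0// nrm2_ge0.
have c0 (e : R) b : (0 < e)%R -> (0 <= e ^+ b / b`!%:R)%R.
  by move=> e0; rewrite divr_ge0// exprn_ge0// ltW.
have half : (0 < (2^-1 : R) < 1)%R by rewrite invr_gt0 ltr0n/= invf_lt1// ltr1n.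
have term b : ((2^-1 ^+ b / b`!%:R)%:E * M b <= 2%:E)%E.
  have -> : (2 : R)%:E = (1 - 2^-1)^-1%:E by congr EFin; field.
  rewrite -(gauss_moment_series half).
  pose u b := (2^-1 ^+ b / b`!%:R)%:E * M b.
  have u0 b' : 0 <= u b' by rewrite mule_ge0// lee_fin c0//; case/andP: half.
  have := @nneseries_lim_ge R u xpredT 0%N b.+1 (fun i _ _ => u0 i).
  apply: le_trans; rewrite big_nat_recr//= leeDr// sume_ge0// => i _.
have f0 b : (0 < b`!%:R :> R)%R by rewrite ltr0n fact_gt0.
have Mfin b : M b \is a fin_num.
  rewrite ge0_fin_numE//; move: (M b) (M0 b) (term b) => [r| |]//= _; first by rewrite ltry.
  by rewrite mulry gtr0_sg ?mul1e// divr_gt0// exprn_gt0// invr_gt0.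
have MB b : (fine (M b) / b`!%:R <= 2 * 2 ^+ b)%R.
  have := term b; rewrite -(fineK (Mfin b)) -EFinM lee_fin /= => h.
  rewrite -ler_pdivrMr ?exprn_gt0//; apply: le_trans h.
  by rewrite exprVn le_eqVlt; apply/orP; left; apply/eqP; ring.
pose c b : R := (fine (M b) / b`!%:R - 1)%R.
suff : c a = 0%R.
  move/eqP; rewrite subr_eq0 => /eqP /(congr1 (fun x => x * a`!%:R)%R).
  by rewrite divfK ?gt_eqF// mul1r -/(M a) => <-; rewrite fineK.
apply: (@power_series_eq0 c 3) => [b|e e01].
  apply: le_trans (ler_normB _ _) _; rewrite normr1 ger0_norm; last first.
    by rewrite divr_ge0// fine_ge0.
  have := MB b; have : (1 <= 2 ^+ b :> R)%R by rewrite exprn_ege1// ler1n.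
  by move: (fine _ / _)%R (2 ^+ b)%R => x y; lra.
have [e0 e1] := andP e01.
have s1 : (series (fun b => fine (M b) / b`!%:R * e ^+ b)%R) @ \oo --> (1 - e)^-1%R.
  have cv : (fun n => \sum_(0 <= b < n) ((e ^+ b / b`!%:R)%:E * M b)) @ \oo --> (1 - e)^-1%:E.
    rewrite -(gauss_moment_series e01).
    pose u b := (e ^+ b / b`!%:R)%:E * M b.
    have u0 b : 0 <= u b by rewrite mule_ge0// lee_fin c0.
    exact: (@is_cvg_nneseries R u xpredT 0%N (fun i _ _ => u0 i)).
  have E : (fun n => \sum_(0 <= b < n) ((e ^+ b / b`!%:R)%:E * M b)) =
      EFin \o series (fun b => fine (M b) / b`!%:R * e ^+ b)%R.
    apply/funext => n; rewrite /series /= -sumEFin; apply: eq_bigr => b _.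
    by rewrite -{1}(fineK (Mfin b)) -EFinM mulrC mulrAC mulrA.
  by rewrite E in cv; exact: (fine_cvg cv).
have s2 : (series (fun b => e ^+ b)%R) @ \oo --> (1 - e)^-1%R.
  have -> : (fun b => e ^+ b)%R = geometric 1 e by apply/funext => b /=; rewrite mul1r.
  have := @cvg_geometric_series R 1 e; rewrite mul1r; apply.
  by rewrite gtr0_norm.
have -> : series (fun b => c b * e ^+ b)%R =
    (series (fun b => fine (M b) / b`!%:R * e ^+ b)%R - series (fun b => e ^+ b)%R)%R.
  apply/funext => n; rewrite !fctE /series /= -sumrB; apply: eq_bigr => b _.
  by rewrite /c mulrBl mul1r.
by rewrite -(subrr ((1 - e)^-1)%R); exact: (cvgB s1 s2).
Qed.

End moments.

(** * Monomials in z and zbar *)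

Section monomials.
Variable R : realType.
Local Notation mplane := (mplane R).
Local Notation gauss := (@gauss_measure R).
Implicit Types (f g h : R[i] -> R[i]) (z : R[i]).

(** Measurability as the definition of L^2 expresses it. *)
Definition cmeas f := measurable_fun [set: mplane] (plane f : mplane -> mplane).

Lemma cmeasM f g : cmeas f -> cmeas g -> cmeas (f * g).
Proof.
move=> mf mg; have [fr fi] := (measurable_Re mf, measurable_Im mf).
have [gr gi] := (measurable_Re mg, measurable_Im mg).
apply: measurable_planeP.
  have -> : (fun p : mplane => complex.Re ((f * g) (cplx p))) =
    fun p => complex.Re (f (cplx p)) * complex.Re (g (cplx p)) -
      complex.Im (f (cplx p)) * complex.Im (g (cplx p)).
    by apply/funext => p; rewrite -Re_mulc.
  by apply: measurable_funB; apply: measurable_funM.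
have -> : (fun p : mplane => complex.Im ((f * g) (cplx p))) =
    fun p => complex.Re (f (cplx p)) * complex.Im (g (cplx p)) +
      complex.Im (f (cplx p)) * complex.Re (g (cplx p)).
  by apply/funext => p; rewrite -Im_mulc.
by apply: measurable_funD; apply: measurable_funM.
Qed.

Lemma cmeas_conj f : cmeas f -> cmeas (conjf f).
Proof.
move=> mf; have [fr fi] := (measurable_Re mf, measurable_Im mf).
apply: measurable_planeP.
  have -> // : (fun p : mplane => complex.Re (conjf f (cplx p))) =
     fun p => complex.Re (f (cplx p)).
  by apply/funext => p; rewrite /conjf Re_conjc.
have -> : (fun p : mplane => complex.Im (conjf f (cplx p))) =
     fun p => - complex.Im (f (cplx p)).
  by apply/funext => p; rewrite /conjf Im_conjc.
exact: measurableT_comp.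
Qed.

Lemma cmeas_id : cmeas (@id R[i]).
Proof. by apply: measurable_planeP; [exact: measurable_fst|exact: measurable_snd]. Qed.

Lemma cmeas_cst (c : R[i]) : cmeas (cst c).
Proof. by apply: measurable_planeP; exact: measurable_cst. Qed.

Lemma cmeasX f n : cmeas f -> cmeas (f ^+ n).
Proof.
move=> mf; elim: n => [|n IH]; first by rewrite expr0; exact: cmeas_cst.
by rewrite exprS; exact: cmeasM.
Qed.

Lemma cmeas_lin (c : R[i]) f g : cmeas f -> cmeas g -> cmeas (c *: f + g).
Proof. exact: measurable_plane_lin. Qed.

Definition mono (a b : nat) : R[i] -> R[i] := id ^+ a * @zb R ^+ b.

Lemma monoE a b z : mono a b z = z ^+ a * z^* ^+ b.
Proof. by rewrite -[LHS]/((id ^+ a : R[i] -> R[i]) z * (@zb R ^+ b) z) !expfE. Qed.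

Lemma cmeas_mono a b : cmeas (mono a b).
Proof. by apply: cmeasM; apply: cmeasX; [|apply: cmeas_conj]; exact: cmeas_id. Qed.

Lemma smooth_mono a b : smooth (mono a b).
Proof. by apply: smoothM; apply: smoothX; [exact: smooth_id|exact: smooth_zb]. Qed.

Lemma normc_mono a b z : normc (mono a b z) = normc z ^+ (a + b).
Proof. by rewrite monoE normcM !normc_exp normc_conj exprD. Qed.

Lemma L2_mono a b : L2 (mono a b).
Proof.
split; first exact: cmeas_mono.
have -> : (\int[gauss]_p (normc (mono a b (cplx p)) ^+ 2)%:E =
   \int[gauss]_p (nrm2 p ^+ (a + b))%:E)%E.
  by apply: eq_integral => p _; rewrite normc_mono /nrm2 -!exprM mulnC.
by rewrite gauss_moment ltry.
Qed.

Lemma unit_power_minus_one k : (0 < k)%N -> exists c : R[i], normc c = 1 /\ c ^+ k = -1.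
Proof.
move=> k0; pose t : R := pi / k%:R.
pose e (x : R) : R[i] := cos x +i* sin x.
have eD x y : e (x + y) = e x * e y.
  by apply/eqP; rewrite eq_complex /= cosD sinD; apply/andP; split; apply/eqP => //; ring.
have eX n : e t ^+ n = e (n%:R * t).
  elim: n => [|n IH]; first by rewrite expr0 mul0r /e cos0 sin0.
  by rewrite exprS IH -eD -natr1 mulrDl mul1r addrC.
exists (e t); split; first by rewrite /= cos2Dsin2 sqrtr1.
rewrite eX /t mulrC divfK ?pnatr_eq0 -?lt0n// /e cospi sinpi.
by apply/eqP; rewrite eq_complex/= oppr0 !eqxx.
Qed.

(** Distinct characters of the circle differ at some point, and the point can be
    chosen so that their quotient is -1 there. *)
Lemma circle_separates a b : a <> b ->
  exists c : R[i], normc c = 1 /\ c ^+ a * c^* ^+ b = -1.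
Proof.
move=> ab.
have key m n : (m < n)%N -> exists c : R[i], normc c = 1 /\ c ^+ n * c^* ^+ m = -1.
  move=> mn; have [|c [c1 ck]] := @unit_power_minus_one (n - m); first by rewrite subn_gt0.
  exists c; split => //.
  by rewrite -(subnK (ltnW mn)) exprD -mulrA -exprMn mulrC [_ * c^*]mulrC unit_conjK// expr1n mul1r.
have [|] := ltnP b a; first exact: key.
rewrite leq_eqVlt => /orP[/eqP ba|/key[c [c1 cE]]]; first by case: ab.
exists c^*; rewrite normc_conj; split => //.
by rewrite conjCK mulrC.
Qed.

(** An integrand that transforms under rotations by a nontrivial character equals
    minus itself after some rotation, and the measure is invariant. *)
Lemma gauss_integral_invariant (F : R[i] -> R[i]) a b : cmeas F -> a <> b ->
  (forall c z, normc c = 1 -> F (c * z) = c ^+ a * c^* ^+ b * F z) ->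
  cintegrable F -> gauss_integral F = 0.
Proof.
move=> mF ab FE iF; have [c [c1 cE]] := circle_separates ab.
have E : gauss_integral (fun z => F (c * z)) = - gauss_integral F.
  have i0 : cintegrable (cst 0 : R[i] -> R[i]).
    by split; exact: integrable0.
  have := @gauss_integral_lin R (-1) F (cst 0) iF i0.
  have -> : gauss_integral (cst 0 : R[i] -> R[i]) = 0.
    by apply/eqP; rewrite eq_complex/=; apply/andP; split; apply/eqP; rewrite /Rintegral integral0.
  rewrite addr0 mulN1r => <-; congr gauss_integral; apply/funext => z.
  by rewrite FE// cE mulN1r addr0.
have := gauss_integral_rot c1 mF; rewrite E => /eqP.
by rewrite -subr_eq0 -opprD oppr_eq0 -mulr2n mulrn_eq0/= => /eqP.
Qed.

Lemma cintegrable_mono a b : cintegrable (mono a b).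
Proof.
have -> : mono a b = fun z => mono a b z * (mono 0 0 z)^*.
  by apply/funext => z; rewrite [mono 0 0 z]monoE !expr0 mulr1 rmorph1 mulr1.
exact: L2_cintegrable (L2_mono a b) (L2_mono 0 0).
Qed.

Lemma mono_rot a b (c : R[i]) z : mono a b (c * z) = c ^+ a * c^* ^+ b * mono a b z.
Proof. by rewrite !monoE cconjM !exprMn; ring. Qed.

Lemma gauss_integral_mono a b : gauss_integral (mono a b) = (a == b)%:R * a`!%:R.
Proof.
have [<-|/eqP ab] := eqVneq a b; last first.
  rewrite mul0r; apply: (gauss_integral_invariant (cmeas_mono a b) ab _ (cintegrable_mono a b)).
  by move=> c z _; exact: mono_rot.
rewrite mul1r.
have E p : mono a a (cplx p) = (nrm2 p ^+ a)%:C.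
  by rewrite monoE -exprMn mul_conj; exact/esym/rmorphXn.
have -> : (a`!%:R : R[i]) = (a`!%:R : R)%:C by rewrite rmorph_nat.
apply/eqP; rewrite eq_complex/=; apply/andP; split; apply/eqP.
  have -> : a`!%:R = fine (a`!%:R : R)%:E by [].
  by rewrite -gauss_moment; apply: eq_Rintegral => p _; rewrite E.
rewrite /Rintegral.
have -> : (\int[gauss]_p (complex.Im (mono a a (cplx p)))%:E = \int[gauss]_p 0%E)%E.
  by apply: eq_integral => p _; rewrite E.
by rewrite integral0.
Qed.

Lemma inner_conj f g : L2 f -> L2 g -> inner g f = (inner f g)^*.
Proof.
move=> Lf Lg; rewrite /inner /gauss_integral.
have -> : ((\int[gauss]_p complex.Re (f (cplx p) * (g (cplx p))^*)) +i*
           (\int[gauss]_p complex.Im (f (cplx p) * (g (cplx p))^*)))^* =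
   (\int[gauss]_p complex.Re (f (cplx p) * (g (cplx p))^*)) +i*
   (- (\int[gauss]_p complex.Im (f (cplx p) * (g (cplx p))^*))) by [].
have E p : (f (cplx p) * (g (cplx p))^*)^* = g (cplx p) * (f (cplx p))^*.
  by rewrite cconjM conjCK mulrC.
congr (_ +i* _).
  by apply: eq_Rintegral => p _; rewrite -E Re_conjc.
have [_ iI] := L2_cintegrable Lf Lg.
transitivity (-1 * \int[gauss]_p complex.Im (f (cplx p) * (g (cplx p))^*)); last by rewrite mulN1r.
rewrite -RintegralZl//; apply: eq_Rintegral => p _.
by rewrite -E Im_conjc mulN1r.
Qed.

Lemma L2Z (c : R[i]) f : L2 f -> L2 (c *: f).
Proof. by move=> Lf; rewrite -[c *: f]addr0; apply: L2_lin => //; exact: L2_0. Qed.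

Lemma L2D f g : L2 f -> L2 g -> L2 (f + g).
Proof. by move=> Lf Lg; rewrite -[f]scale1r; exact: L2_lin. Qed.

Lemma L2_sum I (s : seq I) (P : pred I) (F : I -> R[i] -> R[i]) :
  (forall i, P i -> L2 (F i)) -> L2 (\sum_(i <- s | P i) F i).
Proof. by move=> LF; elim/big_ind : _ => //; [exact: L2_0|exact: L2D]. Qed.

Lemma inner0l g : L2 g -> inner 0 g = 0.
Proof.
move=> Lg; have := inner_linl 1 (L2_0 R) (L2_0 R) Lg.
by rewrite scale1r addr0 mul1r => /eqP; rewrite -subr_eq subrr eq_sym => /eqP.
Qed.

Lemma innerZl (c : R[i]) f g : L2 f -> L2 g -> inner (c *: f) g = c * inner f g.
Proof.
by move=> Lf Lg; rewrite -[c *: f]addr0 (inner_linl c Lf (L2_0 R) Lg) inner0l// addr0.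
Qed.

Lemma innerDl f g h : L2 f -> L2 g -> L2 h -> inner (f + g) h = inner f h + inner g h.
Proof. by move=> Lf Lg Lh; rewrite -[f]scale1r (inner_linl 1 Lf Lg Lh) mul1r scale1r. Qed.

Lemma inner_suml I (s : seq I) (P : pred I) (F : I -> R[i] -> R[i]) g :
  (forall i, P i -> L2 (F i)) -> L2 g ->
  inner (\sum_(i <- s | P i) F i) g = \sum_(i <- s | P i) inner (F i) g.
Proof.
move=> LF Lg.
suff [] : L2 (\sum_(i <- s | P i) F i) /\
  inner (\sum_(i <- s | P i) F i) g = \sum_(i <- s | P i) inner (F i) g by [].
elim/big_rec2 : _ => [|i u f Pi [Lf <-]]; first by split; [exact: L2_0|exact: inner0l].
by split; [apply: L2D => //; exact: LF|rewrite innerDl//; exact: LF].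
Qed.

Lemma innerZr (c : R[i]) f g : L2 f -> L2 g -> inner f (c *: g) = c^* * inner f g.
Proof.
move=> Lf Lg; rewrite (inner_conj (L2Z c Lg) Lf) innerZl// cconjM.
by rewrite (inner_conj Lg Lf).
Qed.

Lemma innerDr f g h : L2 f -> L2 g -> L2 h -> inner h (f + g) = inner h f + inner h g.
Proof.
move=> Lf Lg Lh; rewrite (inner_conj (L2D Lf Lg) Lh) innerDl// cconjD.
by rewrite -(inner_conj Lf Lh) -(inner_conj Lg Lh).
Qed.

Lemma inner_sumr I (s : seq I) (P : pred I) (F : I -> R[i] -> R[i]) g :
  (forall i, P i -> L2 (F i)) -> L2 g ->
  inner g (\sum_(i <- s | P i) F i) = \sum_(i <- s | P i) inner g (F i).
Proof.
move=> LF Lg.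
suff [] : L2 (\sum_(i <- s | P i) F i) /\
  inner g (\sum_(i <- s | P i) F i) = \sum_(i <- s | P i) inner g (F i) by [].
elim/big_rec2 : _ => [|i u f Pi [Lf <-]].
  split; first exact: L2_0.
  by rewrite (inner_conj (L2_0 R) Lg) inner0l// rmorph0.
by split; [apply: L2D => //; exact: LF|rewrite innerDr//; exact: LF].
Qed.

Lemma inner_mono j k a b : inner (mono j k) (mono a b) =
  (j + b == k + a)%N%:R * (j + b)`!%:R.
Proof.
rewrite -gauss_integral_mono /inner; congr gauss_integral; apply/funext => z.
by rewrite !monoE cconjM !cconjX conjCK !exprD; ring.
Qed.

Lemma Dz_mono a b : Dz (mono a b) = a%:R *: mono a.-1 b.
Proof.
have sid := smooth_id R; have sb := @smooth_zb R.
rewrite (DzM (smoothX a sid) (smoothX b sb)) (DzX _ sid) (DzX _ sb) Dz_id Dz_zb.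
apply/funext => z.
rewrite -[LHS]/(a%:R * z ^+ a.-1 * 1 * (@zb R ^+ b) z + (id ^+ a : R[i] -> R[i]) z * (b%:R * @zb R z ^+ b.-1 * 0)).
by rewrite mulr0 mulr0 addr0 -[RHS]/(a%:R * mono a.-1 b z) monoE expfE; ring.
Qed.

Lemma creation_mono a b : creation (mono a b) = mono a b.+1 - a%:R *: mono a.-1 b.
Proof.
apply/funext => z; rewrite /creation DzE Dz_mono.
rewrite -[RHS]/(mono a b.+1 z - a%:R * mono a.-1 b z) -[(_ *: _) z]/(a%:R * mono a.-1 b z).
by rewrite !monoE exprS; ring.
Qed.

(** A^dagger is the adjoint of d/dzbar; on monomials this is an identity between
    factorials. *)
Lemma creation_adjoint_mono j k a b :
  inner (mono j k) (creation (mono a b)) = k%:R * inner (mono j k.-1) (mono a b).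
Proof.
have L := L2_mono.
rewrite creation_mono -scaleNr innerDr//; last exact: L2Z.
rewrite innerZr// !inner_mono.
have -> : (- a%:R : R[i])^* = - a%:R by rewrite rmorphN rmorph_nat.
case: a => [|a]; case: k => [|k]; rewrite ?[_.+1.-1]/(_).
- have -> : (j + b.+1 == 0 + 0)%N = false by rewrite addnS.
  by rewrite oppr0 mulr0n !mul0r addr0.
- have -> : (j + b.+1 == k.+1 + 0)%N = (j + b == k + 0)%N by rewrite addnS addSn eqSS.
  rewrite oppr0 !mul0r addr0; case: eqP => [E|_]; last by rewrite mulr0n !mul0r mulr0.
  by rewrite !mul1r addnS E addn0 factS natrM.
- have -> : (j + b.+1 == 0 + a.+1)%N = (j + b == 0 + a)%N by rewrite addnS add0n eqSS.
  rewrite [RHS]mul0r; case: eqP => [E|_]; last by rewrite mulr0n !mul0r mulr0 addr0.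
  by rewrite !mul1r addnS E add0n factS natrM; ring.
- have -> : (j + b.+1 == k.+1 + a.+1)%N = (j + b == k.+1 + a)%N by rewrite addnS addnS eqSS.
  have -> : (j + b == k + a.+1)%N = (j + b == k.+1 + a)%N by rewrite addSnnS.
  case: eqP => [E|_]; last by rewrite mulr0n !mul0r !mulr0 addr0.
  have -> : ((j + b.+1)`!%:R : R[i]) = (k.+1%:R + a.+1%:R) * (j + b)`!%:R.
    by rewrite addnS factS natrM -natrD E addnS.
  by rewrite !mul1r; ring.
Qed.

End monomials.

(** * Explicit complex Hermite polynomials *)

Section pairing.
Variable R : realType.
Local Notation mplane := (mplane R).
Local Notation gauss := (@gauss_measure R).
Implicit Types (f g h : R[i] -> R[i]) (z : R[i]) (a : nat -> R[i]).

(** The coefficient of z^(p-i) zbar^(q-i) in (A^dagger)^q z^p; it vanishes for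
    i > p, so that truncated subtraction in the exponents is harmless. *)
Definition hcoef (p q i : nat) : R[i] := (-1) ^+ i * 'C(q, i)%:R * (p ^_ i)%:R.

(** The Hermite polynomial before normalization; [iter_creation] identifies it. *)
Definition hpoly (p q : nat) : R[i] -> R[i] :=
  \sum_(i < q.+1) hcoef p q i *: @mono R (p - i) (q - i).

Lemma hpolyE p q z : hpoly p q z = \sum_(i < q.+1) hcoef p q i * @mono R (p - i) (q - i) z.
Proof. by rewrite /hpoly sumfE. Qed.

Lemma creation_lin (c : R[i]) f g : smooth f -> smooth g ->
  creation (c *: f + g) = c *: creation f + creation g.
Proof.
move=> sf sg; apply/funext => z; rewrite /creation DzE (Dz_lin c sf sg).
rewrite -[LHS]/(z^* * (c * f z + g z) - (c * Dz f z + Dz g z)).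
rewrite -[RHS]/(c * (z^* * f z - Dz f z) + (z^* * g z - Dz g z)).
by ring.
Qed.

Lemma creation0 : creation (0 : R[i] -> R[i]) = 0.
Proof.
apply/funext => z; rewrite /creation DzE Dz_cst.
by rewrite -[LHS]/(z^* * 0 - 0) mulr0 subr0.
Qed.

Lemma creation_sum n (c : nat -> R[i]) (F : nat -> R[i] -> R[i]) :
  (forall i, smooth (F i)) ->
  creation (\sum_(i < n) c i *: F i) = \sum_(i < n) c i *: creation (F i).
Proof.
move=> sF; elim: n => [|n IH]; first by rewrite !big_ord0 creation0.
rewrite !big_ord_recr/= addrC creation_lin//; last first.
  by apply: smooth_sum => i _; exact: smoothZ.
by rewrite IH addrC.
Qed.

Lemma hcoefS p q i : hcoef p q.+1 i.+1 = hcoef p q i.+1 - hcoef p q i * (p - i)%:R.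
Proof. by rewrite /hcoef binS natrD ffactnSr natrM exprS; ring. Qed.

Lemma creation_hpoly p q : creation (hpoly p q) = hpoly p q.+1.
Proof.
rewrite /hpoly (@creation_sum _ (hcoef p q) (fun i => @mono R (p - i) (q - i))); last first.
  by move=> i; exact: smooth_mono.
apply/funext => z; rewrite !sumfE.
transitivity (\sum_(i < q.+1) hcoef p q i * @mono R (p - i) (q.+1 - i) z -
   \sum_(i < q.+1) hcoef p q i * (p - i)%:R * @mono R (p - i.+1) (q.+1 - i.+1) z).
  rewrite -sumrB; apply: eq_bigr => i _; rewrite creation_mono.
  rewrite -[LHS]/(hcoef p q i * (@mono R (p - i) (q - i).+1 z - (p - i)%:R * @mono R (p - i).-1 (q - i) z)).
  have iq : (i <= q)%N by rewrite -ltnS.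
  rewrite subSS (subSn iq) subnS.
  move: (mono (p - i) _ z) (mono (p - i).-1 _ z) ((p - i)%:R : R[i]) (hcoef p q i) => *.
  by ring.
have -> : \sum_(i < q.+1) hcoef p q i * @mono R (p - i) (q.+1 - i) z =
   \sum_(i < q.+2) hcoef p q i * @mono R (p - i) (q.+1 - i) z.
  by rewrite [RHS]big_ord_recr/= /hcoef bin_small// mulr0 mul0r mul0r addr0.
rewrite big_ord_recl [RHS]big_ord_recl -addrA; congr (_ + _).
  by rewrite -[RHS]/(hcoef p q.+1 0 * @mono R (p - 0) (q.+1 - 0) z) /hcoef !bin0.
rewrite -sumrB; apply: eq_bigr => i _; rewrite ?lift0.
rewrite -[RHS]/(hcoef p q.+1 i.+1 * @mono R (p - i.+1) (q.+1 - i.+1) z) hcoefS.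
by ring.
Qed.

Lemma hpoly0 p : hpoly p 0 = @mono R p 0.
Proof.
apply/funext => z; rewrite hpolyE big_ord1 /hcoef bin0 ffactn0 expr0 !mul1r !subn0//.
Qed.

Lemma Dzb_mono j k : Dzb (@mono R j k) = k%:R *: @mono R j k.-1.
Proof.
have sid := smooth_id R; have sb := @smooth_zb R.
rewrite (DzbM (smoothX j sid) (smoothX k sb)) (DzbX _ sid) (DzbX _ sb) Dzb_id Dzb_zb.
apply/funext => z.
rewrite -[LHS]/(j%:R * z ^+ j.-1 * 0 * (@zb R ^+ k) z + (id ^+ j : R[i] -> R[i]) z * (k%:R * @zb R z ^+ k.-1 * 1)).
by rewrite mulr0 mul0r add0r -[RHS]/(k%:R * @mono R j k.-1 z) monoE expfE; ring.
Qed.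

Lemma iter_creation_bar p : iter p (@creation_bar R) (cst 1) = @mono R p 0.
Proof.
elim: p => [|p IH].
  by apply/funext => z; rewrite monoE !expr0 mulr1.
rewrite iterS IH; apply/funext => z; rewrite /creation_bar DzbE Dzb_mono.
rewrite -[LHS]/(z * @mono R p 0 z - 0%:R * @mono R p 0 z) !monoE exprS mul0r subr0.
by rewrite mulrA.
Qed.

Lemma iter_creation p q :
  iter q (@creation R) (iter p (@creation_bar R) (cst 1)) = hpoly p q.
Proof.
rewrite iter_creation_bar; elim: q => [|q IH]; first by rewrite hpoly0.
by rewrite iterS IH creation_hpoly.
Qed.

Lemma L2_hpoly p q : L2 (hpoly p q).
Proof. by apply: L2_sum => i _; apply/L2Z/L2_mono. Qed.

Lemma smooth_hpoly p q : smooth (hpoly p q).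
Proof. by apply: smooth_sum => i _; apply/smoothZ/smooth_mono. Qed.

Lemma inner_mono_sum j k n (c : nat -> R[i]) (F : nat -> R[i] -> R[i]) : (forall i, L2 (F i)) ->
  inner (@mono R j k) (\sum_(i < n) c i *: F i) = \sum_(i < n) (c i)^* * inner (@mono R j k) (F i).
Proof.
move=> LF; rewrite inner_sumr; last exact: L2_mono.
  by apply: eq_bigr => i _; rewrite innerZr//; exact: L2_mono.
by move=> i _; exact: L2Z.
Qed.

Lemma L2_creation_mono j k : L2 (creation (@mono R j k)).
Proof. by rewrite creation_mono -scaleNr; apply: L2D; [|apply: L2Z]; exact: L2_mono. Qed.

(** Moving the q creation operators to the other side differentiates zbar^k q
    times. *)
Lemma inner_mono_hpoly j k p q :
  inner (@mono R j k) (hpoly p q) = (k ^_ q)%:R * inner (@mono R j (k - q)) (@mono R p 0).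
Proof.
elim: q k => [|q IH] k; first by rewrite hpoly0 ffactn0 mul1r subn0.
rewrite -creation_hpoly /hpoly (@creation_sum _ (hcoef p q) (fun i => @mono R (p - i) (q - i))); last first.
  by move=> i; exact: smooth_mono.
rewrite (@inner_mono_sum _ _ _ (hcoef p q) (fun i => creation (@mono R (p - i) (q - i)))); last by move=> i; exact: L2_creation_mono.
transitivity (k%:R * inner (@mono R j k.-1) (hpoly p q)).
  rewrite /hpoly (@inner_mono_sum _ _ _ (hcoef p q) (fun i => @mono R (p - i) (q - i))); last by move=> i; exact: L2_mono.
  rewrite mulr_sumr; apply: eq_bigr => i _.
  by rewrite creation_adjoint_mono mulrCA.
by rewrite IH mulrA -natrM -ffactnS subnS -predn_sub.
Qed.

Lemma hpoly_rot p q (c : R[i]) z : normc c = 1 ->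
  hpoly p q (c * z) = c ^+ p * c^* ^+ q * hpoly p q z.
Proof.
move=> c1; rewrite !hpolyE mulr_sumr; apply: eq_bigr => i _.
rewrite mono_rot mulrCA; have [ip|pi] := leqP i p; last first.
  by rewrite /hcoef ffact_small// mulr0n !mulr0 !mul0r !mulr0.
have iq : (i <= q)%N by rewrite -ltnS.
have -> : c ^+ p = c ^+ (p - i) * c ^+ i by rewrite -exprD subnK.
have -> : c^* ^+ q = c^* ^+ (q - i) * c^* ^+ i by rewrite -exprD subnK.
have := unit_conjK c1 => /(congr1 (fun x => x ^+ i)); rewrite exprMn expr1n => E.
have -> : c ^+ (p - i) * c ^+ i * (c^* ^+ (q - i) * c^* ^+ i) =
  c ^+ (p - i) * c^* ^+ (q - i) * (c^* ^+ i * c ^+ i) by ring.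
by rewrite E mulr1.
Qed.

(** * Discs and dominated convergence *)

(** Indicator function of the disc of radius |r|. The square makes it the
    sublevel set of a polynomial, hence visibly measurable. *)
Definition chi (r : R) : R[i] -> R[i] :=
  fun z => if normc z ^+ 2 <= r ^+ 2 then 1 else 0.

Lemma cmeas_chi r : cmeas (chi r).
Proof.
have mA : measurable [set p : mplane | nrm2 p <= r ^+ 2].
  rewrite -[X in measurable X]setTI.
  have -> : [set p | nrm2 p <= r ^+ 2] = (@nrm2 R) @^-1` `]-oo, r ^+ 2]%classic.
    by apply/seteqP; split => p /=; rewrite in_itv.
  by apply: (@measurable_nrm2 R) => //; exact: measurable_itv.
apply: measurable_planeP.
  have -> : (fun p : mplane => complex.Re (chi r (cplx p))) =
     \1_[set p : mplane | nrm2 p <= r ^+ 2].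
    apply/funext => p; rewrite indicE /chi -[normc (cplx p) ^+ 2]/(nrm2 p).
    by case: ifP => h; [rewrite mem_set|rewrite memNset//= h].
  exact: measurable_indic.
have -> : (fun p : mplane => complex.Im (chi r (cplx p))) = cst 0.
  by apply/funext => p; rewrite /chi; case: ifP.
exact: measurable_cst.
Qed.

Lemma chi_rot r (c : R[i]) z : normc c = 1 -> chi r (c * z) = chi r z.
Proof. by move=> c1; rewrite /chi normcM c1 mul1r. Qed.

Lemma clim_Re (u : nat -> R[i]) l : clim u l ->
  (fun n => complex.Re (u n)) @ \oo --> complex.Re l.
Proof.
move=> ul; apply/cvgrPdist_le => e /ul[N H]; near=> m.
have -> : complex.Re l - complex.Re (u m) = complex.Re (l - u m).
  by rewrite Re_addc; case: (u m).
apply: le_trans (normc_ge_parts _).1 _; rewrite normcB; apply: H.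
by near: m; exact: nbhs_infty_ge.
Unshelve. all: by end_near. Qed.

Lemma clim_Im (u : nat -> R[i]) l : clim u l ->
  (fun n => complex.Im (u n)) @ \oo --> complex.Im l.
Proof.
move=> ul; apply/cvgrPdist_le => e /ul[N H]; near=> m.
have -> : complex.Im l - complex.Im (u m) = complex.Im (l - u m).
  by rewrite Im_addc; case: (u m).
apply: le_trans (normc_ge_parts _).2 _; rewrite normcB; apply: H.
by near: m; exact: nbhs_infty_ge.
Unshelve. all: by end_near. Qed.

Lemma clim_parts (u : nat -> R[i]) l :
  (fun n => complex.Re (u n)) @ \oo --> complex.Re l ->
  (fun n => complex.Im (u n)) @ \oo --> complex.Im l -> clim u l.
Proof.
move=> /cvgrPdist_le hr /cvgrPdist_le hi e e0.
have e2 : 0 < e / 2 by rewrite divr_gt0.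
have [N1 _ H1] := hr _ e2; have [N2 _ H2] := hi _ e2.
exists (maxn N1 N2) => m; rewrite geq_max => /andP[/H1 h1 /H2 h2].
rewrite normcB; apply: le_trans (normc_le_parts _) _.
have -> : complex.Re (l - u m) = complex.Re l - complex.Re (u m).
  by rewrite Re_addc; case: (u m).
have -> : complex.Im (l - u m) = complex.Im l - complex.Im (u m).
  by rewrite Im_addc; case: (u m).
by rewrite [e]splitr; exact: lerD.
Qed.

Lemma eq_clim (u v : nat -> R[i]) l : (forall n, v n = u n) -> clim u l -> clim v l.
Proof. by move=> /funext ->. Qed.

Lemma eventually_clim (u v : nat -> R[i]) l N :
  (forall n, (N <= n)%N -> v n = u n) -> clim u l -> clim v l.
Proof.
move=> uv ul e /ul[M HM]; exists (maxn N M) => n; rewrite geq_max => /andP[/uv-> ?].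
exact: HM.
Qed.

Lemma clim_sum n (u : nat -> nat -> R[i]) (l : nat -> R[i]) : (forall k, clim (u k) (l k)) ->
  clim (fun N => \sum_(k < n) u k N) (\sum_(k < n) l k).
Proof.
move=> ul; elim: n => [|n IH].
  by rewrite big_ord0; apply: eq_clim (clim_cst 0) => N; rewrite big_ord0.
rewrite big_ord_recr/=; apply: eq_clim (climD IH (ul n)) => N.
by rewrite big_ord_recr.
Qed.

Lemma cmeas_clim (F : nat -> R[i] -> R[i]) f : (forall N, cmeas (F N)) ->
  (forall z, clim (fun N => F N z) (f z)) -> cmeas f.
Proof.
move=> mF Ff; apply: measurable_planeP.
  apply: (@measurable_fun_cvg _ _ _ _ (fun N (p : mplane) => complex.Re (F N (cplx p)))).
    by move=> N; apply: measurable_Re; exact: mF.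
  move=> p _; exact: clim_Re.
apply: (@measurable_fun_cvg _ _ _ _ (fun N (p : mplane) => complex.Im (F N (cplx p)))).
  by move=> N; apply: measurable_Im; exact: mF.
move=> p _; exact: clim_Im.
Qed.

Lemma real_dominated_convergence (u : nat -> mplane -> R) (v G : mplane -> R) :
  (forall N, measurable_fun [set: mplane] (u N)) ->
  (forall p, (fun N => u N p) @ \oo --> v p) ->
  gauss.-integrable [set: mplane] (EFin \o G) -> (forall N p, `|u N p| <= G p) ->
  gauss.-integrable [set: mplane] (EFin \o v) /\
  (fun N => \int[gauss]_p u N p) @ \oo --> \int[gauss]_p v p.
Proof.
move=> mu uv iG uG.
have mv : measurable_fun [set: mplane] v.
  by apply: (@measurable_fun_cvg _ _ _ _ u) => // p _; exact: uv.
have [|||||iv _ C] := @dominated_convergence _ _ _ gauss [set: mplane] measurableT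
   (fun N p => (u N p)%:E) (fun p => (v p)%:E) (EFin \o G).
- by move=> N; apply/measurable_EFinP.
- exact/measurable_EFinP.
- by apply: aeW => p _; apply: cvg_EFin; [exact: nearW|exact: uv].
- exact: iG.
- by apply: aeW => p N _; rewrite abse_EFin lee_fin.
split => //; apply: fine_cvg.
by rewrite fineK//; exact: integrable_fin_num.
Qed.

Lemma dominated_clim (F : nat -> R[i] -> R[i]) f (G : mplane -> R) :
  (forall N, cmeas (F N)) -> (forall z, clim (fun N => F N z) (f z)) ->
  gauss.-integrable [set: mplane] (EFin \o G) ->
  (forall N p, normc (F N (cplx p)) <= G p) ->
  cintegrable f /\ clim (fun N => gauss_integral (F N)) (gauss_integral f).
Proof.
move=> mF Ff iG FG.
have [|||i1 C1] := @real_dominated_convergence (fun N p => complex.Re (F N (cplx p)))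
   (fun p => complex.Re (f (cplx p))) G _ _ iG _.
- by move=> N; apply: measurable_Re; exact: mF.
- by move=> p; exact: clim_Re.
- by move=> N p; apply: le_trans (normc_ge_parts _).1 (FG _ _).
have [|||i2 C2] := @real_dominated_convergence (fun N p => complex.Im (F N (cplx p)))
   (fun p => complex.Im (f (cplx p))) G _ _ iG _.
- by move=> N; apply: measurable_Im; exact: mF.
- by move=> p; exact: clim_Im.
- by move=> N p; apply: le_trans (normc_ge_parts _).2 (FG _ _).
by split; [split|apply: clim_parts].
Qed.

Lemma integrable_const (K : R) : gauss.-integrable [set: mplane] (EFin \o (fun=> K)).
Proof.
have := integrableZl measurableT K (L2_integrable (L2_mono R 0 0)).
apply: eq_integrable => // p _.
by rewrite normc_mono expr0 expr1n /= mule1.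
Qed.

Lemma chi_le1 r z : normc (chi r z) <= 1.
Proof. by rewrite /chi; case: ifP => _; rewrite ?normc1 ?normc0. Qed.

Lemma chi_bound r f M z : 0 <= r -> 0 <= M -> (forall z, normc z <= r -> normc (f z) <= M) ->
  normc (chi r z * f z) <= M.
Proof.
move=> r0 M0 fM; rewrite /chi; case: ifP => [zr|_].
  by rewrite mul1r; apply: fM; rewrite -(@ler_pXn2r _ 2)// nnegrE normc_ge0.
by rewrite mul0r normc0.
Qed.

Lemma chi_clim z (l : R[i]) : clim (fun N => chi N%:R z * l) l.
Proof.
move=> e e0; exists (Num.bound (normc z)) => N zN.
rewrite /chi ifT ?mul1r ?subrr ?normc0 ?ltW//.
rewrite ltrXn2r// ?nnegrE ?normc_ge0//.
have := archi_boundP (normc_ge0 z) => h; apply: lt_le_trans h _.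
by rewrite ler_nat.
Qed.

(** Inner products can be computed as limits of integrals over discs, where power
    series converge uniformly. *)
Lemma inner_disc f g : L2 f -> L2 g ->
  clim (fun N => gauss_integral (chi N%:R * (f * conjf g))) (inner f g).
Proof.
move=> Lf Lg; have [[mf _] [mg _]] := (Lf, Lg).
have iG : gauss.-integrable [set: mplane]
    (EFin \o (fun p => 1 * normc (f (cplx p)) ^+ 2 + 1 * normc (g (cplx p)) ^+ 2)).
  by have [] := RintegralDZ 1 1 (L2_integrable Lf) (L2_integrable Lg).
have [|||_ ] := @dominated_clim (fun N => chi N%:R * (f * conjf g)) (f * conjf g) _ _ _ iG _.
- by move=> N; apply: cmeasM; [exact: cmeas_chi|apply: cmeasM => //; exact: cmeas_conj].
- move=> z; exact: chi_clim.
- move=> N p; rewrite -[(_ * _) (cplx p)]/(chi N%:R (cplx p) * (f (cplx p) * (g (cplx p))^*)).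
  rewrite !normcM normc_conj !mul1r.
  have := chi_le1 N%:R (cplx p); have := normc_ge0 (chi N%:R (cplx p)).
  have := normc_ge0 (f (cplx p)); have := normc_ge0 (g (cplx p)).
  move: (normc (chi _ _)) (normc (f _)) (normc (g _)) => x u v v0 u0 x0 x1.
  apply: (@le_trans _ _ (u * v)); first by rewrite ler_piMl// mulr_ge0.
  have := sqr_ge0 (u - v); have := sqr_ge0 (u + v); clear; nra.
by [].
Qed.

Lemma psum_bound a r : entire a -> 0 < r ->
  exists2 C, 0 <= C & forall N z, normc z <= r -> normc (psum a N z) <= C.
Proof.
move=> ea r0; have r20 : 0 < 2 * r by rewrite mulr_gt0.
have [C HC] := ea _ r20.
have C0 : 0 <= C by apply: le_trans (HC 0%N); rewrite mulr_ge0 ?normc_ge0// expr0.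
have key N z : normc z <= r -> normc (psum a N z - pser a z) <= 2 * C.
  move=> zr; apply: le_trans (pser_rate N HC ea zr) _.
  by rewrite ler_piMr ?mulr_ge0// exprn_ile1// invf_le1// ler1n.
exists (2 * C + 2 * C) => [|N z zr]; first by rewrite addr_ge0// mulr_ge0.
have -> : psum a N z = (psum a N z - pser a z) + (pser a z - psum a 0 z).
  by rewrite /psum big_ord0 subr0 subrK.
apply: le_trans (le_normcD _ _) _; rewrite lerD ?key//.
by rewrite normcB key.
Qed.

Lemma gauss_integral0 : gauss_integral (0 : R[i] -> R[i]) = 0.
Proof.
by apply/eqP; rewrite eq_complex/=; apply/andP; split; apply/eqP; rewrite /Rintegral integral0.
Qed.

Lemma cintegrable_bounded f M : cmeas f -> (forall z, normc (f z) <= M) -> cintegrable f.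
Proof.
move=> mf fM; have [] // := @dominated_clim (fun=> f) f _ (fun=> mf) (fun z => clim_cst (f z)) (integrable_const M).
Qed.

Lemma cintegrable_lin (c : R[i]) f g :
  cintegrable f -> cintegrable g -> cintegrable (c *: f + g).
Proof.
case: c => a b [Fr Fi] [Gr Gi].
have [_ i1] := RintegralDZ a (- b) Fr Fi.
have [_ i2] := RintegralDZ a b Fi Fr.
have [_ i3] := RintegralDZ 1 1 i1 Gr.
have [_ i4] := RintegralDZ 1 1 i2 Gi.
split.
- apply: eq_integrable i3 => // p _; congr EFin.
  rewrite -[(_ + _) (cplx p)]/((a +i* b) * f (cplx p) + g (cplx p)).
  by rewrite /= Re_addc Re_mulc /= !mul1r mulNr.
- apply: eq_integrable i4 => // p _; congr EFin.
  rewrite -[(_ + _) (cplx p)]/((a +i* b) * f (cplx p) + g (cplx p)).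
  by rewrite /= Im_addc Im_mulc /= !mul1r.
Qed.

Lemma gauss_integral_suml n (c : nat -> R[i]) (F : nat -> R[i] -> R[i]) :
  (forall i, cintegrable (F i)) ->
  cintegrable (\sum_(i < n) c i *: F i) /\
  gauss_integral (\sum_(i < n) c i *: F i) = \sum_(i < n) c i * gauss_integral (F i).
Proof.
move=> iF; elim: n => [|n [IH1 IH2]].
  by rewrite !big_ord0; split; [split; exact: integrable0|exact: gauss_integral0].
rewrite !big_ord_recr/= ![_ + c n *: _]addrC; split.
  exact: cintegrable_lin.
by rewrite -[c n *: gauss_integral _]/(c n * gauss_integral _) -IH2 -gauss_integral_lin.
Qed.

(** * Pairing with Hermite polynomials *)

Lemma cmeas_sum n (c : nat -> R[i]) (F : nat -> R[i] -> R[i]) :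
  (forall i, cmeas (F i)) -> cmeas (\sum_(i < n) c i *: F i).
Proof.
move=> mF; elim: n => [|n IH]; first by rewrite big_ord0; exact: cmeas_cst.
by rewrite big_ord_recr/= addrC; exact: cmeas_lin.
Qed.

Lemma cmeas_pser a : entire a -> cmeas (pser a).
Proof.
move=> ea; apply: (@cmeas_clim (fun n => psum a n)) => [n|z]; last exact: pserP.
have -> : psum a n = \sum_(j < n) a j *: (id ^+ j : R[i] -> R[i]).
  by apply/funext => z; rewrite sumfE; apply: eq_bigr => j _; rewrite -[RHS]/(a j * (id ^+ j : R[i] -> R[i]) z) expfE.
by apply: (@cmeas_sum n a (fun j => id ^+ j)) => j; apply: cmeasX; exact: cmeas_id.
Qed.

Lemma cmeas_hpoly p q : cmeas (hpoly p q). Proof. by have [] := L2_hpoly p q. Qed.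

Definition disc_mono (N j k p q : nat) : R[i] -> R[i] :=
  chi N%:R * (mono j k * conjf (hpoly p q)).

Lemma cmeas_disc_mono N j k p q : cmeas (disc_mono N j k p q).
Proof.
apply: cmeasM; first exact: cmeas_chi.
by apply: cmeasM; [exact: cmeas_mono|apply: cmeas_conj; exact: cmeas_hpoly].
Qed.

Lemma smooth_disc_bound N f : smooth f ->
  exists2 M, 0 <= M & forall z, normc (chi N%:R z * f z) <= M.
Proof.
move=> sf; have [M HM] := bounded_on_disc N%:R sf.
exists `|M| => [|z]; first exact: normr_ge0.
by apply: chi_bound => // u ru; apply: le_trans (HM _ ru) (ler_norm _).
Qed.

Lemma cintegrable_disc_mono N j k p q : cintegrable (disc_mono N j k p q).
Proof.
have [M _ HM] := @smooth_disc_bound N (mono j k * conjf (hpoly p q))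
  (smoothM (@smooth_mono R j k) (smooth_conj (smooth_hpoly p q))).
exact: (cintegrable_bounded (cmeas_disc_mono N j k p q) HM).
Qed.

(** The integrand transforms under rotations by the character of weight
    (j + q) - (k + p). *)
Lemma disc_mono_orthogonal N j k p q : (j + q)%N <> (k + p)%N ->
  gauss_integral (disc_mono N j k p q) = 0.
Proof.
move=> jk; apply: (gauss_integral_invariant (cmeas_disc_mono N j k p q) jk); last first.
  exact: cintegrable_disc_mono.
move=> c z c1.
rewrite -[LHS]/(chi N%:R (c * z) * (mono j k (c * z) * (hpoly p q (c * z))^*)).
rewrite -[disc_mono N j k p q z]/(chi N%:R z * (mono j k z * (hpoly p q z)^*)).
rewrite chi_rot// mono_rot hpoly_rot// !cconjM !cconjX conjCK !exprD.
by ring.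
Qed.

(** Partial sums are bounded uniformly on the disc, so the series is integrated
    termwise, and only the term j = k + p - q survives. *)
Lemma disc_pairing N k p q a : entire a ->
  gauss_integral (chi N%:R * (@zb R ^+ k * pser a * conjf (hpoly p q))) =
  if (q <= k + p)%N then
    a (k + p - q)%N * gauss_integral (disc_mono N (k + p - q) k p q) else 0.
Proof.
move=> ea.
pose F n : R[i] -> R[i] := \sum_(j < n) a j *: disc_mono N j k p q.
have FE n z : F n z = chi N%:R z * (psum a n z * (@zb R z ^+ k * (hpoly p q z)^*)).
  rewrite /F sumfE /psum mulr_suml mulr_sumr; apply: eq_bigr => j _.
  rewrite -[LHS]/(a j * (chi N%:R z * (mono j k z * (hpoly p q z)^*))) monoE.
  by rewrite -[@zb R z]/(z^*); ring.
have LE z : (chi N%:R * (@zb R ^+ k * pser a * conjf (hpoly p q))) z =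
   chi N%:R z * @zb R z ^+ k * (hpoly p q z)^* * pser a z.
  rewrite -[LHS]/(chi N%:R z * ((@zb R ^+ k) z * pser a z * (hpoly p q z)^*)) expfE.
  by ring.
have [M1 M10 HM1] := @smooth_disc_bound N (@zb R ^+ k * conjf (hpoly p q))
  (smoothM (smoothX k (@smooth_zb R)) (smooth_conj (smooth_hpoly p q))).
have [C C0 HC] := @psum_bound a N.+1%:R ea (ltr0Sn _ _).
have [|||_ cF] := @dominated_clim F (chi N%:R * (@zb R ^+ k * pser a * conjf (hpoly p q)))
   (fun=> M1 * C) _ _ (integrable_const _).
- move=> n; apply: (@cmeas_sum n a (fun j => disc_mono N j k p q)) => i.
  exact: cmeas_disc_mono.
- move=> z; rewrite LE; have := climZ (chi N%:R z * @zb R z ^+ k * (hpoly p q z)^* ) (pserP z ea).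
  by apply: eq_clim => n; rewrite FE; ring.
- move=> n u; rewrite FE; set z := cplx u.
  have [zN|zN] := leP (normc z) N.+1%:R.
    have -> : chi N%:R z * (psum a n z * (@zb R z ^+ k * (hpoly p q z)^*)) =
      (chi N%:R z * (@zb R z ^+ k * (hpoly p q z)^*)) * psum a n z by ring.
    rewrite normcM; apply: ler_pM; rewrite ?normc_ge0//; last exact: HC.
    have := HM1 z.
    by rewrite -[(_ * _) z]/((@zb R ^+ k) z * (hpoly p q z)^*) expfE.
  rewrite /chi ifF ?mul0r ?normc0 ?mulr_ge0//.
  apply/negbTE; rewrite -ltNge ltr_pXn2r// ?nnegrE ?normc_ge0//.
  by apply: le_lt_trans zN; rewrite ler_nat.
apply: clim_unique cF _.
have GF n : gauss_integral (F n) =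
    \sum_(j < n) a j * gauss_integral (disc_mono N j k p q).
  by have [_ ->] := @gauss_integral_suml n a (fun j => disc_mono N j k p q)
     (fun j => cintegrable_disc_mono N j k p q).
have := clim_cst (if (q <= k + p)%N then
    a (k + p - q)%N * gauss_integral (disc_mono N (k + p - q) k p q) else 0).
apply: (@eventually_clim _ _ _ (k + p).+1) => n kpn; rewrite GF.
case: ifP => [qkp|qkp]; last first.
  rewrite big1// => j _; rewrite disc_mono_orthogonal ?mulr0// => E.
  by move: qkp; rewrite -E leq_addl.
have jn : (k + p - q < n)%N by apply: leq_ltn_trans kpn; rewrite leq_subr.
rewrite (bigD1 (Ordinal jn))//= big1 ?addr0// => j jN.
rewrite disc_mono_orthogonal ?mulr0// => E.
by move/negP: jN; apply; apply/eqP/val_inj => /=; rewrite -E addnK.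
Qed.

(** Summation of [disc_pairing] over k, followed by the limit of large discs. The
    terms with k < q drop out through the falling factorial. *)
Lemma pairing_coef n p q (a : nat -> nat -> R[i]) f : (forall k, entire (a k)) ->
  L2 f -> f = \sum_(k < n) @zb R ^+ k * pser (a k) ->
  inner f (hpoly p q) =
  \sum_(k < n) (k ^_ q)%:R * (k + p - q)`!%:R * a k (k + p - q)%N.
Proof.
move=> ea Lf fE.
apply: clim_unique (inner_disc Lf (L2_hpoly p q)) _.
pose T k N : R[i] := if (q <= k + p)%N then
    a k (k + p - q)%N * gauss_integral (disc_mono N (k + p - q) k p q) else 0.
have E N : gauss_integral (chi N%:R * (f * conjf (hpoly p q))) = \sum_(k < n) T k N.
  pose F k : R[i] -> R[i] := chi N%:R * (@zb R ^+ k * pser (a k) * conjf (hpoly p q)).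
  transitivity (gauss_integral (\sum_(k < n) (1 : R[i]) *: F k)).
    congr gauss_integral; apply/funext => z; rewrite sumfE.
    rewrite -[LHS]/(chi N%:R z * (f z * (hpoly p q z)^*)) fE sumfE mulr_suml mulr_sumr.
    by apply: eq_bigr => k _; rewrite scale1r.
  have iF k : cintegrable (F k).
    have sF : smooth (@zb R ^+ k * pser (a k) * conjf (hpoly p q)).
      apply: smoothM; last exact: smooth_conj (smooth_hpoly p q).
      exact: smooth_zbX_pser.
    have [M _ HM] := @smooth_disc_bound N _ sF.
    apply: (cintegrable_bounded _ HM).
    apply: cmeasM; first exact: cmeas_chi.
    apply: cmeasM; last by apply: cmeas_conj; exact: cmeas_hpoly.
    by apply: cmeasM; [apply: cmeasX; apply: cmeas_conj; exact: cmeas_id|exact: cmeas_pser].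
  have [_ ->] := @gauss_integral_suml n (fun=> 1) F iF.
  by apply: eq_bigr => k _; rewrite mul1r /F disc_pairing.
have C k : clim (T k) ((k ^_ q)%:R * (k + p - q)`!%:R * a k (k + p - q)%N).
  rewrite /T; have [qkp|qkp] := leqP q (k + p); last first.
    by rewrite ffact_small ?mul0r//; [exact: clim_cst|exact: leq_ltn_trans (leq_addr p k) _].
  have := climZ (a k (k + p - q)%N) (inner_disc (L2_mono R (k + p - q) k) (L2_hpoly p q)).
  rewrite inner_mono_hpoly inner_mono !addn0.
  have [qk|kq] := leqP q k; last by rewrite ffact_small// !mul0r mulr0.
  rewrite addnBAC// eqxx mul1r [X in clim _ X]mulrC.
  exact.
have := clim_sum n C.
by apply: eq_clim => N; rewrite E.
Qed.

(** * Orthogonality and completeness *)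

Lemma polyfock_mono n j b : (b < n)%N -> polyfock n (@mono R j b).
Proof.
move=> bn; split; [exact: smooth_mono| |exact: L2_mono].
move=> z; rewrite DzbE [mono j b]mulrC iter_Dzb_zbX.
  by rewrite ffact_small// scale0r.
split; first exact: smoothX (smooth_id R).
rewrite (DzbX j (smooth_id R)) Dzb_id; apply/funext => u.
by rewrite -[LHS]/(j%:R * u ^+ j.-1 * 0) mulr0.
Qed.

Lemma polyfock_hpoly n p q : (q < n)%N -> polyfock n (hpoly p q).
Proof.
move=> qn; rewrite /hpoly; elim/big_ind : _ => [|f g Ff Fg|i _].
- exact: polyfock0.
- by rewrite -[f]scale1r; exact: polyfock_lin.
- rewrite -[_ *: _]addr0; apply: polyfock_lin; last exact: polyfock0.
  by apply: polyfock_mono; apply: leq_ltn_trans qn; exact: leq_subr.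
Qed.

Lemma polyfock_series n f : polyfock n f -> exists a : nat -> nat -> R[i],
  (forall k, entire (a k)) /\ f = \sum_(k < n) @zb R ^+ k * pser (a k).
Proof.
move=> [sf nf _]; have [|a [ea fE]] := @polyanalytic_expansion R n f sf _; first exact: nf.
exists a; split => //; apply/funext => z; rewrite fE sumfE; apply: eq_bigr => k _.
by rewrite -[RHS]/((@zb R ^+ k) z * pser (a k) z) expfE.
Qed.

Lemma hpoly_orthogonal n p q f : polyfock n f -> (n <= q)%N -> inner f (hpoly p q) = 0.
Proof.
move=> Ff nq; have [a [ea fE]] := polyfock_series Ff; have [_ _ Lf] := Ff.
rewrite (pairing_coef p q ea Lf fE) big1// => k _.
by rewrite ffact_small ?mul0r//; exact: leq_trans nq.
Qed.

Lemma pser0 (a : nat -> R[i]) : (forall j, a j = 0) -> pser a = 0.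
Proof.
move=> a0; apply/funext => z.
have ea : entire a by move=> r _; exists 0 => j; rewrite a0 normc0 mul0r.
apply: clim_unique (pserP z ea) _; apply: eq_clim (clim_cst 0) => n.
by rewrite /psum big1// => j _; rewrite a0 mul0r.
Qed.

(** The pairings with the Hermite polynomials of index q = n-1, n-2, ... involve
    the coefficients of zbar^k for k >= q only, so they show successively that
    the coefficients of the highest powers of zbar vanish. *)
Lemma polyfock_eq0 n f : polyfock n f ->
  (forall p q, (q < n)%N -> inner f (hpoly p q) = 0) -> f = 0.
Proof.
move=> Ff f0; have [a [ea fE]] := polyfock_series Ff; have [_ _ Lf] := Ff.
have key m k : (k < n)%N -> (n - k <= m)%N -> forall j, a k j = 0.
  elim: m k => [|m IH] k kn; first by rewrite leqn0 subn_eq0 leqNgt kn.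
  move=> nkm j; have := f0 j k kn; rewrite (pairing_coef j k ea Lf fE).
  rewrite (bigD1 (Ordinal kn))//= big1 => [|l lk].
    rewrite addr0 addnC addnK ffactnn => /eqP.
    by rewrite !mulf_eq0 !pnatr_eq0 !eqn0Ngt !fact_gt0/= => /eqP.
  have [lk'|kl] := ltnP l k; first by rewrite ffact_small// !mul0r.
  rewrite IH ?mulr0//.
  have {}kl : (k < l)%N.
    by rewrite ltn_neqAle kl andbT eq_sym; apply: contra lk => /eqP E; apply/eqP/val_inj.
  by rewrite -ltnS; apply: leq_trans nkm; rewrite ltn_sub2l.
rewrite fE big1// => k _; rewrite (pser0 (key _ _ (ltn_ord k) (leqnn _))).
by rewrite mulr0.
Qed.

(** In the expansion of the first polynomial only the leading monomial z^p zbar^q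
    contributes, because the others contain zbar to a power less than q. *)
Lemma inner_hpoly p p' q :
  inner (hpoly p q) (hpoly p' q) = (p == p')%:R * (p`! * q`!)%:R.
Proof.
rewrite {1}/hpoly inner_suml; last exact: L2_hpoly.
  rewrite big_ord_recl big1 => [|i _]; rewrite innerZl ?inner_mono_hpoly;
    try exact: L2_mono; try exact: L2_hpoly.
    rewrite addr0 inner_mono !subn0 subnn ffactnn !addn0 /hcoef bin0 ffactn0 expr0 natrM.
    by rewrite !mul1r mulrCA [q`!%:R * _]mulrC.
  by rewrite lift0 ffact_small ?mul0r ?mulr0// ltn_subrL/=; move: i; case: q => // -[].
by move=> i _; apply/L2Z/L2_mono.
Qed.

Definition hnorm p q : R := Num.sqrt (p`! * q`!)%:R.

Lemma hnorm_gt0 p q : 0 < hnorm p q.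
Proof. by rewrite sqrtr_gt0 ltr0n muln_gt0 !fact_gt0. Qed.

Lemma hermiteE p q : @hermite R p q = ((hnorm p q)^-1)%:C *: hpoly p q.
Proof. by rewrite /hermite iter_creation. Qed.

Lemma L2_hermite p q : L2 (@hermite R p q).
Proof. by rewrite hermiteE; apply/L2Z/L2_hpoly. Qed.

Lemma inner_hermite p p' q : inner (@hermite R p q) (@hermite R p' q) = (p == p')%:R.
Proof.
have L := L2_hpoly.
rewrite !hermiteE innerZl//; last exact: L2Z.
rewrite innerZr// inner_hpoly; case: eqP => [<-|_]; last by rewrite !mul0r !mulr0.
have -> : ((p`! * q`!)%:R : R[i]) = ((hnorm p q) ^+ 2)%:C.
  by rewrite sqr_sqrtr ?ler0n// rmorph_nat.
rewrite conj_real mul1r mulr1n -!rmorphM/= expr2 mulKf ?mulVf ?gt_eqF ?hnorm_gt0//.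
Qed.

Lemma true_polyfock_hermite n p : (0 < n)%N -> true_polyfock n (@hermite R p n.-1).
Proof.
move=> n0; have n1 : (n.-1 < n)%N by rewrite prednK.
rewrite hermiteE -[_ *: _]addr0.
apply: true_polyfock_lin; last exact: true_polyfock0.
split; first exact: polyfock_hpoly.
move=> g Fg; have [_ _ Lg] := Fg.
by rewrite (inner_conj Lg (L2_hpoly _ _)) (hpoly_orthogonal _ Fg)// rmorph0.
Qed.

(** Orthogonality to F_(n-1) takes care of the Hermite polynomials of index
    q < n - 1. *)
Lemma true_polyfock_eq0 n f : true_polyfock n f ->
  (forall p, inner f (@hermite R p n.-1) = 0) -> f = 0.
Proof.
move=> [Ff of_] f0; apply: (polyfock_eq0 Ff) => p q qn; have [_ _ Lf] := Ff.
have [qn1|nq] := ltnP q n.-1; first by apply/of_/polyfock_hpoly.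
have -> : q = n.-1 by apply/eqP; rewrite eqn_leq nq andbT -ltnS prednK// (leq_ltn_trans _ qn).
have := f0 p; rewrite hermiteE innerZr//; last exact: L2_hpoly.
rewrite conj_real => /eqP; rewrite mulf_eq0 => /orP[|/eqP//].
by rewrite fmorph_eq0 invr_eq0 gt_eqF// hnorm_gt0.
Qed.

End pairing.

(** * Hilbert space theory of the Hermite basis *)

Section hilbert.
Variable R : realType.
Local Notation mplane := (mplane R).
Local Notation gauss := (@gauss_measure R).
Implicit Types (f g h : R[i] -> R[i]) (z : R[i]) (a c : nat -> R[i]).

(** The squared norm of L^2, as a real number. *)
Definition sq f : R := complex.Re (inner f f).

Lemma sq_integral f : L2 f -> (\int[gauss]_p (normc (f (cplx p)) ^+ 2)%:E)%E = (sq f)%:E.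
Proof.
move=> Lf.
have -> : sq f = \int[gauss]_p (normc (f (cplx p)) ^+ 2).
  by apply: eq_Rintegral => p _; rewrite mul_conj.
rewrite fineK//; apply: integrable_fin_num => //; exact: L2_integrable.
Qed.

Lemma sq_ge0 f : 0 <= sq f.
Proof.
have -> : sq f = \int[gauss]_p (normc (f (cplx p)) ^+ 2).
  by apply: eq_Rintegral => p _; rewrite mul_conj.
by apply: Rintegral_ge0 => p _; exact: sqr_ge0.
Qed.

Lemma inner_self f : L2 f -> inner f f = (sq f)%:C.
Proof.
move=> Lf; have := inner_conj Lf Lf; rewrite /sq; case: (inner f f) => x y [yE].
by congr (_ +i* _); have := yE; lra.
Qed.

Lemma sq_sub f g (b : R[i]) : L2 f -> L2 g ->
  sq (f - b *: g) = sq f - 2 * complex.Re (b^* * inner f g) + normc b ^+ 2 * sq g.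
Proof.
move=> Lf Lg; have Lbg := L2Z (- b) Lg.
rewrite -scaleNr /sq innerDl//; last exact: L2D.
rewrite !innerDr// !innerZl// !innerZr//.
rewrite (inner_conj Lf Lg) (inner_self Lf) (inner_self Lg) -/(sq f) -/(sq g).
have -> : (- b)^* = - b^* by rewrite rmorphN.
move: (inner f g) (sq f) (sq g) => [x y] A C; case: b {Lbg} => u v.
by rewrite normcE2 /=; ring.
Qed.

(** The squared norm of f - s <f, g> g is nonnegative for every real s; the case of
    a null vector g needs large s instead of the usual s = 1 / |g|^2. *)
Lemma cauchy_schwarz f g : L2 f -> L2 g -> normc (inner f g) ^+ 2 <= sq f * sq g.
Proof.
move=> Lf Lg; set B := inner f g.
have key (s : R) : 0 <= sq f - 2 * s * normc B ^+ 2 + s ^+ 2 * normc B ^+ 2 * sq g.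
  have := sq_ge0 (f - (s%:C * B) *: g); rewrite sq_sub// -/B.
  have -> : complex.Re ((s%:C * B)^* * B) = s * normc B ^+ 2.
    by rewrite cconjM conj_real -mulrA [B^* * B]mulrC mul_conj -rmorphM.
  by rewrite normcM exprMn normc_real real_normK ?num_real// mulrA.
have := sq_ge0 f; have := sq_ge0 g; move: (sq f) (sq g) key => A C key C0 A0.
have := sqr_ge0 (normc B); move: (normc B ^+ 2) key => b key b0.
have [C1|C1] := eqVneq C 0.
  have [->|b1] := eqVneq b 0; first by rewrite mulr_ge0.
  (* With C = 0 the expression is A - 2 s b, which is -1 for this s. *)
  have := key ((A + 1) / (2 * b)); rewrite C1 mulr0 addr0.
  have -> : 2 * ((A + 1) / (2 * b)) * b = A + 1 by field.
  by clear; lra.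
have Cp : 0 < C by rewrite lt_def C1.
have := key C^-1.
have -> : A - 2 * C^-1 * b + C^-1 ^+ 2 * b * C = (A * C - b) / C by field.
by rewrite pmulr_lge0 ?invr_gt0// subr_ge0.
Qed.

Lemma limn_einf_le (u : nat -> \bar R) (K : \bar R) : (forall n, (u n <= K)%E) ->
  (limn_einf u <= K)%E.
Proof.
move=> uK; rewrite limn_einf_lim; apply: lime_le; first exact: is_cvg_einfs.
apply: nearW => n; apply: le_trans (uK n); apply: ereal_inf_lbound.
by exists n => /=.
Qed.

Lemma clim_sqr_normc (u : nat -> R[i]) l : clim u l ->
  (fun n => normc (u n) ^+ 2) @ \oo --> normc l ^+ 2.
Proof.
move=> ul; rewrite normcE2; under eq_fun do rewrite normcE2.
have hr := clim_Re ul; have hi := clim_Im ul.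
by rewrite !expr2; apply: cvgD; apply: cvgM.
Qed.

(** The only completeness argument: it passes norm bounds to pointwise limits. *)
Lemma L2_fatou (F : nat -> R[i] -> R[i]) f (K : R) : (forall M, L2 (F M)) ->
  (forall M, sq (F M) <= K) -> (forall z, clim (fun M => F M z) (f z)) ->
  L2 f /\ sq f <= K.
Proof.
move=> LF FK Ff.
have mf : cmeas f by apply: (cmeas_clim _ Ff) => M; have [] := LF M.
have H : (\int[gauss]_p (normc (f (cplx p)) ^+ 2)%:E <= K%:E)%E.
  have := @fatou _ _ _ gauss [set: mplane] measurableT
    (fun M p => (normc (F M (cplx p)) ^+ 2)%:E) _ _.
  have -> : (\int[gauss]_p limn_einf (fun M => (normc (F M (cplx p)) ^+ 2)%:E))%E =
     (\int[gauss]_p (normc (f (cplx p)) ^+ 2)%:E)%E.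
    apply: eq_integral => p _.
    have C : (fun M => (normc (F M (cplx p)) ^+ 2)%:E) @ \oo --> (normc (f (cplx p)) ^+ 2)%:E.
      by apply: cvg_EFin; [exact: nearW|exact: clim_sqr_normc].
    by rewrite is_cvg_limn_einfE; [exact/cvg_lim|apply/cvg_ex; eexists; exact: C].
  move=> fat; apply: le_trans (fat _ _) _.
  - by move=> M; apply/measurable_EFinP; apply: measurable_normc2; have [] := LF M.
  - by move=> M p _; rewrite lee_fin sqr_ge0.
  - by apply: limn_einf_le => M; rewrite sq_integral// lee_fin.
have Lf : L2 f by split => //; apply: le_lt_trans H _; rewrite ltry.
by split => //; rewrite -lee_fin -sq_integral.
Qed.

Variable q : nat.
Local Notation b := (fun p => @hermite R p q).

Definition hsum c N : R[i] -> R[i] := \sum_(p < N) c p *: @hermite R p q.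

Lemma L2_hsum c N : L2 (hsum c N).
Proof. by apply: L2_sum => p _; apply/L2Z/L2_hermite. Qed.

Lemma hsumS c N : hsum c N.+1 = hsum c N + c N *: @hermite R N q.
Proof. by rewrite /hsum big_ord_recr. Qed.

Lemma inner_hsum c N g : L2 g -> inner (hsum c N) g = \sum_(p < N) c p * inner (b p) g.
Proof.
move=> Lg; rewrite inner_suml//; last by move=> p _; apply/L2Z/L2_hermite.
by apply: eq_bigr => p _; rewrite innerZl//; exact: L2_hermite.
Qed.

Lemma inner_hsum_hermite c N p : inner (hsum c N) (b p) = if (p < N)%N then c p else 0.
Proof.
rewrite inner_hsum; last exact: L2_hermite.
case: ifP => [pN|pN].
  rewrite (bigD1 (Ordinal pN))//= inner_hermite eqxx mulr1 big1 ?addr0// => j jp.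
  rewrite inner_hermite; case: eqP => [E|_]; last by rewrite mulr0.
  by move/negP: jp; case; apply/eqP/val_inj.
rewrite big1// => j _; rewrite inner_hermite; case: eqP => [E|_]; last by rewrite mulr0.
by move: (ltn_ord j); rewrite E pN.
Qed.

Lemma sq_hermite p : sq (b p) = 1.
Proof. by rewrite /sq inner_hermite eqxx. Qed.

Lemma sq_minus_hsum f N : L2 f ->
  sq (f - hsum (fun p => inner f (b p)) N) =
  sq f - \sum_(p < N) normc (inner f (b p)) ^+ 2.
Proof.
move=> Lf; set c := fun p => _; elim: N => [|N IH].
  by rewrite /hsum !big_ord0 !subr0.
have Lg : L2 (f - hsum c N).
  by rewrite -scaleN1r; apply: L2D => //; apply/L2Z/L2_hsum.
rewrite hsumS opprD addrA sq_sub//; last exact: L2_hermite.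
have -> : inner (f - hsum c N) (b N) = c N.
  rewrite -scaleN1r innerDl//; [|by apply/L2Z/L2_hsum|exact: L2_hermite].
  rewrite innerZl; [|exact: L2_hsum|exact: L2_hermite].
  by rewrite inner_hsum_hermite ltnn mulr0 addr0.
have RE (w : R[i]) : complex.Re (w^* * w) = normc w ^+ 2 by rewrite mulrC mul_conj.
rewrite RE IH sq_hermite mulr1 big_ord_recr/=.
by rewrite -/(c N); ring.
Qed.

Lemma bessel f N : L2 f -> \sum_(p < N) normc (inner f (b p)) ^+ 2 <= sq f.
Proof. by move=> Lf; rewrite -subr_ge0 -sq_minus_hsum// sq_ge0. Qed.

Lemma sq_hsum c N : sq (hsum c N) = \sum_(p < N) normc (c p) ^+ 2.
Proof.
rewrite /sq inner_hsum; last exact: L2_hsum.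
rewrite (raddf_sum (@complex.Re R)); apply: eq_bigr => p _.
rewrite (inner_conj (L2_hsum c N) (L2_hermite R p q)) inner_hsum_hermite ltn_ord.
by rewrite mul_conj.
Qed.

Lemma sq_hsum_diff c N M : (N <= M)%N ->
  sq (hsum c M - hsum c N) = \sum_(p < M) normc (c p) ^+ 2 - \sum_(p < N) normc (c p) ^+ 2.
Proof.
move=> NM; pose c' p := if (p < N)%N then 0 else c p.
have -> : hsum c M - hsum c N = hsum c' M.
  rewrite -(subnKC NM); elim: (M - N)%N => [|m IH].
    rewrite addn0 subrr /hsum big1// => j _.
    by rewrite /c' ltn_ord scale0r.
  by rewrite addnS !hsumS -IH /c' ltnNge leq_addr/= addrAC.
rewrite sq_hsum -!(big_mkord xpredT (fun p => normc (_ p) ^+ 2)).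
rewrite (big_cat_nat (leq0n N) NM)/= (big_cat_nat (leq0n N) NM (F := fun p => normc (c p) ^+ 2))/=.
rewrite [RHS]addrAC subrr add0r big_nat big1 ?add0r => [|j /andP[_ jN]]; last first.
  by rewrite /c' jN normc0 expr0n.
by apply: eq_big_nat => j /andP[Nj _]; rewrite /c' ltnNge Nj.
Qed.

(** The coefficient of z^j zbar^(q-i) in sum_p c_p b_p, which comes from p = j + i. *)
Definition hseries_coef c i j : R[i] :=
  c (j + i)%N * ((hnorm R (j + i) q)^-1)%:C * hcoef R (j + i) q i.

(** The sum of the Hermite series, rearranged by powers of zbar so that it is
    visibly polyanalytic. *)
Definition hseries c : R[i] -> R[i] :=
  \sum_(k < q.+1) @zb R ^+ k * pser (hseries_coef c (q - k)).

Lemma hsum_psum c N z :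
  hsum c N z = \sum_(i < q.+1) z^* ^+ (q - i) * psum (hseries_coef c i) (N - i) z.
Proof.
have E p : (c p *: @hermite R p q) z = \sum_(i < q.+1)
    c p * ((hnorm R p q)^-1)%:C * hcoef R p q i * (z ^+ (p - i) * z^* ^+ (q - i)).
  rewrite hermiteE -[LHS]/(c p * (((hnorm R p q)^-1)%:C * hpoly p q z)) hpolyE.
  by rewrite !mulr_sumr; apply: eq_bigr => i _; rewrite monoE !mulrA.
rewrite /hsum sumfE (eq_bigr _ (fun (p : 'I_N) _ => E p)) exchange_big/=.
apply: eq_bigr => i _; rewrite /psum mulr_sumr.
rewrite -(big_mkord xpredT (fun p => c p * ((hnorm R p q)^-1)%:C * hcoef R p q i *
  (z ^+ (p - i) * z^* ^+ (q - i)))).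
have small p : (p < i)%N -> c p * ((hnorm R p q)^-1)%:C * hcoef R p q i *
    (z ^+ (p - i) * z^* ^+ (q - i)) = 0.
  by move=> pi; rewrite /hcoef ffact_small// mulr0n !mulr0 mul0r.
have [Ni|iN] := leqP N i.
  have -> : (N - i = 0)%N by apply/eqP; rewrite subn_eq0.
  rewrite big_ord0 big_nat big1// => p /andP[_ pN]; apply: small.
  exact: leq_trans pN Ni.
rewrite (big_cat_nat (leq0n i) (ltnW iN))/= big_nat big1 ?add0r => [|p /andP[_]]; last exact: small.
rewrite -{1}[nat_of_ord i]add0n big_addn big_mkord; apply: eq_bigr => j _.
by rewrite addnK /hseries_coef; ring.
Qed.

Lemma pow_fact_le (x : R) j : 0 <= x -> x ^+ j / j`!%:R <= expR x.
Proof.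
move=> x0; case: j => [|j].
  by rewrite expr0 fact0 divr1 -expR0 ler_expR.
by apply: le_trans (expR_ge1Dxn j x0); rewrite lerDr.
Qed.

(** For bounded c the square of the j-th coefficient is at most D (2 r^2)^j / j! after
    multiplication by r^(2j): the two falling factorials lose against the
    factorial under the square root of the normalization. *)
Lemma entire_hseries_coef c (B : R) i : (forall p, normc (c p) <= B) ->
  entire (hseries_coef c i).
Proof.
move=> cB r r0; have B0 : 0 <= B by apply: le_trans (cB 0%N); exact: normc_ge0.
pose D : R := B ^+ 2 * 'C(q, i)%:R ^+ 2 * (i`! * 2 ^ i)%:R.
exists (1 + D * expR (2 * r ^+ 2)) => j.
set X := normc _ * _.
have X0 : 0 <= X by rewrite mulr_ge0 ?normc_ge0// exprn_ge0// ltW.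
suff : X ^+ 2 <= D * expR (2 * r ^+ 2).
  have := sqr_ge0 (X - 1); move: (D * _) => E; clear -X0; nra.
apply: (@le_trans _ _ (D * ((2 * r ^+ 2) ^+ j / j`!%:R))); last first.
  apply: ler_wpM2l; first by rewrite /D !mulr_ge0 ?sqr_ge0.
  by apply: pow_fact_le; rewrite mulr_ge0// sqr_ge0.
have hE : hnorm R (j + i) q ^+ 2 = ((j + i) ^_ i)%:R * j`!%:R * q`!%:R.
  rewrite sqr_sqrtr ?ler0n// natrM -(ffact_fact (leq_addl j i)) addnK natrM.
  by [].
have rrE : (r ^+ j) ^+ 2 = (r ^+ 2) ^+ j by rewrite -!exprM mulnC.
set rr := (r ^+ 2) ^+ j in rrE *.
have XE : X ^+ 2 = normc (c (j + i)%N) ^+ 2 * 'C(q, i)%:R ^+ 2 *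
    (((j + i) ^_ i)%:R / q`!%:R) * rr / j`!%:R.
  rewrite /X /hseries_coef /hcoef !normcM normc_real normrV ?unitfE ?gt_eqF ?hnorm_gt0//.
  rewrite ger0_norm ?ltW ?hnorm_gt0// normc_exp normcN normc1 expr1n mul1r !normc_nat.
  rewrite !exprMn exprVn hE rrE.
  have f0 : ((j + i) ^_ i)%:R != 0 :> R by rewrite pnatr_eq0 -lt0n ffact_gt0 leq_addl.
  have j0 : j`!%:R != 0 :> R by rewrite pnatr_eq0 -lt0n fact_gt0.
  have q0 : q`!%:R != 0 :> R by rewrite pnatr_eq0 -lt0n fact_gt0.
  by field; rewrite f0 j0 q0.
rewrite XE /D exprMn -/rr [X in _ <= X]mulrA.
apply: ler_wpM2r; first by rewrite invr_ge0.
rewrite [X in _ <= X]mulrA; apply: ler_wpM2r; first by rewrite exprn_ge0// sqr_ge0.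
rewrite -[X in _ <= X]mulrA; apply: ler_pM.
- by rewrite mulr_ge0 ?sqr_ge0.
- by rewrite mulr_ge0 ?invr_ge0.
- apply: ler_wpM2r; first exact: sqr_ge0.
  by rewrite ler_pXn2r// ?nnegrE ?normc_ge0.
apply: (@le_trans _ _ ((j + i) ^_ i)%:R).
  by rewrite ler_piMr// invf_le1 ?ltr0n ?fact_gt0// ler1n fact_gt0.
rewrite -natrX -natrM ler_nat -bin_ffact mulnC -mulnA leq_mul2l -expnD addnC leq_bin_exp2.
by rewrite orbT.
Qed.

Lemma clim_subn (u : nat -> R[i]) l i : clim u l -> clim (fun N => u (N - i)%N) l.
Proof.
move=> ul e /ul[N HN]; exists (N + i)%N => n Nn; apply: HN.
by rewrite leq_subRL ?(leq_trans (leq_addl N i))// addnC.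
Qed.

Lemma hsum_clim c (B : R) z : (forall p, normc (c p) <= B) ->
  clim (fun N => hsum c N z) (hseries c z).
Proof.
move=> cB.
have -> : hseries c z = \sum_(i < q.+1) z^* ^+ (q - i) * pser (hseries_coef c i) z.
  rewrite /hseries sumfE (reindex_inj rev_ord_inj); apply: eq_bigr => i _.
  rewrite -[LHS]/((@zb R ^+ rev_ord i) z * pser (hseries_coef c (q - rev_ord i)) z) expfE.
  by rewrite /= subSS subKn// -ltnS.
apply: eq_clim (fun N => hsum_psum c N z) _.
apply: (@clim_sum _ q.+1 (fun i N => z^* ^+ (q - i) * psum (hseries_coef c i) (N - i) z)
  (fun i => z^* ^+ (q - i) * pser (hseries_coef c i) z)) => i.
by apply: climZ; apply: (@clim_subn (fun N => psum (hseries_coef c i) N z)); apply: pserP; exact: entire_hseries_coef cB.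
Qed.

Lemma l2_bounded c (K : R) : (forall N, \sum_(p < N) normc (c p) ^+ 2 <= K) ->
  forall p, normc (c p) <= 1 + K.
Proof.
move=> cK p.
have : normc (c p) ^+ 2 <= K.
  apply: le_trans (cK p.+1); rewrite big_ord_recr/= lerDr.
  by apply: sumr_ge0 => i _; exact: sqr_ge0.
have := normc_ge0 (c p); move: (normc _) => x; clear; nra.
Qed.

(** The partial sums increase to their supremum. *)
Lemma l2_tail c (K e : R) : (forall N, \sum_(p < N) normc (c p) ^+ 2 <= K) -> 0 < e ->
  exists N, forall M, (N <= M)%N ->
  \sum_(p < M) normc (c p) ^+ 2 - \sum_(p < N) normc (c p) ^+ 2 <= e.
Proof.
move=> cK e0; pose S N := \sum_(p < N) normc (c p) ^+ 2.
have hs : has_sup (range S).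
  by split; [exists (S 0%N); exists 0%N|exists K => _ [N _ <-]; exact: cK].
have [_ [N _ <-] HN] := sup_adherent e0 hs.
exists N => M _; rewrite lerBlDl -lerBlDr.
apply: le_trans (ltW HN); rewrite lerD2r; apply: ub_le_sup; first by case: hs.
by exists M.
Qed.

(** Fatou's lemma is applied to the differences of partial sums, with their first
    index fixed. *)
Lemma L2_hseries c (K : R) : (forall N, \sum_(p < N) normc (c p) ^+ 2 <= K) ->
  L2 (hseries c) /\ forall e, 0 < e -> exists N0, forall N, (N0 <= N)%N ->
    sq (hseries c - hsum c N) <= e.
Proof.
move=> cK; have cB := l2_bounded cK.
have key N (e : R) : (forall M, (N <= M)%N ->
    \sum_(p < M) normc (c p) ^+ 2 - \sum_(p < N) normc (c p) ^+ 2 <= e) ->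
    L2 (hseries c - hsum c N) /\ sq (hseries c - hsum c N) <= e.
  move=> H; apply: (@L2_fatou (fun M => hsum c (M + N) - hsum c N)).
  - move=> M; rewrite -scaleN1r; apply: L2D; first exact: L2_hsum.
    by apply/L2Z/L2_hsum.
  - by move=> M; rewrite sq_hsum_diff ?leq_addl// H// leq_addl.
  - by move=> z; apply: climD (clim_cst _); apply: clim_shift (hsum_clim z cB).
split.
  have [|+ _] := @key 0%N K; last by rewrite /hsum big_ord0 subr0.
  by move=> M _; rewrite big_ord0 subr0.
move=> e e0; have [N0 HN0] := l2_tail cK e0; exists N0 => N NN.
have [] // := key N e; move=> M NM; apply: le_trans (HN0 M (leq_trans NN NM)).
rewrite lerD2l lerN2 -!(big_mkord xpredT (fun p => normc (c p) ^+ 2)).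
rewrite (big_cat_nat (leq0n N0) NN)/= lerDl.
by apply: sumr_ge0 => i _; exact: sqr_ge0.
Qed.

Lemma small_le0 (x : R) (C : R) : (forall e, 0 < e -> x <= e * C) -> x <= 0.
Proof.
move=> H; rewrite leNgt; apply/negP => x0.
have C0 : 0 < 1 + `|C| by rewrite ltr_pwDl.
have := H (x / 2 / (1 + `|C|)); rewrite !divr_gt0// => /(_ isT).
have : x / 2 / (1 + `|C|) * C <= x / 2.
  rewrite mulrAC ler_pdivrMr//; apply: ler_wpM2l; first by rewrite divr_ge0// ltW.
  by apply: le_trans (ler_norm C) _; rewrite lerDr.
move: (x / 2 / _ * C) => y; clear -x0; lra.
Qed.

Lemma inner_hseries c (K : R) g (l : R[i]) N1 :
  (forall N, \sum_(p < N) normc (c p) ^+ 2 <= K) -> L2 g ->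
  (forall N, (N1 <= N)%N -> inner (hsum c N) g = l) -> inner (hseries c) g = l.
Proof.
move=> cK Lg gl; have [LG HG] := L2_hseries cK.
suff : normc (inner (hseries c) g - l) ^+ 2 <= 0.
  rewrite le_eqVlt ltNge sqr_ge0 orbF sqrf_eq0 => /eqP/eq0_normc/eqP.
  by rewrite subr_eq0 => /eqP.
apply: (@small_le0 _ (sq g)) => e /HG[N0 HN0].
pose N := maxn N0 N1; rewrite -(gl N) ?leq_maxr//.
have Lh : L2 (- hsum c N) by rewrite -scaleN1r; apply/L2Z/L2_hsum.
have -> : inner (hseries c) g - inner (hsum c N) g = inner (hseries c - hsum c N) g.
  rewrite innerDl//; congr (_ + _); rewrite -[in RHS]scaleN1r innerZl ?mulN1r//.
  exact: L2_hsum.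
apply: le_trans (cauchy_schwarz (L2D LG Lh) Lg) _.
by apply: ler_wpM2r; [exact: sq_ge0|exact/HN0/leq_maxl].
Qed.

(** Partial sums of the Hermite series are orthogonal to F_q and have the right
    coefficients, and both properties pass to limits in L^2. *)
Lemma riesz_fischer c (K : R) : (forall N, \sum_(p < N) normc (c p) ^+ 2 <= K) ->
  true_polyfock q.+1 (hseries c) /\ forall p, inner (hseries c) (b p) = c p.
Proof.
move=> cK; have cB := l2_bounded cK; have [LG _] := L2_hseries cK; split; last first.
  move=> p; apply: (@inner_hseries c K _ _ p.+1) => //; first exact: L2_hermite.
  by move=> N pN; rewrite inner_hsum_hermite pN.
split.
  have [sG nG] := @polyanalytic_sum R q.+1 (fun k => hseries_coef c (q - k))
    (fun k => entire_hseries_coef (q - k) cB).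
  by split.
move=> g Fg; have [_ _ Lg] := Fg.
apply: (@inner_hseries c K _ _ 0%N) => // N _.
rewrite inner_hsum// big1// => p _.
by have [_ ->] := @true_polyfock_hermite R q.+1 p isT; rewrite ?mulr0.
Qed.

Section expansion.
Variable f : R[i] -> R[i].
Hypothesis Ff : true_polyfock q.+1 f.
Let c p := inner f (b p).

Let Lf : L2 f. Proof. by have [[]] := Ff. Qed.
Let cK N : \sum_(p < N) normc (c p) ^+ 2 <= sq f. Proof. exact: bessel. Qed.

(** By Bessel the coefficients of f are square summable; f and the sum of its
    Hermite series have the same coefficients, so completeness identifies them. *)
Lemma hermite_expansion : f = hseries c.
Proof.
have [FG GE] := riesz_fischer cK; have [[_ _ LG] _] := FG.
apply/eqP; rewrite -subr_eq0; apply/eqP; apply: (@true_polyfock_eq0 R q.+1).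
  by rewrite addrC -scaleN1r; exact: true_polyfock_lin.
move=> p; rewrite addrC -scaleN1r inner_linl//; last exact: L2_hermite.
by rewrite GE mulN1r addNr.
Qed.

Lemma hermite_dense (e : R) : 0 < e -> exists N, sq (f - hsum c N) <= e.
Proof.
by have [_ H] := L2_hseries cK; move=> /H[N HN]; exists N; rewrite {1}hermite_expansion HN.
Qed.

Lemma parseval_le (K : R) : (forall N, \sum_(p < N) normc (c p) ^+ 2 <= K) -> sq f <= K.
Proof.
move=> H; rewrite -subr_le0; apply: (@small_le0 _ 1) => e /hermite_dense[N].
rewrite sq_minus_hsum// mulr1 lerBlDr => h; rewrite lerBlDr.
by apply: le_trans h _; rewrite lerD2l; exact: H.
Qed.

End expansion.

End hilbert.

(** * Radial operators *)

Section operators.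
Variables (R : realType) (q : nat).
Local Notation F := (true_fock R q.+1).
Local Notation b := (fun p => @hermite R p q).
Implicit Types (f g : F) (S T : F -> F) (c : R[i]) (tau : circle R).

Lemma fockP f : true_polyfock q.+1 (\val f).
Proof. exact: (asboolP _ (valP f)). Qed.

Definition to_fock (f : R[i] -> R[i]) (Ff : true_polyfock q.+1 f) : F :=
  exist _ f (asboolT Ff).

Lemma L2_fock f : L2 (\val f).
Proof. by have [[]] := fockP f. Qed.

Definition coef f p : R[i] := inner (\val f) (b p).

Lemma coef_lin (a : R[i]) f g p : coef (a *: f + g) p = a * coef f p + coef g p.
Proof. exact: (inner_linl a (L2_fock f) (L2_fock g) (L2_hermite R p q)). Qed.

Lemma fock0E : \val (0 : F) = 0. Proof. by []. Qed.

Lemma coef0 p : coef 0 p = 0.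
Proof. by rewrite /coef fock0E inner0l//; exact: L2_hermite. Qed.

Lemma coefZ (a : R[i]) f p : coef (a *: f) p = a * coef f p.
Proof. by rewrite -[a *: f]addr0 coef_lin coef0 addr0. Qed.

(** Completeness of the Hermite polynomials in F_(n). *)
Lemma coef_inj f g : coef f =1 coef g -> f = g.
Proof.
move=> fg; apply/eqP; rewrite -subr_eq0; apply/eqP/val_inj.
apply: (true_polyfock_eq0 (fockP (f - g))) => p.
rewrite -[LHS]/(coef (f - g) p) addrC -scaleN1r coef_lin fg mulN1r.
exact: addNr.
Qed.

Definition basis p : F := to_fock (@true_polyfock_hermite R q.+1 p isT).

Lemma coef_basis p r : coef (basis p) r = (p == r)%:R.
Proof. exact: inner_hermite. Qed.

Lemma fock_norm_sqr f : fock_norm f ^+ 2 = sq (\val f).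
Proof. by rewrite sqr_sqrtr// sq_ge0. Qed.

Lemma fock_norm_ge0 f : 0 <= fock_norm f. Proof. exact: sqrtr_ge0. Qed.

Lemma fock_norm_basis p : fock_norm (basis p) = 1.
Proof. by rewrite /fock_norm -/(sq _) sq_hermite sqrtr1. Qed.

Lemma fock_normZ (a : R[i]) f : fock_norm (a *: f) = normc a * fock_norm f.
Proof.
apply/eqP; rewrite -(@eqrXn2 _ 2) ?mulr_ge0 ?normc_ge0 ?fock_norm_ge0//.
rewrite exprMn !fock_norm_sqr /sq -[\val (a *: f)]/(a *: \val f).
have L := L2_fock f; rewrite innerZl ?innerZr//; last exact: L2Z.
rewrite mulrA mul_conj (inner_self L) -rmorphM /=.
exact: eqxx.
Qed.

Lemma normc_coef f p : normc (coef f p) <= fock_norm f.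
Proof.
rewrite -(@ler_pXn2r _ 2)// ?nnegrE ?normc_ge0 ?fock_norm_ge0// fock_norm_sqr.
have := cauchy_schwarz (L2_fock f) (L2_hermite R p q).
by rewrite sq_hermite mulr1.
Qed.

Lemma bessel_fock f N : \sum_(p < N) normc (coef f p) ^+ 2 <= fock_norm f ^+ 2.
Proof. by rewrite fock_norm_sqr; exact: bessel (L2_fock f). Qed.

(** Parseval's identity, in the only direction that Bessel does not give. *)
Lemma fock_norm_le f (K : R) : 0 <= K ->
  (forall N, \sum_(p < N) normc (coef f p) ^+ 2 <= K ^+ 2) -> fock_norm f <= K.
Proof.
move=> K0 H; rewrite -(@ler_pXn2r _ 2)// ?nnegrE ?fock_norm_ge0// fock_norm_sqr.
exact: parseval_le (fockP f) _ H.
Qed.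

Lemma bounded_lin S (a : R[i]) f g : bounded_operators S -> S (a *: f + g) = a *: S f + S g.
Proof. by move=> [lS _]; exact: lS. Qed.

Lemma bounded0 S : bounded_operators S -> S 0 = 0.
Proof.
move=> bS; have := bounded_lin (-1) 0 0 bS.
by rewrite scaler0 addr0 scaleN1r addNr.
Qed.

Lemma coef_bounded S : bounded_operators S -> exists2 M : R, 0 <= M &
  forall f p, normc (coef (S f) p) <= M * fock_norm f.
Proof.
move=> [_ [M HM]]; exists `|M| => // f p.
apply: le_trans (normc_coef _ _) _; apply: le_trans (HM f) _.
by apply: ler_wpM2r; [exact: fock_norm_ge0|exact: ler_norm].
Qed.

Definition rest f N : F := f - \sum_(p < N) coef f p *: basis p.

Lemma restS f N : rest f N.+1 = (- coef f N) *: basis N + rest f N.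
Proof. by rewrite /rest big_ord_recr/= opprD addrA addrC scaleNr. Qed.

Lemma val_rest f N : \val (rest f N) = \val f - hsum q (coef f) N.
Proof.
elim: N => [|N IH]; first by rewrite /rest /hsum !big_ord0 !subr0.
rewrite restS -[LHS]/(- coef f N *: b N + \val (rest f N)) IH hsumS opprD scaleNr.
by rewrite addrC addrA.
Qed.

Lemma rest_small f (e : R) : 0 < e -> exists N, fock_norm (rest f N) ^+ 2 <= e.
Proof.
move=> /(hermite_dense (fockP f))[N HN]; exists N.
by rewrite fock_norm_sqr val_rest.
Qed.

(** The defect coef (S f) p - lambda p * coef f p does not change when f is replaced
    by the remainder of its Hermite expansion, whose norm tends to 0. *)
Lemma coef_diagonal S (lambda : nat -> R[i]) : bounded_operators S ->
  (forall p, S (basis p) = lambda p *: basis p) ->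
  forall f p, coef (S f) p = lambda p * coef f p.
Proof.
move=> bS Sb f p; apply/eqP; rewrite -subr_eq0; apply/eqP.
have key N : coef (S f) p - lambda p * coef f p =
    coef (S (rest f N)) p - lambda p * coef (rest f N) p.
  elim: N => [|N ->]; first by rewrite /rest big_ord0 subr0.
  rewrite restS (bounded_lin _ _ _ bS) Sb !coef_lin coefZ coef_basis.
  move: (coef (S (rest f N)) p) (coef (rest f N) p) (coef f N) => u v w {Sb bS}.
  by have [->|_] := eqVneq N p; rewrite ?mulr1n ?mulr0n; ring.
have [M M0 HM] := coef_bounded bS.
set D := _ - _ in key *.
suff : normc D ^+ 2 <= 0.
  by rewrite le_eqVlt ltNge sqr_ge0 orbF sqrf_eq0 => /eqP/eq0_normc.
apply: (@small_le0 _ _ ((M + normc (lambda p)) ^+ 2)) => e /(rest_small f)[N HN].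
have : normc D <= (M + normc (lambda p)) * fock_norm (rest f N).
  rewrite (key N); apply: le_trans (le_normcD _ _) _.
  rewrite normcN normcM mulrDl; apply: lerD => //.
  by apply: ler_wpM2l; [exact: normc_ge0|exact: normc_coef].
move=> H; apply: (@le_trans _ _ (((M + normc (lambda p)) * fock_norm (rest f N)) ^+ 2)).
  rewrite ler_pXn2r// ?nnegrE ?normc_ge0 ?mulr_ge0 ?addr_ge0 ?normc_ge0 ?fock_norm_ge0//.
by rewrite exprMn mulrC; apply: ler_wpM2r; [exact: sqr_ge0|exact: HN].
Qed.

Lemma circle_inv (tau : circle R) : normc (\val tau)^-1 = 1.
Proof. by rewrite normcV (eqP (valP tau)) invr1. Qed.

Lemma hermite_rot p c z : normc c = 1 ->
  hermite p q (c * z) = c ^+ p * c^* ^+ q * hermite p q z.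
Proof.
move=> c1; rewrite hermiteE -[LHS]/(((hnorm R p q)^-1)%:C * hpoly p q (c * z)).
by rewrite hpoly_rot// mulrCA.
Qed.

Lemma coef_rotation tau f p : let c := (\val tau)^-1 in
  coef (@rotation R q.+1 tau f) p = c ^+ p * c^* ^+ q * coef f p.
Proof.
move=> c; have c1 := circle_inv tau.
have L := L2_hermite R p q; rewrite /coef (inner_rot c1 (L2_fock f) L) -/c.
have -> : (fun z => b p (c^* * z)) = (c^* ^+ p * c ^+ q) *: b p.
  by apply/funext => z; rewrite hermite_rot ?normc_conj// conjCK.
by rewrite innerZr//; [rewrite cconjM !cconjX conjCK|exact: L2_fock].
Qed.

(** Let x be the coefficient of index r <> p of S b_p. Commutation with a rotation
    equates the characters of weights p and r on x, and some rotation gives them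
    opposite values. *)
Lemma radial_basis S p : @radial R q.+1 S -> S (basis p) = coef (S (basis p)) p *: basis p.
Proof.
move=> [bS SR]; apply: coef_inj => r; rewrite coefZ coef_basis.
have [<-|/eqP pr] := eqVneq p r; first by rewrite mulr1.
rewrite mulr0; set x := coef _ r.
have [c [c1 cE]] := circle_separates R (nesym pr).
have c0 : c != 0.
  by apply/eqP => c0; move: c1; rewrite c0 normc0 => /eqP; rewrite eq_sym oner_eq0.
have t1 : normc c^-1 == 1 by rewrite normcV c1 invr1.
pose tau : circle R := exist _ c^-1 t1.
have tauE : (\val tau)^-1 = c by rewrite /= invrK.
have rb : rotation tau (basis p) = (c ^+ p * c^* ^+ q) *: basis p.
  apply: coef_inj => s; rewrite coef_rotation tauE coefZ coef_basis.
  by case: eqP => [->|_]; rewrite ?mulr0.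
have := congr1 (fun T => coef (T (basis p)) r) (SR tau).
rewrite /= rb coef_rotation tauE -[_ *: basis p]addr0 (bounded_lin _ _ _ bS) bounded0// addr0.
rewrite coefZ -/x => E.
have cc : c^* * c = 1 by exact: unit_conjK.
have ccX k : c^* ^+ k * c ^+ k = 1 by rewrite -exprMn cc expr1n.
have : x = - x.
  transitivity (c^* ^+ p * c ^+ q * (c ^+ p * c^* ^+ q * x)).
    transitivity ((c^* ^+ p * c ^+ p) * (c^* ^+ q * c ^+ q) * x); last by ring.
    by rewrite !ccX !mul1r.
  rewrite E; transitivity ((c ^+ r * c^* ^+ p) * (c^* ^+ q * c ^+ q) * x); first by ring.
  by rewrite ccX cE mulr1 mulN1r.
by move=> /eqP; rewrite -subr_eq0 opprK -mulr2n mulrn_eq0/= => /eqP.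
Qed.

Lemma coef_radial S f p : @radial R q.+1 S ->
  coef (S f) p = coef (S (basis p)) p * coef f p.
Proof.
move=> RS; have [bS _] := RS.
apply: (coef_diagonal bS (lambda := fun p => coef (S (basis p)) p)) => r.
exact: radial_basis.
Qed.

(** Both S and the rotations act diagonally on Hermite coefficients. *)
Lemma diagonal_radial S (lambda : nat -> R[i]) : bounded_operators S ->
  (forall p, S (basis p) = lambda p *: basis p) -> @radial R q.+1 S.
Proof.
move=> bS Sb; split => // tau; apply/funext => f; apply: coef_inj => p /=.
rewrite (coef_diagonal bS Sb) !coef_rotation (coef_diagonal bS Sb).
by rewrite mulrCA.
Qed.

Lemma radialE : @radial R q.+1 =
  [set S | @bounded_operators R q.+1 S /\ diagonal_wrt (fun p => hermite p q) S].
Proof.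
apply/seteqP; split => S.
  move=> RS; split; first by case: RS.
  exists (fun p => coef (S (basis p)) p) => p; exists (basis p) => //.
  exact: radial_basis.
move=> [bS [lambda H]]; apply: (diagonal_radial (lambda := lambda) bS) => p.
have [f fE Sf] := H p.
by have <- : f = basis p by exact: val_inj.
Qed.

Definition eigenvalues S p : R[i] := coef (S (basis p)) p.

Lemma eigenvalues_le S p (M : R) : @radial R q.+1 S ->
  (forall f, fock_norm (S f) <= M * fock_norm f) -> normc (eigenvalues S p) <= M.
Proof.
move=> RS HM; have := HM (basis p).
by rewrite (radial_basis p RS) fock_normZ fock_norm_basis !mulr1.
Qed.

Lemma multiplier_bessel (x : nat -> R[i]) (M : R) f N : (forall p, normc (x p) <= M) ->
  \sum_(p < N) normc (x p * coef f p) ^+ 2 <= (M * fock_norm f) ^+ 2.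
Proof.
move=> xM; have M0 : 0 <= M by apply: le_trans (xM 0%N); exact: normc_ge0.
rewrite exprMn; apply: (@le_trans _ _ (M ^+ 2 * \sum_(p < N) normc (coef f p) ^+ 2)).
  rewrite mulr_sumr; apply: ler_sum => p _; rewrite normcM exprMn.
  by apply: ler_wpM2r; [exact: sqr_ge0|rewrite ler_pXn2r// ?nnegrE ?normc_ge0//; exact: xM].
by apply: ler_wpM2l; [exact: sqr_ge0|exact: bessel_fock].
Qed.

Lemma radial_norm_le S f (M : R) : @radial R q.+1 S ->
  (forall p, normc (eigenvalues S p) <= M) -> fock_norm (S f) <= M * fock_norm f.
Proof.
move=> RS HM; have M0 : 0 <= M by apply: le_trans (HM 0%N); exact: normc_ge0.
apply: fock_norm_le; first by rewrite mulr_ge0 ?fock_norm_ge0.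
move=> N; under eq_bigr do rewrite coef_radial//.
exact: (@multiplier_bessel (eigenvalues S) M).
Qed.

Lemma eigenvalues_linf S : @radial R q.+1 S -> linf (eigenvalues S).
Proof.
move=> RS; have [[_ [M HM]] _] := RS; exists M => p; exact: eigenvalues_le.
Qed.

(** Multiplying the Hermite coefficients by x is possible by Riesz-Fischer, and is
    bounded by Parseval. *)
Lemma multiplier_exists (x : nat -> R[i]) : linf x ->
  exists2 S, @radial R q.+1 S & eigenvalues S = x.
Proof.
move=> [M xM]; have M0 : 0 <= M by apply: le_trans (xM 0%N); exact: normc_ge0.
have rf f := @riesz_fischer R q (fun p => x p * coef f p) _ (fun N => @multiplier_bessel x M f N xM).
pose S f : F := to_fock (rf f).1.
have SE f p : coef (S f) p = x p * coef f p by exact: (rf f).2.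
have bS : bounded_operators S.
  split.
    by move=> a f g; apply: coef_inj => p; rewrite !(coef_lin, SE); ring.
  exists M => f; apply: fock_norm_le; first by rewrite mulr_ge0 ?fock_norm_ge0.
  by move=> N; under eq_bigr do rewrite SE; exact: (@multiplier_bessel x M).
have Sb p : S (basis p) = x p *: basis p.
  apply: coef_inj => r; rewrite SE coefZ coef_basis.
  by case: eqP => [->|_]; rewrite ?mulr0.
exists S; first exact: diagonal_radial bS Sb.
by apply/funext => p; rewrite /eigenvalues SE coef_basis eqxx mulr1.
Qed.

Lemma eigenvalues_inj S T : @radial R q.+1 S -> @radial R q.+1 T ->
  eigenvalues S = eigenvalues T -> S = T.
Proof.
move=> RS RT E; apply/funext => f; apply: coef_inj => p.
by rewrite coef_radial// [RHS]coef_radial//; congr (_ * _); exact: (congr1 (@^~ p) E).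
Qed.

(** The basis vectors have norm 1, so the eigenvalues are bounded by the operator
    norm; the converse is Parseval. *)
Lemma eigenvalues_norm S : @radial R q.+1 S -> linf_norm (eigenvalues S) = opnorm S.
Proof.
move=> RS; have [[_ [M HM]] _] := RS.
have lM p : normc (eigenvalues S p) <= M by exact: eigenvalues_le.
have M0 : 0 <= M by apply: le_trans (lM 0%N); exact: normc_ge0.
have hs : has_sup (range (fun k => normc (eigenvalues S k))).
  by split; [exists (normc (eigenvalues S 0%N)); exists 0%N|exists M => _ [p _ <-]].
have ho : has_sup [set fock_norm (S f) | f in [set f | fock_norm f <= 1]].
  split.
    by exists (fock_norm (S (basis 0%N))); exists (basis 0%N) => //=; rewrite fock_norm_basis.
  exists M => _ [f f1 <-]; apply: le_trans (HM f) _.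
  by rewrite -[X in _ <= X]mulr1; apply: ler_wpM2l.
apply/eqP; rewrite eq_le; apply/andP; split.
  apply: ge_sup; first by case: hs.
  move=> _ [p _ <-]; apply: ub_le_sup; first by case: ho.
  exists (basis p); first by rewrite /= fock_norm_basis.
  by rewrite (radial_basis p RS) fock_normZ fock_norm_basis mulr1.
apply: ge_sup; first by case: ho.
move=> _ [f /= f1 <-].
have H p : normc (eigenvalues S p) <= linf_norm (eigenvalues S).
  by apply: ub_le_sup; [case: hs|exists p].
apply: le_trans (radial_norm_le f RS H) _.
rewrite -[X in _ <= X]mulr1; apply: ler_wpM2l => //.
by apply: le_trans (H 0%N); exact: normc_ge0.
Qed.

End operators.

Unset Implicit Arguments.
Local Close Scope complex_scope.

Theorem theorem1p2 (R : realType) (n : nat) (n_gt0 : (0 < n)%N) :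
  @radial R n =
    [set S | @bounded_operators R n S /\
             diagonal_wrt (fun p => hermite p n.-1) S] /\
  isometrically_isomorphic
    (@radial R n) (fun S T => S \o T) (@opnorm R n)
    (@linf R) (fun x y => x * y) (@linf_norm R).
Proof.
case: n n_gt0 => // q _; split; first exact: radialE.
exists (@eigenvalues R q); split.
- split.
  + exact: eigenvalues_linf.
  + by move=> S T /set_mem RS /set_mem RT; exact: eigenvalues_inj.
  + by move=> x /(@multiplier_exists R q)[S RS SE]; exists S.
- move=> a S T _ _; apply/funext => p.
  by rewrite -[RHS]/(a * eigenvalues S p + eigenvalues T p) -coef_lin.
- move=> S T RS RT; apply/funext => p.
  by rewrite /eigenvalues /= coef_radial.
- by move=> S RS; exact: eigenvalues_norm.
Qed.
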